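(* Let $f:\mathbb{R}\to\mathbb{R}$ be subpolynomial and a member of a Hardy field. Let $(n_k)_{k\in\mathbb{N}}$ be a rational Besicovitch sequence. Assume that for every $p\in\mathbb{Q}[x]$, $$\lim_{x\to\infty}\frac{\log x}{|f(x)-p(x)|}=0.$$ Then the sequence $\big(f(n_k)\bmod 1\big)_{k\in\mathbb{N}}$ is uniformly distributed.
   Context: $\mathbb{N}=\{1,2,\dots\}$. A germ (at infinity) is an equivalence class of real-valued functions defined for all large enough $x\in\mathbb{R}$, where two functions are equivalent if they agree for all $x>M$ for some $M$. A Hardy field is a collection of germs of smooth functions that forms a field under pointwise addition and multiplication and is closed under differentiation. A function $f$ is subpolynomial if there exists $n\in\mathbb{N}$ with $f(x)/x^n\to0$ as $x\to\infty$. A sequence $(x_n)$ in $[0,1)$ is uniformly distributed if $\lim_{N\to\infty}\frac1N|\{1\le n\le N:x_n\in[a,b)\}|=b-a$ for all $0\le a<b\le1$. A function $g:\mathbb{N}\to\mathbb{C}$ is rational Besicovitch almost periodic if for every $\epsilon>0$ there exist $k\in\mathbb{N}$, $\alpha_1,\dots,\alpha_k\in\mathbb{Q}$ and $c_1,\dots,c_k\in\mathbb{C}$ such that $\limsup_{N\to\infty}\frac1N\sum_{n=1}^N\big|g(n)-\sum_{j=1}^kc_je^{2\pi i\alpha_jn}\big|<\epsilon$. An increasing sequence $(n_k)_{k\in\mathbb{N}}$ in $\mathbb{N}$ is a rational Besicovitch sequence if the indicator function of $A=\{n_k:k\in\mathbb{N}\}$ is rational Besicovitch almost periodic and $A$ has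 positive upper density $\limsup_{N\to\infty}|A\cap\{1,\dots,N\}|/N>0$. *)

(* Defs.v *)
From Stdlib Require Import Reals QArith Qreals List ClassicalDescription.
From Coquelicot Require Import Coquelicot.

Local Open Scope R_scope.

(** * Germs at infinity and Hardy fields

    Germs are represented by total functions [R -> R], whose values on bounded
    sets are irrelevant; a collection of germs is then a predicate on [R -> R]
    that is invariant under [germ_eq]. *)

Definition germ_eq (f g : R -> R) : Prop :=
  Rbar_locally p_infty (fun x => f x = g x).

Definition germ_smooth (f : R -> R) : Prop :=
  exists M : R, forall (n : nat) (x : R), M < x -> ex_derive_n f n x.

(** The neutral elements of a field of smooth germs under the pointwise
    operations are necessarily the constant germs 0 and 1.  The inverse is
    required as a germ [g] with [f * g = 1], because the total function [/ f]
    is not a multiplicative inverse of [f] where [f] vanishes. *)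
Record is_Hardy_field (H : (R -> R) -> Prop) : Prop := {
  hardy_germ : forall f g, germ_eq f g -> H f -> H g;
  hardy_smooth : forall f, H f -> germ_smooth f;
  hardy_zero : H (fun _ => 0);
  hardy_one : H (fun _ => 1);
  hardy_add : forall f g, H f -> H g -> H (fun x => f x + g x);
  hardy_opp : forall f, H f -> H (fun x => - f x);
  hardy_mul : forall f g, H f -> H g -> H (fun x => f x * g x);
  hardy_inv : forall f, H f -> ~ germ_eq f (fun _ => 0) ->
    exists g, H g /\ germ_eq (fun x => f x * g x) (fun _ => 1);
  hardy_derive : forall f, H f -> H (Derive f)
}.

Definition in_some_Hardy_field (f : R -> R) : Prop :=
  exists H : (R -> R) -> Prop, is_Hardy_field H /\ H f.

Definition subpolynomial (f : R -> R) : Prop :=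
  exists n : nat, (1 <= n)%nat /\ is_lim (fun x => f x / x ^ n) p_infty 0.

(** Elements of Q[x] are given by their lists of coefficients, constant
    coefficient first. *)
Definition Qpoly_eval (p : list Q) (x : R) : R :=
  fold_right (fun (c : Q) (v : R) => Q2R c + x * v) 0 p.

(** * Sequences

    Sequences indexed by N = {1, 2, ...} are functions on [nat] whose value at
    0 is ignored. *)

Definition indicator (A : nat -> Prop) (n : nat) : R :=
  if excluded_middle_informative (A n) then 1 else 0.

(** Number of [n] in {1, ..., N} satisfying [P]. *)
Definition count_upto (P : nat -> Prop) (N : nat) : nat :=
  length (filter (fun n => if excluded_middle_informative (P n)
                           then true else false) (seq 1 N)).

(** Meant for sequences with values in [0, 1). *)
Definition uniformly_distributed (x : nat -> R) : Prop :=
  forall a b : R, 0 <= a -> a < b -> b <= 1 ->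
    is_lim_seq (fun N => INR (count_upto (fun n => a <= x n < b) N) / INR N)
               (b - a).

(** [expi t] is e^(i t). *)
Definition expi (t : R) : C := (cos t, sin t).

Definition rational_trig_poly (k : nat) (alpha : nat -> Q) (c : nat -> C)
    (n : nat) : C :=
  sum_n_m (fun j => Cmult (c j) (expi (2 * PI * Q2R (alpha j) * INR n))) 1 k.

Definition rational_Besicovitch_ap (g : nat -> C) : Prop :=
  forall eps : R, 0 < eps ->
    exists (k : nat) (alpha : nat -> Q) (c : nat -> C),
      (1 <= k)%nat /\
      Rbar_lt
        (LimSup_seq (fun N =>
           sum_n_m (fun n => Cmod (Cminus (g n) (rational_trig_poly k alpha c n)))
                   1 N / INR N))
        eps.

Definition upper_density (A : nat -> Prop) : Rbar :=
  LimSup_seq (fun N => INR (count_upto A N) / INR N).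

Definition seq_range (u : nat -> nat) (m : nat) : Prop :=
  exists k : nat, (1 <= k)%nat /\ u k = m.

Definition rational_Besicovitch_sequence (u : nat -> nat) : Prop :=
  (forall k : nat, (1 <= k)%nat -> (1 <= u k)%nat) /\
  (forall k : nat, (1 <= k)%nat -> (u k < u (S k))%nat) /\
  rational_Besicovitch_ap (fun m => RtoC (indicator (seq_range u) m)) /\
  Rbar_lt 0 (upper_density (seq_range u)).

(* Main.v *)
Require Import Defs.
From Stdlib Require Import Reals QArith List.
From Stdlib Require Import Qreals ZArith Lra Lia Psatz Ranalysis5.
From Stdlib Require Import Classical ClassicalDescription FunctionalExtensionality.
From Coquelicot Require Import Coquelicot.
Local Open Scope R_scope.

(** Write [e t] for exp(2 pi i t).  By Weyl's criterion ([Weyl_criterion]) it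
    suffices that the averages of [e (h f(n_k))] tend to zero for [h >= 1].  The
    indicator function of [A = {n_k}] is approximated in mean by trigonometric
    polynomials with rational frequencies, so the averages of [1_A(n) e (h f(n))]
    tend to zero as soon as those of [e (h f(n) + alpha n)] do for every rational
    [alpha] ([Besicovitch_mean_zero]).  Averaging over [A] instead of over all
    integers costs only a constant factor, because the averages of an almost
    periodic function converge, so that [A] has positive lower density.  Finally
    [h f + alpha x] is as far from the rational polynomials as [f] is.  What
    remains is Boshernitzan's theorem ([mean_zero_e_of_vanishing_derivative]): if
    [f - p] grows faster than the logarithm for all rational polynomials [p], then
    [e (f(n))] has mean zero.

    On the side of germs, all work takes place in the ring [H[x]] of polynomials
    over the Hardy field [H] of [f].  Its elements have a definite sign near
    infinity ([poly_over_sign]); hence they are monotone and have limits, and any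
    two of them can be compared.  Subpolynomial growth makes [f^(d)] tend to zero
    for some [d], and the proof is by induction on [d].  Let [c] be the limit of
    [f^(d-1)].

    - If [d = 1], comparison with the logarithm shows that [1 / f'] has derivative
      tending to zero, and Fejer's criterion ([mean_zero_e_Fejer]) applies.
    - If [c] is irrational, van der Corput differencing, [d - 2] times, leads to
      sequences whose increments converge to a nonzero integer multiple of [c].
    - If [c] is infinite, differencing leads to sequences whose increments tend to
      infinity with steps tending to zero.  They may do so very slowly, as for
      [x log log x], and then classical criteria that ask for [x f'' -> oo] do not
      apply.  The criterion [mean_zero_e_second_difference] only asks that
      [f' = o(x sqrt(f''))], which [ring_slow_ratio] derives from [f' -> oo] and
      [f'' -> 0] in a Hardy field.
    - If [c] is rational, the leading term [q x^(d-1)] is subtracted.  The factor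
      [e (q n^(d-1))] is periodic in [n], hence a combination of characters
      [e (a n / Q)], and the induction hypothesis applies to
      [f - q x^(d-1) + (a / Q) x].  For [d = 2] the twist would spoil the
      induction, but there the increments of [f(n)] converge to [c], which settles
      the case of nonintegral [c] and makes the twist trivial for integral [c].

    All three criteria for exponential sums exhibit an approximate discrete
    primitive of [e (u n)] that grows slower than [n]
    ([mean_zero_of_primitive]). *)

(** * The character e(t) of R/Z *)

Definition e (t : R) : C := expi (2 * PI * t).

Lemma e_plus s t : e (s + t) = Cmult (e s) (e t).
Proof.
  unfold e, expi, Cmult; simpl.
  replace (2 * PI * (s + t)) with (2 * PI * s + 2 * PI * t) by ring.
  rewrite cos_plus, sin_plus; f_equal; ring.
Qed.

Lemma e_opp t : e (- t) = Cconj (e t).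
Proof.
  unfold e, expi, Cconj; simpl.
  replace (2 * PI * - t) with (- (2 * PI * t)) by ring.
  rewrite cos_neg, sin_neg; reflexivity.
Qed.

Lemma e_0 : e 0 = 1.
Proof.
  unfold e, expi; rewrite Rmult_0_r, cos_0, sin_0; reflexivity.
Qed.

Lemma Cmod_e t : Cmod (e t) = 1.
Proof.
  unfold Cmod, e, expi; cbn [fst snd].
  pose proof (sin2_cos2 (2 * PI * t)) as H; unfold Rsqr in H.
  replace (cos (2 * PI * t) ^ 2 + sin (2 * PI * t) ^ 2) with 1 by (rewrite <- H; ring).
  apply sqrt_1.
Qed.

Lemma e_conj_l t : Cmult (Cconj (e t)) (e t) = 1.
Proof.
  rewrite <- e_opp, <- e_plus.
  replace (- t + t) with 0 by ring. apply e_0.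
Qed.

Lemma e_minus s t : e (s - t) = Cmult (e s) (Cconj (e t)).
Proof. unfold Rminus; rewrite e_plus, e_opp; reflexivity. Qed.

Lemma e_INR n : e (INR n) = 1.
Proof.
  unfold e, expi.
  replace (2 * PI * INR n) with (0 + 2 * INR n * PI) by ring.
  rewrite cos_period, sin_period, cos_0, sin_0; reflexivity.
Qed.

Lemma e_IZR k : e (IZR k) = 1.
Proof.
  destruct (Z_le_gt_dec 0 k) as [Hk|Hk].
  - rewrite <- (Z2Nat.id k Hk), <- INR_IZR_INZ; apply e_INR.
  - replace k with (- (- k))%Z by lia.
    rewrite opp_IZR, e_opp, <- (Z2Nat.id (- k)) by lia.
    rewrite <- INR_IZR_INZ, e_INR.
    unfold Cconj; simpl. rewrite Ropp_0. reflexivity.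
Qed.

Lemma e_period t k : e (t + IZR k) = e t.
Proof. rewrite e_plus, e_IZR. ring. Qed.

Lemma Cmod_e_sub_1 t : Cmod (Cminus (e t) 1) = 2 * Rabs (sin (PI * t)).
Proof.
  unfold Cmod, e, expi, Cminus, Cplus, Copp; cbn [fst snd RtoC].
  replace (2 * PI * t) with (2 * (PI * t)) by ring.
  rewrite cos_2a_sin, sin_2a.
  set (s := sin (PI * t)); set (c := cos (PI * t)).
  assert (Hsc : c * c = 1 - s * s).
  { pose proof (sin2_cos2 (PI * t)) as H; unfold Rsqr in H; fold s c in H; lra. }
  replace ((1 - 2 * s * s + - (1)) ^ 2 + (2 * s * c + - 0) ^ 2)
    with ((2 * s) ^ 2 * (s * s + c * c)) by ring.
  rewrite Hsc.
  replace ((2 * s) ^ 2 * (s * s + (1 - s * s))) with (Rsqr (2 * s)) by (unfold Rsqr; ring).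
  rewrite sqrt_Rsqr_abs, Rabs_mult, (Rabs_pos_eq 2) by lra.
  reflexivity.
Qed.

Lemma sin_le_id x : 0 <= x -> sin x <= x.
Proof.
  intros Hx; destruct (Req_dec x 0) as [->|Hx0].
  - rewrite sin_0; lra.
  - left; apply sin_lt_x; lra.
Qed.

Lemma Rabs_sin_le x : Rabs (sin x) <= Rabs x.
Proof.
  assert (H : forall y, 0 <= y -> Rabs (sin y) <= y).
  { intros y Hy; destruct (Rle_dec y 1) as [H1|H1].
    - rewrite Rabs_pos_eq; [now apply sin_le_id|].
      apply sin_ge_0; [exact Hy|]. pose proof PI2_1; lra.
    - apply Rle_trans with 1; [|lra].
      apply Rabs_le; pose proof (SIN_bound y); lra. }
  destruct (Rle_dec 0 x) as [Hx|Hx].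
  - rewrite (Rabs_pos_eq x Hx); auto.
  - rewrite <- (Rabs_Ropp (sin x)), <- sin_neg, (Rabs_left x) by lra.
    apply H; lra.
Qed.

Lemma Cmod_e_sub_e s t : Cmod (Cminus (e s) (e t)) <= 2 * PI * Rabs (s - t).
Proof.
  replace (Cminus (e s) (e t)) with (Cmult (e t) (Cminus (e (s - t)) 1)).
  - rewrite Cmod_mult, Cmod_e, Cmod_e_sub_1, Rmult_1_l.
    apply Rle_trans with (2 * Rabs (PI * (s - t))).
    + apply Rmult_le_compat_l; [lra|apply Rabs_sin_le].
    + rewrite Rabs_mult, (Rabs_pos_eq PI); [lra|left; apply PI_RGT_0].
  - rewrite e_minus.
    replace (Cmult (e t) (Cminus (Cmult (e s) (Cconj (e t))) 1))
      with (Cminus (Cmult (Cmult (Cconj (e t)) (e t)) (e s)) (e t)) by ring.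
    rewrite e_conj_l; ring.
Qed.


Lemma Rabs_le_Cmod_e_sub_1 t : Rabs t <= 1 / 2 -> Rabs t <= Cmod (Cminus (e t) 1).
Proof.
  intros Ht.
  assert (H : forall s, 0 <= s <= 1 / 2 -> s <= 2 * Rabs (sin (PI * s))).
  { intros s Hs.
    pose proof PI2_3_2 as HP3. pose proof PI_4 as HP4.
    assert (Ha : 0 <= PI * s <= 2) by nra.
    (* The Taylor bound [sin a >= a - a^3 / 6], with [a <= 2]. *)
    destruct (sin_bound (PI * s) 0) as [Hsin _]; [lra|lra|].
    unfold sin_approx, sin_term in Hsin; simpl in Hsin.
    rewrite Rabs_pos_eq by (apply sin_ge_0; lra).
    set (y := PI * s) in *.
    assert (H3 : y / 3 <= sin y) by nra.
    unfold y in *; nra. }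
  rewrite Cmod_e_sub_1.
  destruct (Rle_dec 0 t) as [H0|H0].
  - rewrite (Rabs_pos_eq t) in * by exact H0. apply H; lra.
  - rewrite (Rabs_left t) in * by lra.
    replace (PI * t) with (- (PI * - t)) by ring.
    rewrite sin_neg, Rabs_Ropp. apply H; lra.
Qed.

Lemma Cmod_e_sub_1_away (d t : R) :
  0 <= d -> d <= Rabs t <= 1 - d -> d <= Cmod (Cminus (e t) 1).
Proof.
  intros Hd Ht. destruct (Rle_dec (Rabs t) (1 / 2)) as [H|H].
  - apply Rle_trans with (Rabs t); [lra|now apply Rabs_le_Cmod_e_sub_1].
  - assert (Hk : exists k : Z, Rabs (t + IZR k) = 1 - Rabs t).
    { destruct (Rle_dec 0 t) as [H0|H0].
      - exists (-1)%Z. rewrite (Rabs_pos_eq t) in * by exact H0.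
        rewrite Rabs_left1 by lra. lra.
      - exists 1%Z. rewrite (Rabs_left t) in * by lra.
        rewrite Rabs_pos_eq; lra. }
    destruct Hk as [k Hk].
    rewrite <- (e_period t k).
    apply Rle_trans with (Rabs (t + IZR k)); [lra|].
    apply Rabs_le_Cmod_e_sub_1; lra.
Qed.

Lemma nearest_integer t : exists k : Z, Rabs (t - IZR k) <= 1 / 2.
Proof.
  exists (Int_part (t + 1 / 2)).
  destruct (base_Int_part (t + 1 / 2)) as [H1 H2].
  apply Rabs_le; lra.
Qed.

Lemma e_eq_1_integer t : e t = 1 -> exists k : Z, t = IZR k.
Proof.
  intros H. destruct (nearest_integer t) as [k Hk]. exists k.
  assert (H' : e (t - IZR k) = 1).
  { unfold Rminus. rewrite <- opp_IZR, e_period. exact H. }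
  pose proof (Rabs_le_Cmod_e_sub_1 _ Hk) as H1.
  rewrite H' in H1. replace (Cminus 1 1) with (RtoC 0) in H1 by ring.
  rewrite Cmod_0 in H1.
  destruct (Req_dec (t - IZR k) 0) as [H0|H0]; [lra|].
  pose proof (Rabs_pos_lt _ H0). lra.
Qed.

(** * Finite sums and sequences with mean zero *)

Fixpoint csum (z : nat -> C) (N : nat) : C :=
  match N with
  | O => 0
  | S M => Cplus (csum z M) (z (S M))
  end.

Fixpoint rsum (r : nat -> R) (N : nat) : R :=
  match N with
  | O => 0
  | S M => rsum r M + r (S M)
  end.

Lemma csum_ext z w N :
  (forall n, (1 <= n <= N)%nat -> z n = w n) -> csum z N = csum w N.
Proof.
  induction N as [|N IH]; intros H; simpl; [reflexivity|].
  rewrite (H (S N)) by lia. rewrite IH by (intros; apply H; lia). reflexivity.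
Qed.

Lemma csum_plus z w N :
  csum (fun n => Cplus (z n) (w n)) N = Cplus (csum z N) (csum w N).
Proof. induction N as [|N IH]; simpl; [|rewrite IH]; ring. Qed.

Lemma csum_scal c z N : csum (fun n => Cmult c (z n)) N = Cmult c (csum z N).
Proof. induction N as [|N IH]; simpl; [|rewrite IH]; ring. Qed.

Lemma csum_minus z w N :
  csum (fun n => Cminus (z n) (w n)) N = Cminus (csum z N) (csum w N).
Proof. induction N as [|N IH]; simpl; [|rewrite IH]; ring. Qed.

Lemma csum_conj z N : csum (fun n => Cconj (z n)) N = Cconj (csum z N).
Proof.
  induction N as [|N IH]; simpl.
  - unfold Cconj; simpl; now rewrite Ropp_0.
  - now rewrite IH, Cplus_conj.
Qed.

Lemma csum_const c N : csum (fun _ => c) N = Cmult (RtoC (INR N)) c.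
Proof.
  induction N as [|N IH]; [simpl; ring|].
  cbn [csum]. rewrite IH, S_INR, RtoC_plus. ring.
Qed.

Lemma csum_exchange (z : nat -> nat -> C) N K :
  csum (fun n => csum (fun k => z n k) K) N = csum (fun k => csum (fun n => z n k) N) K.
Proof.
  induction N as [|N IH]; simpl.
  - induction K as [|K IHK]; simpl; [reflexivity|]. rewrite <- IHK; ring.
  - rewrite IH, <- csum_plus. reflexivity.
Qed.

Lemma csum_telescope (F : nat -> C) N :
  csum (fun n => Cminus (F (S n)) (F n)) N = Cminus (F (S N)) (F 1%nat).
Proof. induction N as [|N IH]; simpl; [|rewrite IH]; ring. Qed.

Lemma csum_shift z k N :
  csum (fun n => z (n + k)%nat) N = Cminus (csum z (N + k)) (csum z k).
Proof. induction N as [|N IH]; simpl; [|rewrite IH]; ring. Qed.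

Lemma csum_RtoC r N : csum (fun n => RtoC (r n)) N = RtoC (rsum r N).
Proof.
  induction N as [|N IH]; simpl; [reflexivity|]. now rewrite IH, RtoC_plus.
Qed.

Lemma rsum_ext r s N :
  (forall n, (1 <= n <= N)%nat -> r n = s n) -> rsum r N = rsum s N.
Proof.
  induction N as [|N IH]; intros H; simpl; [reflexivity|].
  rewrite (H (S N)) by lia. rewrite IH by (intros; apply H; lia). reflexivity.
Qed.

Lemma rsum_le r s N :
  (forall n, (1 <= n <= N)%nat -> r n <= s n) -> rsum r N <= rsum s N.
Proof.
  induction N as [|N IH]; intros H; simpl; [lra|].
  apply Rplus_le_compat; [apply IH; intros; apply H; lia|apply H; lia].
Qed.

Lemma rsum_plus r s N : rsum (fun n => r n + s n) N = rsum r N + rsum s N.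
Proof. induction N as [|N IH]; simpl; [|rewrite IH]; ring. Qed.

Lemma rsum_scal c r N : rsum (fun n => c * r n) N = c * rsum r N.
Proof. induction N as [|N IH]; simpl; [|rewrite IH]; ring. Qed.

Lemma rsum_const c N : rsum (fun _ => c) N = INR N * c.
Proof.
  induction N as [|N IH]; [simpl; ring|].
  cbn [rsum]. rewrite IH, S_INR. ring.
Qed.

Lemma rsum_pos r N : (forall n, (1 <= n <= N)%nat -> 0 <= r n) -> 0 <= rsum r N.
Proof.
  intros H. replace 0 with (rsum (fun _ => 0) N) by (rewrite rsum_const; ring).
  now apply rsum_le.
Qed.

Lemma rsum_telescope (F : nat -> R) N :
  rsum (fun n => F (S n) - F n) N = F (S N) - F 1%nat.
Proof. induction N as [|N IH]; simpl; [|rewrite IH]; ring. Qed.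

Lemma Cmod_csum_le z N : Cmod (csum z N) <= rsum (fun n => Cmod (z n)) N.
Proof.
  induction N as [|N IH]; simpl; [rewrite Cmod_0; lra|].
  eapply Rle_trans; [apply Cmod_triangle|lra].
Qed.

Lemma Rabs_rsum_le r N : Rabs (rsum r N) <= rsum (fun n => Rabs (r n)) N.
Proof.
  induction N as [|N IH]; simpl; [rewrite Rabs_R0; lra|].
  eapply Rle_trans; [apply Rabs_triang|lra].
Qed.

Lemma eventually_le_INR (c : R) : exists N0, forall N, (N0 <= N)%nat -> c <= INR N.
Proof.
  destruct (INR_unbounded c) as [N0 HN0]. exists N0. intros N HN.
  apply le_INR in HN. lra.
Qed.

(** Cesaro's lemma, one-sided because it is applied to nonnegative errors. *)
Lemma rsum_null r :
  (forall eps, 0 < eps -> exists n0, forall n, (n0 <= n)%nat -> r n <= eps) ->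
  forall eps, 0 < eps -> exists N0, forall N, (N0 <= N)%nat -> rsum r N <= eps * INR N.
Proof.
  intros Hr eps Heps. destruct (Hr (eps / 2)) as [n0 Hn0]; [lra|].
  destruct (eventually_le_INR (2 * rsum r n0 / eps)) as [N1 HN1].
  exists (Nat.max n0 N1). intros N HN.
  assert (H : rsum r N <= rsum r n0 + eps / 2 * INR (N - n0)).
  { assert (Hk : forall k, rsum r (n0 + k) <= rsum r n0 + eps / 2 * INR k).
    { induction k as [|k IH]; [rewrite Nat.add_0_r; simpl; lra|].
      rewrite Nat.add_succ_r; cbn [rsum]. rewrite S_INR.
      pose proof (Hn0 (S (n0 + k)) ltac:(lia)). lra. }
    replace N with (n0 + (N - n0))%nat at 1 by lia. apply Hk. }
  specialize (HN1 N ltac:(lia)).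
  assert (HNle : INR (N - n0) <= INR N) by (apply le_INR; lia).
  assert (H2 : 2 * rsum r n0 <= eps * INR N).
  { apply (Rmult_le_compat_r eps) in HN1; [|lra].
    replace (2 * rsum r n0 / eps * eps) with (2 * rsum r n0) in HN1 by (field; lra). lra. }
  nra.
Qed.

Definition mean_zero (z : nat -> C) : Prop :=
  forall eps, 0 < eps ->
    exists N0, forall N, (N0 <= N)%nat -> Cmod (csum z N) <= eps * INR N.

Lemma mean_zero_ext z w :
  (forall n, (1 <= n)%nat -> z n = w n) -> mean_zero z -> mean_zero w.
Proof.
  intros H Hz eps Heps. destruct (Hz eps Heps) as [N0 HN0]. exists N0. intros N HN.
  rewrite <- (csum_ext z w) by (intros; apply H; lia). now apply HN0.
Qed.

Lemma mean_zero_0 : mean_zero (fun _ => 0).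
Proof.
  intros eps Heps. exists 0%nat. intros N _.
  rewrite csum_const, Cmult_0_r, Cmod_0.
  apply Rmult_le_pos; [lra|apply pos_INR].
Qed.

Lemma mean_zero_plus z w :
  mean_zero z -> mean_zero w -> mean_zero (fun n => Cplus (z n) (w n)).
Proof.
  intros Hz Hw eps Heps.
  destruct (Hz (eps / 2)) as [N1 H1]; [lra|]. destruct (Hw (eps / 2)) as [N2 H2]; [lra|].
  exists (Nat.max N1 N2). intros N HN.
  rewrite csum_plus. eapply Rle_trans; [apply Cmod_triangle|].
  specialize (H1 N ltac:(lia)). specialize (H2 N ltac:(lia)). lra.
Qed.

Lemma mean_zero_scal c z : mean_zero z -> mean_zero (fun n => Cmult c (z n)).
Proof.
  intros Hz eps Heps. pose proof (Cmod_ge_0 c) as Hc.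
  destruct (Hz (eps / (Cmod c + 1))) as [N0 HN0]; [apply Rdiv_lt_0_compat; lra|].
  exists N0. intros N HN. rewrite csum_scal, Cmod_mult.
  specialize (HN0 N HN). pose proof (Cmod_ge_0 (csum z N)).
  apply Rle_trans with ((Cmod c + 1) * (eps / (Cmod c + 1) * INR N)).
  - apply Rmult_le_compat; lra.
  - right; field; lra.
Qed.

Lemma mean_zero_conj z : mean_zero z -> mean_zero (fun n => Cconj (z n)).
Proof.
  intros Hz eps Heps. destruct (Hz eps Heps) as [N0 HN0]. exists N0. intros N HN.
  rewrite csum_conj, Cmod_conj. now apply HN0.
Qed.

Lemma mean_zero_csum (z : nat -> nat -> C) K :
  (forall k, (1 <= k <= K)%nat -> mean_zero (fun n => z n k)) ->
  mean_zero (fun n => csum (fun k => z n k) K).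
Proof.
  induction K as [|K IH]; intros H; simpl.
  - apply mean_zero_0.
  - apply mean_zero_plus; [apply IH; intros; apply H; lia|apply H; lia].
Qed.

Lemma mean_zero_shift k z : mean_zero z -> mean_zero (fun n => z (n + k)%nat).
Proof.
  intros Hz eps Heps. destruct (Hz (eps / 2)) as [N0 HN0]; [lra|].
  destruct (eventually_le_INR (INR k + 2 * Cmod (csum z k) / eps)) as [N1 HN1].
  exists (Nat.max N0 N1). intros N HN.
  rewrite csum_shift. unfold Cminus. eapply Rle_trans; [apply Cmod_triangle|].
  rewrite Cmod_opp.
  specialize (HN0 (N + k)%nat ltac:(lia)). specialize (HN1 N ltac:(lia)).
  rewrite plus_INR in HN0.
  assert (H2 : eps * INR k + 2 * Cmod (csum z k) <= eps * INR N).
  { apply (Rmult_le_compat_l eps) in HN1; [|lra].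
    replace (eps * (INR k + 2 * Cmod (csum z k) / eps))
      with (eps * INR k + 2 * Cmod (csum z k)) in HN1 by (field; lra). lra. }
  lra.
Qed.

Lemma mean_zero_unshift k z : mean_zero (fun n => z (n + k)%nat) -> mean_zero z.
Proof.
  intros Hz eps Heps. destruct (Hz (eps / 2)) as [N0 HN0]; [lra|].
  destruct (eventually_le_INR (2 * Cmod (csum z k) / eps)) as [N1 HN1].
  exists (Nat.max (N0 + k) N1). intros N HN.
  specialize (HN0 (N - k)%nat ltac:(lia)). specialize (HN1 N ltac:(lia)).
  rewrite csum_shift in HN0. replace (N - k + k)%nat with N in HN0 by lia.
  assert (HNk : INR (N - k) <= INR N) by (apply le_INR; lia).
  assert (H2 : 2 * Cmod (csum z k) <= eps * INR N).
  { apply (Rmult_le_compat_l eps) in HN1; [|lra].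
    replace (eps * (2 * Cmod (csum z k) / eps)) with (2 * Cmod (csum z k)) in HN1
      by (field; lra). lra. }
  replace (csum z N) with (Cplus (Cminus (csum z N) (csum z k)) (csum z k)) by ring.
  eapply Rle_trans; [apply Cmod_triangle|]. nra.
Qed.

(** The sum of [F (n + 1) - F n] telescopes, so [F] acts as an approximate
    discrete primitive of [z]. *)
Lemma mean_zero_of_primitive (F z : nat -> C) :
  (forall eps, 0 < eps -> exists N0, forall N, (N0 <= N)%nat ->
     Cmod (F (S N)) <= eps * INR N) ->
  (forall eps, 0 < eps -> exists N0, forall N, (N0 <= N)%nat ->
     rsum (fun n => Cmod (Cminus (Cminus (F (S n)) (F n)) (z n))) N <= eps * INR N) ->
  mean_zero z.
Proof.
  intros HF Hr eps Heps.
  destruct (HF (eps / 3)) as [N1 H1]; [lra|]. destruct (Hr (eps / 3)) as [N2 H2]; [lra|].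
  destruct (eventually_le_INR (3 * Cmod (F 1%nat) / eps)) as [N3 H3].
  exists (Nat.max N1 (Nat.max N2 N3)). intros N HN.
  specialize (H1 N ltac:(lia)). specialize (H2 N ltac:(lia)). specialize (H3 N ltac:(lia)).
  assert (H4 : Cmod (F 1%nat) <= eps / 3 * INR N).
  { apply (Rmult_le_compat_l (eps / 3)) in H3; [|lra].
    replace (eps / 3 * (3 * Cmod (F 1%nat) / eps)) with (Cmod (F 1%nat)) in H3
      by (field; lra). lra. }
  set (d := fun n => Cminus (Cminus (F (S n)) (F n)) (z n)).
  change (rsum (fun n => Cmod (d n)) N <= eps / 3 * INR N) in H2.
  replace (csum z N) with (Cplus (F (S N)) (Copp (Cplus (F 1%nat) (csum d N)))).
  - eapply Rle_trans; [apply Cmod_triangle|]. rewrite Cmod_opp.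
    pose proof (Cmod_triangle (F 1%nat) (csum d N)).
    pose proof (Cmod_csum_le d N). lra.
  - unfold d. rewrite csum_minus, csum_telescope. ring.
Qed.

Lemma mean_zero_of_primitive_null (F z : nat -> C) :
  (forall eps, 0 < eps -> exists N0, forall N, (N0 <= N)%nat ->
     Cmod (F (S N)) <= eps * INR N) ->
  (forall eps, 0 < eps -> exists n0, forall n, (n0 <= n)%nat ->
     Cmod (Cminus (Cminus (F (S n)) (F n)) (z n)) <= eps) ->
  mean_zero z.
Proof.
  intros HF Hr. apply mean_zero_of_primitive with F; [exact HF|].
  now apply rsum_null.
Qed.

(** * Exponential sums along slowly varying sequences *)

Lemma is_lim_seq_eps (v : nat -> R) (l : R) :
  is_lim_seq v l ->
  forall eps, 0 < eps -> exists n0, forall n, (n0 <= n)%nat -> Rabs (v n - l) <= eps.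
Proof.
  intros H eps Heps. apply is_lim_seq_spec in H.
  destruct (H (mkposreal eps Heps)) as [n0 Hn0]. exists n0. intros n Hn.
  left. now apply Hn0.
Qed.

Lemma eps_is_lim_seq (v : nat -> R) (l : R) :
  (forall eps, 0 < eps -> exists n0, forall n, (n0 <= n)%nat -> Rabs (v n - l) <= eps) ->
  is_lim_seq v l.
Proof.
  intros H. apply is_lim_seq_spec. intros [eps Heps].
  destruct (H (eps / 2)) as [n0 Hn0]; [lra|]. exists n0. intros n Hn.
  specialize (Hn0 n Hn). simpl. lra.
Qed.

(** If the increments were equal to [beta], the sequence would be geometric and
    [e (u n) / (e beta - 1)] an exact primitive. *)
Lemma mean_zero_e_of_difference (u : nat -> R) (beta : R) :
  is_lim_seq (fun n => u (S n) - u n) beta ->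
  (forall k : Z, beta <> IZR k) ->
  mean_zero (fun n => e (u n)).
Proof.
  intros Hu Hbeta.
  assert (Hq : Cminus (e beta) 1 <> 0).
  { intros H. apply Cminus_eq_contra in H; [easy|].
    intros H1. destruct (e_eq_1_integer _ H1) as [k Hk]. now apply (Hbeta k). }
  pose proof (proj1 (Cmod_gt_0 _) Hq) as Hq0.
  set (q := Cminus (e beta) 1) in *.
  apply mean_zero_of_primitive_null with (F := fun n => Cdiv (e (u n)) q).
  - intros eps Heps.
    destruct (eventually_le_INR (/ Cmod q / eps)) as [N0 HN0]. exists N0. intros N HN.
    rewrite Cmod_div, Cmod_e by exact Hq.
    specialize (HN0 N HN). apply (Rmult_le_compat_l eps) in HN0; [|lra].
    replace (eps * (/ Cmod q / eps)) with (1 / Cmod q) in HN0 by (field; lra). exact HN0.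
  - intros eps Heps.
    pose proof PI_RGT_0 as HPI.
    destruct (is_lim_seq_eps _ _ Hu (eps * Cmod q / (2 * PI))) as [n0 Hn0].
    { apply Rdiv_lt_0_compat; nra. }
    exists n0. intros n Hn. specialize (Hn0 n Hn).
    replace (u (S n)) with (u n + (u (S n) - u n)) at 1 by ring.
    rewrite e_plus.
    replace (Cminus (Cminus (Cdiv (Cmult (e (u n)) (e (u (S n) - u n))) q) (Cdiv (e (u n)) q))
       (e (u n)))
      with (Cdiv (Cmult (e (u n)) (Cminus (e (u (S n) - u n)) (e beta))) q).
    + rewrite Cmod_div, Cmod_mult, Cmod_e, Rmult_1_l by exact Hq.
      pose proof (Cmod_e_sub_e (u (S n) - u n) beta).
      apply Rle_div_l; [exact Hq0|].
      apply (Rmult_le_compat_l (2 * PI)) in Hn0; [|lra].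
      replace (2 * PI * (eps * Cmod q / (2 * PI))) with (eps * Cmod q) in Hn0 by (field; lra).
      lra.
    + replace (e beta) with (Cplus q 1) by (unfold q; ring). field. exact Hq.
Qed.

Lemma sublinear_of_increments (a : nat -> R) :
  is_lim_seq (fun n => a (S n) - a n) 0 ->
  forall eps, 0 < eps -> exists N0, forall N, (N0 <= N)%nat -> Rabs (a (S N)) <= eps * INR N.
Proof.
  intros Ha eps Heps.
  destruct (rsum_null (fun n => Rabs (a (S n) - a n))) with (eps := eps / 2) as [N1 H1].
  - intros d Hd. destruct (is_lim_seq_eps _ _ Ha d Hd) as [n0 Hn0].
    exists n0. intros n Hn. rewrite <- (Rminus_0_r (a (S n) - a n)). now apply Hn0.
  - lra.
  - destruct (eventually_le_INR (2 * Rabs (a 1%nat) / eps)) as [N2 H2].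
    exists (Nat.max N1 N2). intros N HN.
    specialize (H1 N ltac:(lia)). specialize (H2 N ltac:(lia)).
    apply (Rmult_le_compat_l eps) in H2; [|lra].
    replace (eps * (2 * Rabs (a 1%nat) / eps)) with (2 * Rabs (a 1%nat)) in H2 by (field; lra).
    assert (H3 : Rabs (a (S N) - a 1%nat) <= rsum (fun n => Rabs (a (S n) - a n)) N).
    { rewrite <- rsum_telescope. apply Rabs_rsum_le. }
    replace (a (S N)) with (a 1%nat + (a (S N) - a 1%nat)) by ring.
    eapply Rle_trans; [apply Rabs_triang|]. lra.
Qed.

(** Fejer's criterion.  The sequence [F n = e (u n) / (e (d n) - 1)] would be an
    exact primitive of [e (u n)] if the increments [d n] were constant; the
    defect is controlled by the variation of [/ d n], which also bounds [F]. *)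
Lemma mean_zero_e_Fejer (u d : nat -> R) :
  (forall n, d n = u (S n) - u n) ->
  (exists n0, forall n, (n0 <= n)%nat -> d n <> 0) ->
  is_lim_seq d 0 ->
  is_lim_seq (fun n => / d (S n) - / d n) 0 ->
  mean_zero (fun n => e (u n)).
Proof.
  intros Hd [n0 Hn0] Hd0 Hinv.
  destruct (is_lim_seq_eps _ _ Hd0 (1 / 2)) as [n1 Hn1]; [lra|].
  set (q := fun n => Cminus (e (d n)) 1).
  assert (Hq : forall n, (Nat.max n0 n1 <= n)%nat -> 0 < Rabs (d n) <= Cmod (q n)).
  { intros n Hn. split.
    - apply Rabs_pos_lt, Hn0; lia.
    - apply Rabs_le_Cmod_e_sub_1. specialize (Hn1 n ltac:(lia)).
      now rewrite Rminus_0_r in Hn1. }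
  assert (Hqn0 : forall n, (Nat.max n0 n1 <= n)%nat -> q n <> 0).
  { intros n Hn. apply Cmod_gt_0. specialize (Hq n Hn). lra. }
  pose proof PI_RGT_0 as HPI.
  apply mean_zero_of_primitive_null with (F := fun n => Cdiv (e (u n)) (q n)).
  - intros eps Heps.
    destruct (sublinear_of_increments _ Hinv eps Heps) as [N0 HN0].
    exists (Nat.max N0 (Nat.max n0 n1)). intros N HN.
    specialize (HN0 N ltac:(lia)). specialize (Hq (S N) ltac:(lia)).
    rewrite Cmod_div, Cmod_e by (apply Hqn0; lia).
    eapply Rle_trans; [|exact HN0].
    rewrite Rabs_inv. unfold Rdiv. rewrite Rmult_1_l.
    apply Rinv_le_contravar; lra.
  - intros eps Heps.
    destruct (is_lim_seq_eps _ _ Hinv (eps / (2 * PI))) as [N0 HN0].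
    { apply Rdiv_lt_0_compat; lra. }
    exists (Nat.max N0 (Nat.max n0 n1)). intros n Hn.
    specialize (HN0 n ltac:(lia)). rewrite Rminus_0_r in HN0.
    pose proof (Hq n ltac:(lia)) as Hqa. pose proof (Hq (S n) ltac:(lia)) as Hqb.
    pose proof (Hqn0 n ltac:(lia)) as Hna. pose proof (Hqn0 (S n) ltac:(lia)) as Hnb.
    assert (He : e (u (S n)) = Cmult (e (u n)) (Cplus (q n) 1)).
    { unfold q. replace (u (S n)) with (u n + d n) by (rewrite Hd; ring).
      rewrite e_plus; ring. }
    replace (Cminus (Cminus (Cdiv (e (u (S n))) (q (S n))) (Cdiv (e (u n)) (q n))) (e (u n)))
      with (Cdiv (Cmult (e (u (S n))) (Cminus (e (d n)) (e (d (S n)))))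
                 (Cmult (q n) (q (S n)))).
    + rewrite Cmod_div by now apply Cmult_neq_0.
      rewrite !Cmod_mult, Cmod_e, Rmult_1_l.
      pose proof (Cmod_e_sub_e (d n) (d (S n))) as Hlip.
      assert (Hprod : 0 < Rabs (d n) * Rabs (d (S n)) <= Cmod (q n) * Cmod (q (S n))).
      { split; [apply Rmult_lt_0_compat; lra|apply Rmult_le_compat; lra]. }
      apply Rle_trans with (2 * PI * (Rabs (d n - d (S n)) / (Rabs (d n) * Rabs (d (S n))))).
      * unfold Rdiv. rewrite <- Rmult_assoc.
        apply Rmult_le_compat; [apply Cmod_ge_0| |exact Hlip|].
        -- left; apply Rinv_0_lt_compat; lra.
        -- apply Rinv_le_contravar; lra.
      * rewrite <- Rabs_mult, <- Rabs_div.
        -- replace ((d n - d (S n)) / (d n * d (S n))) with (/ d (S n) - / d n).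
           ++ apply (Rmult_le_compat_l (2 * PI)) in HN0; [|lra].
              replace (2 * PI * (eps / (2 * PI))) with eps in HN0 by (field; lra). exact HN0.
           ++ field; split; apply Hn0; lia.
        -- apply Rmult_integral_contrapositive; split; apply Hn0; lia.
    + rewrite He.
      replace (e (d n)) with (Cplus (q n) 1) by (unfold q; ring).
      replace (e (d (S n))) with (Cplus (q (S n)) 1) by (unfold q; ring).
      field. split; assumption.
Qed.

(** ** The second-difference criterion *)

(** The primitive in Fejer's criterion uses [1 / (e (d n) - 1)], which explodes
    when [d n] passes near an integer.  This regularization of [1 / w] remains
    below [1 / sqrt lam] there. *)
Definition reg_inv (w : C) (lam : R) : C :=
  Cmult (RtoC (/ (Cmod w ^ 2 + lam))) (Cconj w).

Lemma reg_inv_bound w lam : 0 < lam -> Cmod (reg_inv w lam) <= / sqrt lam.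
Proof.
  intros Hl. unfold reg_inv.
  pose proof (Cmod_ge_0 w) as Hw. pose proof (sqrt_lt_R0 _ Hl) as Hs.
  assert (Hss : lam = sqrt lam * sqrt lam) by (symmetry; apply sqrt_sqrt; lra).
  set (s := sqrt lam) in *. set (x := Cmod w) in *.
  assert (Hp : 0 < x ^ 2 + lam) by nra.
  rewrite Cmod_mult, Cmod_conj, Cmod_R, Rabs_pos_eq by (left; now apply Rinv_0_lt_compat).
  fold x. rewrite Rmult_comm. apply Rle_div_l; [exact Hp|].
  apply Rmult_le_reg_l with s; [exact Hs|].
  rewrite <- Rmult_assoc, Rinv_r, Rmult_1_l by lra. nra.
Qed.

Lemma reg_inv_mul w lam : 0 < lam ->
  Cmult w (reg_inv w lam) = RtoC (1 - lam / (Cmod w ^ 2 + lam)).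
Proof.
  intros Hl. unfold reg_inv.
  assert (Hp : 0 < Cmod w ^ 2 + lam) by (pose proof (pow2_ge_0 (Cmod w)); lra).
  replace (Cmult w (Cmult (RtoC (/ (Cmod w ^ 2 + lam))) (Cconj w)))
    with (Cmult (RtoC (/ (Cmod w ^ 2 + lam))) (Cmult w (Cconj w))) by ring.
  rewrite <- Cmod2_conj, <- RtoC_mult. f_equal. field. lra.
Qed.

Lemma reg_inv_variation w w' lam : 0 < lam ->
  Cmod (Cminus (reg_inv w' lam) (reg_inv w lam)) <=
  Cmod (Cminus w' w) / 2 * (/ (Cmod w ^ 2 + lam) + / (Cmod w' ^ 2 + lam)).
Proof.
  intros Hl.
  pose proof (Cmod_ge_0 w) as Hw. pose proof (Cmod_ge_0 w') as Hw'.
  pose proof (Cmod_ge_0 (Cminus w' w)) as Hd.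
  assert (Hq : 0 < Cmod w ^ 2 + lam) by nra.
  assert (Hq' : 0 < Cmod w' ^ 2 + lam) by nra.
  assert (E : Cminus (reg_inv w' lam) (reg_inv w lam) =
     Cmult (RtoC (/ ((Cmod w ^ 2 + lam) * (Cmod w' ^ 2 + lam))))
       (Cplus (Cmult (Cmult (Cconj w) (Cconj w')) (Cminus w w'))
              (Cmult (RtoC lam) (Cconj (Cminus w' w))))).
  { assert (E1 : Cmult w (Cconj w) = RtoC (Cmod w ^ 2)) by now rewrite <- Cmod2_conj.
    assert (E2 : Cmult w' (Cconj w') = RtoC (Cmod w' ^ 2)) by now rewrite <- Cmod2_conj.
    replace (Cplus (Cmult (Cmult (Cconj w) (Cconj w')) (Cminus w w'))
              (Cmult (RtoC lam) (Cconj (Cminus w' w))))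
      with (Cminus (Cmult (Cplus (Cmult w (Cconj w)) (RtoC lam)) (Cconj w'))
                   (Cmult (Cplus (Cmult w' (Cconj w')) (RtoC lam)) (Cconj w)))
      by (rewrite Cminus_conj; ring).
    rewrite E1, E2, <- !RtoC_plus. unfold reg_inv.
    rewrite !RtoC_inv, RtoC_mult by nra.
    field. split; intros H0; apply RtoC_inj in H0; lra. }
  rewrite E, Cmod_mult, Cmod_R, Rabs_pos_eq
    by (left; apply Rinv_0_lt_compat; nra).
  assert (Hn : Cmod (Cplus (Cmult (Cmult (Cconj w) (Cconj w')) (Cminus w w'))
              (Cmult (RtoC lam) (Cconj (Cminus w' w))))
            <= Cmod (Cminus w' w) * (Cmod w * Cmod w' + lam)).
  { eapply Rle_trans; [apply Cmod_triangle|].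
    rewrite !Cmod_mult, !Cmod_conj, Cmod_R, (Rabs_pos_eq lam) by lra.
    replace (Cminus w w') with (Copp (Cminus w' w)) by ring.
    rewrite Cmod_opp. nra. }
  apply Rle_trans with (/ ((Cmod w ^ 2 + lam) * (Cmod w' ^ 2 + lam)) *
    (Cmod (Cminus w' w) * (Cmod w * Cmod w' + lam))).
  { apply Rmult_le_compat_l; [left; apply Rinv_0_lt_compat; nra|exact Hn]. }
  set (x := Cmod w) in *. set (y := Cmod w') in *. set (D := Cmod (Cminus w' w)) in *.
  apply Rle_trans with (/ ((x ^ 2 + lam) * (y ^ 2 + lam)) *
    (D * ((x ^ 2 + lam) + (y ^ 2 + lam)) / 2)).
  - apply Rmult_le_compat_l; [left; apply Rinv_0_lt_compat; nra|].
    assert (x * y <= (x ^ 2 + y ^ 2) / 2) by (pose proof (pow2_ge_0 (x - y)); nra).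
    nra.
  - right. field. lra.
Qed.

(** The bound is chosen to telescope when [lam] runs through a nonincreasing
    sequence. *)
Lemma reg_inv_variation_lam w lam lam' : 0 < lam' <= lam ->
  Cmod (Cminus (reg_inv w lam') (reg_inv w lam)) <= / sqrt lam' - / sqrt lam.
Proof.
  intros Hl. unfold reg_inv.
  pose proof (Cmod_ge_0 w) as Hw.
  assert (Ha : 0 < sqrt lam') by (apply sqrt_lt_R0; lra).
  assert (Hab : sqrt lam' <= sqrt lam) by (apply sqrt_le_1; lra).
  assert (Ea : lam' = sqrt lam' * sqrt lam') by (symmetry; apply sqrt_sqrt; lra).
  assert (Eb : lam = sqrt lam * sqrt lam) by (symmetry; apply sqrt_sqrt; lra).
  set (a := sqrt lam') in *. set (b := sqrt lam) in *. set (x := Cmod w) in *.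
  replace (Cminus (Cmult (RtoC (/ (x ^ 2 + lam'))) (Cconj w))
                  (Cmult (RtoC (/ (x ^ 2 + lam))) (Cconj w)))
    with (Cmult (RtoC (/ (x ^ 2 + lam') - / (x ^ 2 + lam))) (Cconj w))
    by (rewrite RtoC_minus; ring).
  assert (Hq : 0 < x ^ 2 + lam) by nra. assert (Hq' : 0 < x ^ 2 + lam') by nra.
  rewrite Cmod_mult, Cmod_conj, Cmod_R. fold x.
  replace (/ (x ^ 2 + lam') - / (x ^ 2 + lam))
    with ((lam - lam') * / (x ^ 2 + lam') * / (x ^ 2 + lam)) by (field; lra).
  rewrite Rabs_pos_eq.
  2: { repeat apply Rmult_le_pos; try lra; left; now apply Rinv_0_lt_compat. }
  apply Rle_trans with ((lam - lam') * / (2 * a) * / lam).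
  - replace ((lam - lam') * / (x ^ 2 + lam') * / (x ^ 2 + lam) * x)
      with ((lam - lam') * (x * / (x ^ 2 + lam')) * / (x ^ 2 + lam)) by ring.
    assert (H1 : x * / (x ^ 2 + lam') <= / (2 * a)).
    { apply Rle_div_l; [exact Hq'|].
      apply Rmult_le_reg_l with (2 * a); [lra|].
      rewrite <- Rmult_assoc, Rinv_r, Rmult_1_l by lra.
      pose proof (pow2_ge_0 (x - a)). nra. }
    assert (H2 : / (x ^ 2 + lam) <= / lam) by (apply Rinv_le_contravar; nra).
    assert (H3 : 0 <= x * / (x ^ 2 + lam'))
      by (apply Rmult_le_pos; [lra|left; now apply Rinv_0_lt_compat]).
    apply Rmult_le_compat; try lra.
    + apply Rmult_le_pos; lra.
    + left; now apply Rinv_0_lt_compat.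
    + apply Rmult_le_compat_l; lra.
  - rewrite Ea, Eb.
    replace (/ a - / b) with ((b - a) * (2 * b) * / (2 * a * (b * b))) by (field; lra).
    replace ((b * b - a * a) * / (2 * a) * / (b * b))
      with ((b - a) * (b + a) * / (2 * a * (b * b))) by (field; lra).
    apply Rmult_le_compat_r; [|nra].
    left; apply Rinv_0_lt_compat.
    repeat apply Rmult_lt_0_compat; lra.
Qed.

Lemma rsum_ge_term (r : nat -> R) m M :
  (forall k, (1 <= k <= M)%nat -> 0 <= r k) -> (1 <= m <= M)%nat -> r m <= rsum r M.
Proof.
  induction M as [|M IH]; intros Hr Hm; [lia|]. simpl.
  assert (H0 : 0 <= rsum r M) by (apply rsum_pos; intros; apply Hr; lia).
  destruct (Nat.eq_dec m (S M)) as [->|Hne]; [lra|].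
  specialize (IH ltac:(intros; apply Hr; lia) ltac:(lia)).
  pose proof (Hr (S M) ltac:(lia)). lra.
Qed.

(** A primitive of the sum over [m] of [1 / (s ^ 2 + (t - m) ^ 2)].  It measures
    the time that a sequence spends near the integers: a step from [t] to [t'] near
    an integer raises it by a definite amount, while its total increase is at most
    [M pi / s]. *)
Definition potential (s : R) (M : nat) (t : R) : R :=
  rsum (fun m => atan ((t - INR m) / s) / s) M.

Lemma atan_le x y : x <= y -> atan x <= atan y.
Proof.
  intros [H|H]; [left; now apply atan_increasing|subst; lra].
Qed.

Lemma potential_bound s M t t' : 0 < s ->
  potential s M t' - potential s M t <= INR M * (PI / s).
Proof.
  intros Hs. unfold potential. rewrite <- rsum_const.
  assert (H : forall m, atan ((t' - INR m) / s) / s <= atan ((t - INR m) / s) / s + PI / s).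
  { intros m. unfold Rdiv. rewrite <- Rmult_plus_distr_r.
    apply Rmult_le_compat_r; [left; now apply Rinv_0_lt_compat|].
    pose proof (atan_bound ((t' - INR m) * / s)). pose proof (atan_bound ((t - INR m) * / s)).
    lra. }
  assert (H' := rsum_le _ _ M (fun m _ => H m)).
  rewrite rsum_plus in H'. lra.
Qed.

Lemma potential_step s M m t t' tau : 0 < s -> (1 <= m <= M)%nat ->
  s * s <= t' - t <= 1 -> t <= tau <= t' ->
  (t' - t) / ((tau - INR m) ^ 2 + (t' - t)) <= 3 * (potential s M t' - potential s M t).
Proof.
  intros Hs Hm HD Htau.
  assert (Ht : t < t') by nra.
  set (r := fun k => atan ((t' - INR k) / s) / s - atan ((t - INR k) / s) / s).
  assert (Hr : potential s M t' - potential s M t = rsum r M).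
  { unfold potential, r.
    rewrite (rsum_ext (fun k => atan ((t' - INR k) / s) / s - atan ((t - INR k) / s) / s)
      (fun k => atan ((t' - INR k) / s) / s + -1 * (atan ((t - INR k) / s) / s)))
      by (intros; ring).
    rewrite rsum_plus, rsum_scal. ring. }
  rewrite Hr.
  apply Rle_trans with (3 * r m).
  2: { apply Rmult_le_compat_l; [lra|]. apply rsum_ge_term; [|exact Hm].
       intros k _. unfold r, Rdiv. rewrite <- Rmult_minus_distr_r.
       apply Rmult_le_pos; [|left; now apply Rinv_0_lt_compat].
       assert (Hat : atan ((t - INR k) * / s) <= atan ((t' - INR k) * / s)).
       { apply atan_le, Rmult_le_compat_r; [left; now apply Rinv_0_lt_compat|lra]. }
       lra. }
  destruct (MVT_cor2 (fun x => atan ((x - INR m) / s) / s)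
    (fun x => / (s * s + (x - INR m) ^ 2)) t t' Ht) as [th [Hth1 Hth2]].
  { intros c _. apply is_derive_Reals.
    auto_derive; [trivial|]. field. split; [|lra].
    pose proof (pow2_ge_0 (c - INR m)). nra. }
  unfold r. rewrite Hth1.
  set (D := t' - t) in *. set (x := tau - INR m). set (y := th - INR m).
  (* [th] and [tau] lie in the same step, of length [D <= 1] *)
  assert (Hy : y ^ 2 <= 2 * x ^ 2 + 2 * D ^ 2).
  { assert (Hxy : (y - x) ^ 2 <= D ^ 2) by (unfold x, y, D; nra).
    pose proof (pow2_ge_0 (2 * x - y)). nra. }
  pose proof (pow2_ge_0 x) as Hx0. pose proof (pow2_ge_0 y) as Hy0.
  assert (Hle : s * s + y ^ 2 <= 3 * (x ^ 2 + D)) by nra.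
  assert (H0 : 0 < s * s + y ^ 2) by nra.
  apply Rle_trans with (D * (3 * / (3 * (x ^ 2 + D)))).
  - right. field. nra.
  - apply Rle_trans with (D * (3 * / (s * s + y ^ 2))).
    + apply Rmult_le_compat_l; [nra|].
      apply Rmult_le_compat_l; [lra|]. apply Rinv_le_contravar; lra.
    + right; ring.
Qed.

Lemma near_integer_mass s M t t' tau : 0 < s -> 1 <= t -> t' + 1 / 2 <= INR M ->
  s * s <= t' - t <= 1 -> t <= tau <= t' ->
  (t' - t) / (Cmod (Cminus (e tau) 1) ^ 2 + (t' - t)) <=
  3 * (potential s M t' - potential s M t).
Proof.
  intros Hs Ht HM HD Htau.
  destruct (nearest_integer tau) as [k Hk].
  assert (Hk' : Rabs (tau - IZR k) <= Cmod (Cminus (e tau) 1)).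
  { rewrite <- (e_period tau (- k)). rewrite opp_IZR.
    now apply Rabs_le_Cmod_e_sub_1. }
  assert (Hk2 := proj1 (Rabs_le_between _ _) Hk).
  assert (Hk0 : (1 <= k)%Z).
  { assert (0 < k)%Z by (apply lt_IZR; lra). lia. }
  assert (Em : IZR k = INR (Z.to_nat k)) by (rewrite INR_IZR_INZ, Z2Nat.id by lia; reflexivity).
  assert (Hm : (1 <= Z.to_nat k <= M)%nat).
  { split; [lia|]. apply INR_le. rewrite <- Em. lra. }
  eapply Rle_trans; [|exact (potential_step s M _ t t' tau Hs Hm HD Htau)].
  rewrite <- Em.
  assert (Hsq : (tau - IZR k) ^ 2 <= Cmod (Cminus (e tau) 1) ^ 2).
  { rewrite <- (pow2_abs (tau - IZR k)). apply pow_incr.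
    split; [apply Rabs_pos|exact Hk']. }
  pose proof (pow2_ge_0 (tau - IZR k)).
  assert (0 < t' - t) by nra.
  apply Rmult_le_compat_l; [lra|]. apply Rinv_le_contravar; lra.
Qed.

(** With [w n = e (d n) - 1] take [F n = e (u n) * reg_inv (w n) (D n)].  Its defect
    as a primitive of [e (u n)] is at most a constant times
    [D n / (|w n| ^ 2 + D n)], taken at both ends of the step, plus a telescoping
    term in [1 / sqrt (D n)].  The first kind of error is large only near integers
    and is summed by means of [potential] with [s = sqrt (D (N + 1))].  In total
    the errors are [O (d (N + 1) / sqrt (D (N + 1)))]. *)
Lemma mean_zero_e_second_difference_core (u d D : nat -> R) :
  (forall n, d n = u (S n) - u n) ->
  (forall n, D n = d (S n) - d n) ->
  (forall n, 0 < D n) -> (forall n, D (S n) <= D n) ->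
  (forall n, D n <= 1) -> (forall n, 1 <= d n) ->
  (forall eps, 0 < eps -> exists N0, forall N, (N0 <= N)%nat ->
     d N <= eps * (INR N * sqrt (D N))) ->
  mean_zero (fun n => e (u n)).
Proof.
  intros Hd HD Dpos Ddec D1 d1 Hratio.
  pose proof PI_RGT_0 as HPI.
  set (w := fun n => Cminus (e (d n)) 1).
  set (A := fun n => reg_inv (w n) (D n)).
  assert (sD : forall n, 0 < sqrt (D n)) by (intros; apply sqrt_lt_R0, Dpos).
  assert (Ddec' : forall k n, D (n + k)%nat <= D n).
  { induction k as [|k IH]; intros n; [rewrite Nat.add_0_r; lra|].
    rewrite Nat.add_succ_r. eapply Rle_trans; [apply Ddec|apply IH]. }
  assert (dinc : forall k n, d n <= d (n + k)%nat).
  { induction k as [|k IH]; intros n; [rewrite Nat.add_0_r; lra|].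
    rewrite Nat.add_succ_r. specialize (IH n). pose proof (HD (n + k)%nat).
    pose proof (Dpos (n + k)%nat). lra. }
  assert (Hr : forall eps, 0 < eps -> exists N0, forall N, (N0 <= N)%nat ->
     d (S N) * / sqrt (D (S N)) <= eps * INR N).
  { intros eps Heps. destruct (Hratio (eps / 2)) as [N0 HN0]; [lra|].
    exists (Nat.max 1 N0). intros N HN. specialize (HN0 (S N) ltac:(lia)).
    apply Rle_div_l; [apply sD|].
    eapply Rle_trans; [exact HN0|].
    assert (HS : INR (S N) <= 2 * INR N).
    { rewrite S_INR. pose proof (le_INR 1 N ltac:(lia)) as H1. simpl in H1. lra. }
    pose proof (sD (S N)).
    replace (eps * INR N * sqrt (D (S N))) with (eps / 2 * (2 * INR N * sqrt (D (S N)))) by field.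
    apply Rmult_le_compat_l; [lra|]. apply Rmult_le_compat_r; lra. }
  assert (Hone : forall n, / sqrt (D n) <= d n * / sqrt (D n)).
  { intros n. rewrite <- (Rmult_1_l (/ sqrt (D n))) at 1.
    apply Rmult_le_compat_r; [left; apply Rinv_0_lt_compat, sD|apply d1]. }
  apply mean_zero_of_primitive with (F := fun n => Cmult (e (u n)) (A n)).
  - intros eps Heps. destruct (Hr eps Heps) as [N0 HN0]. exists N0. intros N HN.
    rewrite Cmod_mult, Cmod_e, Rmult_1_l.
    eapply Rle_trans; [apply reg_inv_bound, Dpos|].
    eapply Rle_trans; [apply Hone|]. now apply HN0.
  - assert (Herr : forall n,
      Cmod (Cminus (Cminus (Cmult (e (u (S n))) (A (S n))) (Cmult (e (u n)) (A n))) (e (u n)))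
      <= Cmod (Cminus (A (S n)) (A n)) + D n / (Cmod (w n) ^ 2 + D n)).
    { intros n.
      assert (E : e (u (S n)) = Cmult (e (u n)) (e (d n))).
      { rewrite <- e_plus. f_equal. rewrite Hd; ring. }
      assert (Hq : 0 < Cmod (w n) ^ 2 + D n)
        by (pose proof (pow2_ge_0 (Cmod (w n))); pose proof (Dpos n); lra).
      replace (Cminus (Cminus (Cmult (e (u (S n))) (A (S n))) (Cmult (e (u n)) (A n))) (e (u n)))
        with (Cmult (e (u n)) (Cplus (Cmult (e (d n)) (Cminus (A (S n)) (A n)))
                                     (Cminus (Cmult (w n) (A n)) 1)))
        by (rewrite E; unfold w; ring).
      rewrite Cmod_mult, Cmod_e, Rmult_1_l.
      eapply Rle_trans; [apply Cmod_triangle|].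
      rewrite Cmod_mult, Cmod_e, Rmult_1_l.
      apply Rplus_le_compat_l.
      unfold A. rewrite reg_inv_mul, <- RtoC_minus, Cmod_R by apply Dpos.
      replace (1 - D n / (Cmod (w n) ^ 2 + D n) - 1) with (- (D n / (Cmod (w n) ^ 2 + D n))) by ring.
      rewrite Rabs_Ropp, Rabs_pos_eq; [lra|].
      apply Rmult_le_pos; [left; apply Dpos|left; now apply Rinv_0_lt_compat]. }
    assert (Hvar : forall n, Cmod (Cminus (A (S n)) (A n)) <=
       (/ sqrt (D (S n)) - / sqrt (D n)) +
       PI * (D n / (Cmod (w n) ^ 2 + D n) + D n / (Cmod (w (S n)) ^ 2 + D n))).
    { intros n. unfold A.
      replace (Cminus (reg_inv (w (S n)) (D (S n))) (reg_inv (w n) (D n)))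
        with (Cplus (Cminus (reg_inv (w (S n)) (D (S n))) (reg_inv (w (S n)) (D n)))
                    (Cminus (reg_inv (w (S n)) (D n)) (reg_inv (w n) (D n)))) by ring.
      eapply Rle_trans; [apply Cmod_triangle|]. apply Rplus_le_compat.
      - apply reg_inv_variation_lam. split; [apply Dpos|apply Ddec].
      - eapply Rle_trans; [apply reg_inv_variation, Dpos|].
        assert (Hw : Cmod (Cminus (w (S n)) (w n)) <= 2 * PI * D n).
        { unfold w.
          replace (Cminus (Cminus (e (d (S n))) 1) (Cminus (e (d n)) 1))
            with (Cminus (e (d (S n))) (e (d n))) by ring.
          eapply Rle_trans; [apply Cmod_e_sub_e|].
          rewrite <- HD, Rabs_pos_eq by (left; apply Dpos). lra. }
        pose proof (Dpos n) as Hp.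
        assert (H1 : 0 < / (Cmod (w n) ^ 2 + D n)).
        { apply Rinv_0_lt_compat. pose proof (pow2_ge_0 (Cmod (w n))); lra. }
        assert (H2 : 0 < / (Cmod (w (S n)) ^ 2 + D n)).
        { apply Rinv_0_lt_compat. pose proof (pow2_ge_0 (Cmod (w (S n)))); lra. }
        unfold Rdiv.
        apply Rle_trans with
          (PI * D n * (/ (Cmod (w n) ^ 2 + D n) + / (Cmod (w (S n)) ^ 2 + D n))); [|lra].
        apply Rmult_le_compat_r; lra. }
    assert (Hsum : forall N,
      rsum (fun n => Cmod (Cminus (Cminus (Cmult (e (u (S n))) (A (S n))) (Cmult (e (u n)) (A n)))
         (e (u n)))) N <= (1 + 9 * (1 + 2 * PI) * PI) * (d (S N) * / sqrt (D (S N)))).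
    { intros N.
      set (s := sqrt (D (S N))).
      assert (Hs : 0 < s) by apply sD.
      assert (Hss : s * s = D (S N)) by (apply sqrt_sqrt; left; apply Dpos).
      (* all integers nearest to some [d n] with [n <= N + 1] are among [1, ..., M] *)
      set (M := Z.to_nat (up (d (S N) + 1 / 2))).
      destruct (archimed (d (S N) + 1 / 2)) as [Hup1 Hup2].
      assert (HM : INR M = IZR (up (d (S N) + 1 / 2))).
      { unfold M. rewrite INR_IZR_INZ, Z2Nat.id; [reflexivity|].
        apply le_IZR. pose proof (d1 (S N)). lra. }
      assert (Hn : forall n, (1 <= n <= N)%nat ->
        Cmod (Cminus (Cminus (Cmult (e (u (S n))) (A (S n))) (Cmult (e (u n)) (A n)))
         (e (u n))) <= (/ sqrt (D (S n)) - / sqrt (D n)) +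
        3 * (1 + 2 * PI) * (potential s M (d (S n)) - potential s M (d n))).
      { intros n Hn.
        assert (Hdle : d (S n) <= d (S N)).
        { replace (S N) with (S n + (N - n))%nat by lia. apply dinc. }
        assert (HDle : D (S N) <= D n).
        { replace (S N) with (n + (S N - n))%nat by lia. apply Ddec'. }
        assert (Hc : s * s <= d (S n) - d n <= 1) by (rewrite <- HD, Hss; split; [lra|apply D1]).
        assert (Hdd : d n <= d (S n)) by (pose proof (HD n); pose proof (Dpos n); lra).
        assert (P1 := near_integer_mass s M (d n) (d (S n)) (d n) Hs (d1 n) ltac:(lra) Hc
          ltac:(lra)).
        assert (P2 := near_integer_mass s M (d n) (d (S n)) (d (S n)) Hs (d1 n) ltac:(lra) Hc
          ltac:(lra)).
        rewrite <- HD in P1, P2. fold (w n) in P1. fold (w (S n)) in P2.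
        specialize (Herr n). specialize (Hvar n).
        set (p := potential s M (d (S n)) - potential s M (d n)) in *.
        assert (PI * (D n / (Cmod (w n) ^ 2 + D n) + D n / (Cmod (w (S n)) ^ 2 + D n))
          <= PI * (3 * p + 3 * p)) by (apply Rmult_le_compat_l; lra).
        lra. }
      eapply Rle_trans; [apply rsum_le, Hn|].
      rewrite rsum_plus, rsum_scal.
      rewrite (rsum_telescope (fun n => / sqrt (D n))).
      rewrite (rsum_telescope (fun n => potential s M (d n))).
      fold s.
      pose proof (potential_bound s M (d 1%nat) (d (S N)) Hs) as HP.
      assert (Hs0 : 0 < / s) by now apply Rinv_0_lt_compat.
      assert (Hs1 : 0 < / sqrt (D 1%nat)) by apply Rinv_0_lt_compat, sD.
      pose proof (Hone (S N)) as Ho. fold s in Ho. pose proof (d1 (S N)) as Hd1.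
      assert (HMd : INR M * (PI / s) <= 3 * PI * (d (S N) * / s)).
      { unfold Rdiv. replace (INR M * (PI * / s)) with (PI * (INR M * / s)) by ring.
        replace (3 * PI * (d (S N) * / s)) with (PI * (3 * d (S N) * / s)) by ring.
        apply Rmult_le_compat_l; [lra|]. apply Rmult_le_compat_r; lra. }
      set (X := d (S N) * / s) in *.
      set (Y := potential s M (d (S N)) - potential s M (d 1%nat)) in *.
      assert (3 * (1 + 2 * PI) * Y <= 3 * (1 + 2 * PI) * (3 * PI * X))
        by (apply Rmult_le_compat_l; lra).
      lra. }
    intros eps Heps.
    set (K := 1 + 9 * (1 + 2 * PI) * PI) in *.
    assert (HK : 0 < K) by (unfold K; nra).
    destruct (Hr (eps / K)) as [N0 HN0]; [apply Rdiv_lt_0_compat; lra|].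
    exists N0. intros N HN. eapply Rle_trans; [apply Hsum|].
    specialize (HN0 N HN). apply (Rmult_le_compat_l K) in HN0; [|lra].
    replace (K * (eps / K * INR N)) with (eps * INR N) in HN0 by (field; lra).
    exact HN0.
Qed.

(** This criterion covers increments [d] as slow as [log log n], which linger near
    each integer for a very long time. *)
Lemma mean_zero_e_second_difference (u d D : nat -> R) :
  (forall n, d n = u (S n) - u n) ->
  (forall n, D n = d (S n) - d n) ->
  (exists n0, forall n, (n0 <= n)%nat -> 0 < D n /\ D (S n) <= D n) ->
  is_lim_seq D 0 ->
  is_lim_seq d p_infty ->
  (forall eps, 0 < eps -> exists N0, forall N, (N0 <= N)%nat ->
     d N <= eps * (INR N * sqrt (D N))) ->
  mean_zero (fun n => e (u n)).
Proof.
  intros Hd HD [n0 Hn0] HD0 Hdinf Hratio.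
  destruct (is_lim_seq_eps _ _ HD0 1) as [n1 Hn1]; [lra|].
  apply is_lim_seq_spec in Hdinf. destruct (Hdinf 1) as [n2 Hn2].
  set (k := Nat.max 1 (Nat.max n0 (Nat.max n1 n2))).
  apply mean_zero_unshift with (k := k).
  apply (mean_zero_e_second_difference_core (fun n => u (n + k)%nat) (fun n => d (n + k)%nat)
    (fun n => D (n + k)%nat)).
  - intros n. apply Hd.
  - intros n. apply HD.
  - intros n. apply Hn0. lia.
  - intros n. apply (Hn0 (n + k)%nat). lia.
  - intros n. specialize (Hn1 (n + k)%nat ltac:(lia)).
    rewrite Rminus_0_r in Hn1. pose proof (Rle_abs (D (n + k)%nat)). lra.
  - intros n. left. apply Hn2. lia.
  - intros eps Heps. destruct (Hratio (eps / 2)) as [N0 HN0]; [lra|].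
    exists (Nat.max k N0). intros N HN. specialize (HN0 (N + k)%nat ltac:(lia)).
    eapply Rle_trans; [exact HN0|].
    pose proof (sqrt_pos (D (N + k)%nat)).
    assert (INR (N + k) <= 2 * INR N).
    { rewrite plus_INR. pose proof (le_INR k N ltac:(lia)). lra. }
    replace (eps * (INR N * sqrt (D (N + k)%nat)))
      with (eps / 2 * (2 * INR N * sqrt (D (N + k)%nat))) by field.
    apply Rmult_le_compat_l; [lra|]. apply Rmult_le_compat_r; lra.
Qed.

(** * Van der Corput's difference theorem *)

Lemma Cmod2_plus z w :
  Cmod (Cplus z w) ^ 2 = Cmod z ^ 2 + Cmod w ^ 2 + 2 * Re (Cmult z (Cconj w)).
Proof.
  rewrite !Cmod2_alt. destruct z as [a b], w as [c d].
  unfold Cplus, Cmult, Cconj, Re, Im; cbn [fst snd]. ring.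
Qed.

Lemma mean_zero_Re z : mean_zero z -> mean_zero (fun n => RtoC (Re (z n))).
Proof.
  intros H.
  apply mean_zero_ext with
    (fun n => Cmult (RtoC (/ 2)) (Cplus (z n) (Cconj (z n)))).
  - intros n _. destruct (z n) as [a b].
    unfold Cmult, Cplus, Cconj, RtoC; simpl. f_equal; field.
  - apply mean_zero_scal, mean_zero_plus; [exact H|now apply mean_zero_conj].
Qed.

(** The sums of [z (n + h)] and of [z n] differ in at most [2 h] terms. *)
Lemma mean_zero_translate_sub (z : nat -> C) h :
  (forall n, Cmod (z n) = 1) -> mean_zero (fun n => Cminus (z (n + h)%nat) (z n)).
Proof.
  intros Hz eps Heps.
  assert (B : forall k M, Cmod (csum (fun n => z (n + M)%nat) k) <= INR k).
  { intros k M. eapply Rle_trans; [apply Cmod_csum_le|].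
    rewrite (rsum_ext _ (fun _ => 1)) by (intros; apply Hz). rewrite rsum_const; lra. }
  destruct (eventually_le_INR (2 * INR h / eps)) as [N0 HN0]. exists N0. intros N HN.
  specialize (HN0 N HN). apply (Rmult_le_compat_l eps) in HN0; [|lra].
  replace (eps * (2 * INR h / eps)) with (2 * INR h) in HN0 by (field; lra).
  rewrite csum_minus, csum_shift.
  pose proof (B h N) as H1. rewrite csum_shift, (Nat.add_comm h N) in H1.
  pose proof (B h 0%nat) as H2. rewrite csum_shift, Nat.add_0_r in H2.
  replace (csum z 0) with (RtoC 0) in H2 by reflexivity.
  replace (Cminus (csum z h) 0) with (csum z h) in H2 by ring.
  replace (Cminus (Cminus (csum z (N + h)) (csum z h)) (csum z N))
    with (Cplus (Cminus (csum z (N + h)) (csum z N)) (Copp (csum z h))) by ring.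
  eapply Rle_trans; [apply Cmod_triangle|]. rewrite Cmod_opp. lra.
Qed.

(** Expanding the square, the diagonal contributes [H] and the rest averages
    to zero. *)
Lemma mean_square_of_window_sums (z : nat -> C) :
  (forall n, Cmod (z n) = 1) ->
  (forall h, (1 <= h)%nat -> mean_zero (fun n => Cmult (z (n + h)%nat) (Cconj (z n)))) ->
  forall H, mean_zero (fun n => RtoC (Cmod (csum (fun h => z (n + h)%nat) H) ^ 2 - INR H)).
Proof.
  intros Hz Hcorr H. induction H as [|H IH].
  - apply mean_zero_ext with (fun _ => RtoC 0); [|apply mean_zero_0].
    intros n _. simpl. rewrite Cmod_0. f_equal; ring.
  - apply mean_zero_ext with (fun n =>
      Cplus (RtoC (Cmod (csum (fun h => z (n + h)%nat) H) ^ 2 - INR H))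
        (Cmult 2 (RtoC (Re (csum (fun h => Cmult (z (n + h)%nat)
           (Cconj (z (n + S H)%nat))) H))))).
    { intros n _. cbn [csum]. rewrite Cmod2_plus, Hz, S_INR.
      rewrite (csum_ext (fun h => Cmult (z (n + h)%nat) (Cconj (z (n + S H)%nat)))
        (fun h => Cmult (Cconj (z (n + S H)%nat)) (z (n + h)%nat)))
        by (intros; ring).
      rewrite csum_scal, (Cmult_comm (Cconj _)).
      rewrite <- RtoC_mult, <- RtoC_plus. f_equal. ring. }
    apply mean_zero_plus; [exact IH|].
    apply mean_zero_scal, mean_zero_Re, mean_zero_csum.
    intros k Hk.
    apply mean_zero_ext with (fun n => Cconj (Cmult (z (n + k + (S H - k))%nat)
      (Cconj (z (n + k)%nat)))).
    + intros n _. replace (n + k + (S H - k))%nat with (n + S H)%nat by lia.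
      rewrite Cmult_conj, Cconj_conj. ring.
    + apply mean_zero_conj.
      apply (mean_zero_shift k (fun n => Cmult (z (n + (S H - k))%nat) (Cconj (z n)))).
      apply Hcorr. lia.
Qed.

(** Window sums over [m ^ 2] consecutive terms have size about [m] in the mean,
    while averaging over windows does not change the mean. *)
Lemma van_der_Corput (z : nat -> C) :
  (forall n, Cmod (z n) = 1) ->
  (forall h, (1 <= h)%nat -> mean_zero (fun n => Cmult (z (n + h)%nat) (Cconj (z n)))) ->
  mean_zero z.
Proof.
  intros Hz Hcorr eps Heps.
  destruct (eventually_le_INR (4 / eps + 1)) as [m Hm]. specialize (Hm m (le_n m)).
  assert (Hm1 : 1 <= INR m) by (assert (0 < 4 / eps) by (apply Rdiv_lt_0_compat; lra); lra).
  assert (Hm2 : 4 <= eps * INR m).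
  { apply (Rmult_le_compat_l eps) in Hm; [|lra].
    replace (eps * (4 / eps + 1)) with (4 + eps) in Hm by (field; lra). lra. }
  set (H := (m * m)%nat).
  assert (EH : INR H = INR m * INR m) by apply mult_INR.
  set (W := fun n => csum (fun h => z (n + h)%nat) H).
  destruct (mean_square_of_window_sums z Hz Hcorr H 1) as [N1 HN1]; [lra|].
  assert (HWz : mean_zero (fun n => Cminus (W n) (Cmult (RtoC (INR H)) (z n)))).
  { apply mean_zero_ext with (fun n => csum (fun h => Cminus (z (n + h)%nat) (z n)) H).
    - intros n _. unfold W. rewrite csum_minus, csum_const. reflexivity.
    - apply mean_zero_csum. intros k _. now apply mean_zero_translate_sub. }
  destruct (HWz 1) as [N2 HN2]; [lra|].
  exists (Nat.max N1 N2). intros N HN.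
  specialize (HN1 N ltac:(lia)). specialize (HN2 N ltac:(lia)).
  rewrite csum_minus, csum_scal in HN2.
  rewrite csum_RtoC, Cmod_R in HN1.
  pose proof (Rle_abs (rsum (fun n => Cmod (W n) ^ 2 - INR H) N)) as HN1a.
  fold (W 0%nat) in HN1.
  change (Rabs (rsum (fun n => Cmod (W n) ^ 2 - INR H) N) <= 1 * INR N) in HN1.
  assert (HW : rsum (fun n => Cmod (W n)) N <=
     rsum (fun n => / (2 * INR m) * (Cmod (W n) ^ 2 - INR H) + INR m) N).
  { apply rsum_le. intros n _. rewrite EH.
    pose proof (pow2_ge_0 (Cmod (W n) - INR m)).
    apply Rmult_le_reg_l with (2 * INR m); [lra|].
    replace (2 * INR m * (/ (2 * INR m) * (Cmod (W n) ^ 2 - INR m * INR m) + INR m))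
      with (Cmod (W n) ^ 2 + INR m * INR m) by (field; lra).
    nra. }
  rewrite rsum_plus, rsum_scal, rsum_const in HW.
  pose proof (pos_INR N) as HNpos.
  assert (HW2 : / (2 * INR m) * rsum (fun n => Cmod (W n) ^ 2 - INR H) N <= INR N).
  { apply Rmult_le_reg_l with (2 * INR m); [lra|].
    rewrite <- Rmult_assoc, Rinv_r, Rmult_1_l by lra. nra. }
  pose proof (Cmod_csum_le W N) as HW3.
  assert (HH : INR H * Cmod (csum z N) <= INR N * INR m + 2 * INR N).
  { replace (INR H * Cmod (csum z N)) with (Cmod (Cmult (RtoC (INR H)) (csum z N))).
    - replace (Cmult (RtoC (INR H)) (csum z N)) with
        (Cminus (csum W N) (Cminus (csum W N) (Cmult (RtoC (INR H)) (csum z N)))) by ring.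
      unfold Cminus at 1. eapply Rle_trans; [apply Cmod_triangle|].
      rewrite Cmod_opp. lra.
    - rewrite Cmod_mult, Cmod_R, Rabs_pos_eq by apply pos_INR. reflexivity. }
  apply Rmult_le_reg_l with (INR m * INR m); [nra|].
  rewrite <- EH at 1. eapply Rle_trans; [exact HH|].
  assert (4 * (INR m * INR N) <= eps * INR m * (INR m * INR N))
    by (apply Rmult_le_compat_r; [apply Rmult_le_pos; lra|exact Hm2]).
  assert (1 * INR N <= INR m * INR N) by (apply Rmult_le_compat_r; lra).
  lra.
Qed.

(** * Iterated differences *)

Fixpoint diff (k : nat) (u : nat -> R) : nat -> R :=
  match k with
  | O => u
  | S j => fun n => diff j u (S n) - diff j u n
  end.

Lemma diff_ext k u v : (forall n, u n = v n) -> forall n, diff k u n = diff k v n.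
Proof.
  intros H. induction k as [|k IH]; intros n; simpl; [apply H|now rewrite !IH].
Qed.

Lemma diff_S k u n : diff (S k) u n = diff k (fun m => u (S m) - u m) n.
Proof.
  revert n. induction k as [|k IH]; intros n; [reflexivity|].
  change (diff (S (S k)) u n) with (diff (S k) u (S n) - diff (S k) u n).
  now rewrite !IH.
Qed.

Lemma diff_step h k u n :
  diff k (fun m => u (m + h)%nat - u m) n = diff k u (n + h) - diff k u n.
Proof.
  revert n. induction k as [|k IH]; intros n; simpl; [reflexivity|].
  rewrite !IH. simpl. ring.
Qed.

Lemma lim_step (V : nat -> R) (c : R) :
  is_lim_seq (fun n => V (S n) - V n) c ->
  forall h, is_lim_seq (fun n => V (n + h)%nat - V n) (INR h * c).
Proof.
  intros HV h. induction h as [|h IH].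
  - apply is_lim_seq_ext with (fun _ => 0).
    + intros n. rewrite Nat.add_0_r. ring.
    + simpl. rewrite Rmult_0_l. apply is_lim_seq_const.
  - apply is_lim_seq_ext with
      (fun n => (V (n + h)%nat - V n) + (V (S (n + h)) - V (n + h)%nat)).
    + intros n. rewrite Nat.add_succ_r. ring.
    + replace (INR (S h) * c) with (INR h * c + c) by (rewrite S_INR; ring).
      apply is_lim_seq_plus'; [exact IH|].
      now apply (is_lim_seq_incr_n (fun n => V (S n) - V n) h).
Qed.

(** Differencing lowers the order of the sequence by one. *)
Lemma mean_zero_e_of_step (u : nat -> R) :
  (forall h, (1 <= h)%nat -> mean_zero (fun n => e (u (n + h)%nat - u n))) ->
  mean_zero (fun n => e (u n)).
Proof.
  intros H. apply van_der_Corput.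
  - intros n. apply Cmod_e.
  - intros h Hh. apply mean_zero_ext with (fun n => e (u (n + h)%nat - u n)).
    + intros n _. apply e_minus.
    + now apply H.
Qed.

(** Weyl's theorem for sequences that behave like polynomials with irrational
    leading coefficient: a step [h] multiplies the limit by [h], which preserves
    irrationality. *)
Lemma mean_zero_e_irrational_diff k : forall (u : nat -> R) (c : R),
  is_lim_seq (diff (S k) u) c -> (forall q : Q, c <> Q2R q) ->
  mean_zero (fun n => e (u n)).
Proof.
  induction k as [|k IH]; intros u c Hu Hc.
  - apply mean_zero_e_of_difference with c; [exact Hu|].
    intros z Hz. apply (Hc (inject_Z z)). rewrite Hz. unfold Q2R; simpl. field.
  - apply mean_zero_e_of_step. intros h Hh.
    apply (IH _ (INR h * c)).
    + apply is_lim_seq_ext with (fun n => diff (S k) u (n + h) - diff (S k) u n).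
      * intros n. now rewrite diff_step.
      * now apply lim_step.
    + intros q Hq. apply (Hc (q / inject_Z (Z.of_nat h))%Q).
      assert (Hh0 : 0 < INR h) by (apply lt_0_INR; lia).
      rewrite Q2R_div.
      * rewrite <- Hq. unfold Q2R at 1; simpl. rewrite <- INR_IZR_INZ. field. lra.
      * intros H0. apply (Qeq_eqR _ _) in H0. unfold Q2R in H0; simpl in H0.
        rewrite <- INR_IZR_INZ in H0. lra.
Qed.

Lemma step_bounds (V a : nat -> R) n0 :
  (forall n, a n = V (S n) - V n) ->
  (forall n, (n0 <= n)%nat -> a n <= a (S n)) ->
  forall h n, (n0 <= n)%nat ->
  INR h * a n <= V (n + h)%nat - V n <= INR h * a (n + h)%nat.
Proof.
  intros Ha Hinc h n Hn.
  induction h as [|h IH]; [rewrite Nat.add_0_r; simpl; lra|].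
  assert (Hk : forall k, a n <= a (n + k)%nat).
  { induction k as [|k IHk]; [rewrite Nat.add_0_r; lra|].
    rewrite Nat.add_succ_r. eapply Rle_trans; [apply IHk|apply Hinc; lia]. }
  rewrite Nat.add_succ_r, S_INR. specialize (Hk h).
  pose proof (Ha (n + h)%nat). pose proof (Hinc (n + h)%nat ltac:(lia)).
  assert (INR h * a (n + h)%nat <= INR h * a (S (n + h)))
    by (apply Rmult_le_compat_l; [apply pos_INR|lra]).
  lra.
Qed.

(** The hypotheses of the second-difference criterion, on the increments [v] of a
    sequence. *)
Definition slow (v : nat -> R) : Prop :=
  (exists n0, forall n, (n0 <= n)%nat ->
     0 < v (S n) - v n /\ v (S (S n)) - v (S n) <= v (S n) - v n) /\
  is_lim_seq (fun n => v (S n) - v n) 0 /\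
  is_lim_seq v p_infty /\
  (forall eps, 0 < eps -> exists N0, forall N, (N0 <= N)%nat ->
     v N <= eps * (INR N * sqrt (v (S N) - v N))).

(** Increments and second differences of the new sequence are sums of [h]
    consecutive terms of the old ones; by monotonicity both are comparable to [h]
    times the value at [n + h]. *)
Lemma slow_step (V : nat -> R) h : (1 <= h)%nat ->
  slow (fun n => V (S n) - V n) -> slow (fun n => V (n + h)%nat - V n).
Proof.
  intros Hh Hs. set (v := fun n => V (S n) - V n) in Hs.
  destruct Hs as (Hw & Hw0 & Hvinf & Hratio).
  destruct Hw as [n0 Hn0].
  assert (HR1 : 1 <= INR h) by (apply (le_INR 1 h); lia).
  assert (Hvinc : forall n, (n0 <= n)%nat -> v n <= v (S n)).
  { intros n Hn. destruct (Hn0 n Hn). lra. }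
  assert (HV := step_bounds V v n0 (fun n => eq_refl) Hvinc).
  assert (Hv : forall n, (n0 <= n)%nat ->
     INR h * (v (S (n + h)) - v (n + h)%nat) <= v (n + h)%nat - v n).
  { intros n Hn.
    pose proof (step_bounds (fun n => - v n) (fun n => - (v (S n) - v n)) n0) as Hb.
    cbv beta in Hb. specialize (Hb ltac:(intros; ring)).
    assert (Hdec : forall n : nat,
       (n0 <= n)%nat -> - (v (S n) - v n) <= - (v (S (S n)) - v (S n))).
    { intros m Hm. destruct (Hn0 m Hm). lra. }
    specialize (Hb Hdec h n Hn). lra. }
  assert (Ediff : forall n, V (S n + h)%nat - V (S n) - (V (n + h)%nat - V n)
                           = v (n + h)%nat - v n).
  { intros n. unfold v. simpl. ring. }
  assert (Hv1 : forall n, (n0 <= n)%nat ->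
     v (S (n + h)) - v (n + h)%nat <= v (n + h)%nat - v n).
  { intros n Hn. specialize (Hv n Hn). destruct (Hn0 (n + h)%nat ltac:(lia)). nra. }
  apply is_lim_seq_spec in Hvinf.
  destruct (Hvinf 0) as [n1 Hn1].
  split; [|split; [|split]].
  - exists n0. intros n Hn. rewrite !Ediff. split.
    + pose proof (Hv1 n Hn). destruct (Hn0 (n + h)%nat ltac:(lia)). lra.
    + assert (Hdec : forall k, v (S (n + k)) - v (n + k)%nat <= v (S n) - v n).
      { induction k as [|k IHk]; [rewrite Nat.add_0_r; lra|].
        rewrite Nat.add_succ_r. destruct (Hn0 (n + k)%nat ltac:(lia)). lra. }
      specialize (Hdec h). simpl. lra.
  - apply is_lim_seq_ext with (fun n => v (n + h)%nat - v n); [intros; symmetry; apply Ediff|].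
    rewrite <- (Rmult_0_r (INR h)). now apply lim_step.
  - apply is_lim_seq_spec. intros M. destruct (Hvinf M) as [n2 Hn2].
    exists (Nat.max n0 (Nat.max n1 n2)). intros n Hn.
    specialize (HV h n ltac:(lia)). specialize (Hn1 n ltac:(lia)).
    specialize (Hn2 n ltac:(lia)). nra.
  - intros eps Heps.
    destruct (Hratio (eps / (2 * INR h))) as [N0 HN0]; [apply Rdiv_lt_0_compat; lra|].
    exists (Nat.max h (Nat.max n0 N0)). intros N HN.
    specialize (HN0 (N + h)%nat ltac:(lia)). specialize (HV h N ltac:(lia)).
    specialize (Hv1 N ltac:(lia)).
    rewrite Ediff.
    eapply Rle_trans; [apply HV|].
    apply (Rmult_le_compat_l (INR h)) in HN0; [|lra].
    eapply Rle_trans; [exact HN0|].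
    assert (Hsq : sqrt (v (S (N + h)) - v (N + h)%nat) <= sqrt (v (N + h)%nat - v N))
      by now apply sqrt_le_1_alt.
    assert (HNh : INR (N + h) <= 2 * INR N).
    { rewrite plus_INR. pose proof (le_INR h N ltac:(lia)). lra. }
    set (x := sqrt (v (S (N + h)) - v (N + h)%nat)) in *.
    pose proof (sqrt_pos (v (S (N + h)) - v (N + h)%nat)) as Hx. fold x in Hx.
    set (y := sqrt (v (N + h)%nat - v N)) in *.
    replace (INR h * (eps / (2 * INR h) * (INR (N + h) * x)))
      with (eps / 2 * (INR (N + h) * x)) by (field; lra).
    replace (eps * (INR N * y)) with (eps / 2 * (2 * INR N * y)) by field.
    apply Rmult_le_compat_l; [lra|].
    apply Rmult_le_compat; try lra. apply pos_INR.
Qed.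

Lemma mean_zero_e_slow_diff k : forall u : nat -> R,
  slow (diff (S k) u) -> mean_zero (fun n => e (u n)).
Proof.
  induction k as [|k IH]; intros u Hu.
  - destruct Hu as (Hw & Hw0 & Hvinf & Hratio).
    now apply mean_zero_e_second_difference with (d := diff 1 u)
      (D := fun n => diff 1 u (S n) - diff 1 u n).
  - apply mean_zero_e_of_step. intros h Hh. apply IH.
    pose proof (slow_step (diff (S k) u) h Hh Hu) as Hs.
    replace (diff (S k) (fun n => u (n + h)%nat - u n))
      with (fun n => diff (S k) u (n + h)%nat - diff (S k) u n); [exact Hs|].
    apply FunctionalExtensionality.functional_extensionality. intros n.
    now rewrite diff_step.
Qed.

(** * Adjoining the identity function to a Hardy field *)

Notation ultimately P := (Rbar_locally p_infty P).

Lemma ultimately_gt M : ultimately (fun x => M < x).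
Proof. exists M; auto. Qed.

Lemma ultimately_locally (P : R -> Prop) :
  ultimately P -> ultimately (fun x => locally x P).
Proof.
  intros [M HM]. exists M. intros x Hx.
  apply (locally_interval P x M p_infty); simpl; auto.
Qed.

Lemma germ_eq_Derive f g : germ_eq f g -> germ_eq (Derive f) (Derive g).
Proof.
  unfold germ_eq. intros H. apply ultimately_locally in H. revert H. apply filter_imp.
  intros x Hx. now apply Derive_ext_loc.
Qed.

Lemma germ_eq_sym f g : germ_eq f g -> germ_eq g f.
Proof. unfold germ_eq. apply filter_imp. intros; now symmetry. Qed.

Lemma germ_eq_trans f g h : germ_eq f g -> germ_eq g h -> germ_eq f h.
Proof.
  unfold germ_eq. intros H1 H2. generalize (filter_and _ _ H1 H2). apply filter_imp.
  intros x [-> ->]; reflexivity.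
Qed.

Definition smooth_on (M : R) (f : R -> R) : Prop :=
  forall (n : nat) (x : R), M < x -> ex_derive_n f n x.

Lemma Derive_n_Derive f n x : Derive_n (Derive f) n x = Derive_n f (S n) x.
Proof.
  change (Derive f) with (Derive_n f 1). rewrite Derive_n_comp.
  now rewrite Nat.add_1_r.
Qed.

Lemma smooth_on_Derive M f : smooth_on M f -> smooth_on M (Derive f).
Proof.
  intros Hf [|n] x Hx; [exact I|].
  simpl. apply ex_derive_ext with (Derive_n f (S n)).
  - intros y. now rewrite Derive_n_Derive.
  - apply (Hf (S (S n)) x Hx).
Qed.

Lemma smooth_on_ext M f g : (forall x, M < x -> f x = g x) -> smooth_on M f -> smooth_on M g.
Proof.
  intros Hfg Hf n x Hx. apply ex_derive_n_ext_loc with f; [|now apply Hf].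
  apply (locally_interval _ x M p_infty); simpl; auto.
Qed.

Lemma smooth_on_weaken M M' f : M <= M' -> smooth_on M f -> smooth_on M' f.
Proof. intros HM Hf n x Hx. apply Hf; lra. Qed.

Lemma locally_above (M x : R) (P : R -> Prop) :
  M < x -> (forall y, M < y -> P y) -> locally x P.
Proof. intros Hx HP. apply (locally_interval _ x M p_infty); simpl; auto. Qed.

Lemma smooth_on_plus M f g : smooth_on M f -> smooth_on M g -> smooth_on M (fun x => f x + g x).
Proof.
  intros Hf Hg n x Hx.
  apply ex_derive_n_plus; apply (locally_above M); auto.
Qed.

Lemma smooth_on_ex_derive M f x : smooth_on M f -> M < x -> ex_derive f x.
Proof. intros Hf Hx. exact (Hf 1%nat x Hx). Qed.

Lemma smooth_on_mult M f g : smooth_on M f -> smooth_on M g -> smooth_on M (fun x => f x * g x).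
Proof.
  intros Hf Hg n. revert f g Hf Hg. induction n as [n IH] using lt_wf_ind.
  intros f g Hf Hg x Hx. destruct n as [|[|n]]; [exact I| |].
  - simpl. apply ex_derive_mult; now apply (smooth_on_ex_derive M).
  - assert (H : ex_derive_n (Derive (fun x => f x * g x)) (S n) x).
    { apply ex_derive_n_ext_loc with (fun y => Derive f y * g y + f y * Derive g y).
      - apply (locally_above M); [exact Hx|]. intros y Hy. symmetry.
        apply Derive_mult; now apply (smooth_on_ex_derive M).
      - apply ex_derive_n_plus; apply (locally_above M); try exact Hx;
          intros y Hy k Hk; apply IH; auto using smooth_on_Derive; lia. }
    simpl in H |- *. revert H. apply ex_derive_ext.
    intros y. exact (Derive_n_Derive (fun x => f x * g x) n y).
Qed.

Lemma germ_smooth_ext f g : germ_eq f g -> germ_smooth f -> germ_smooth g.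
Proof.
  intros [M1 H1] [M2 H2]. exists (Rmax M1 M2).
  pose proof (Rmax_l M1 M2). pose proof (Rmax_r M1 M2).
  apply smooth_on_ext with f; [intros; apply H1; lra|].
  now apply smooth_on_weaken with M2.
Qed.

Lemma germ_smooth_common f g : germ_smooth f -> germ_smooth g ->
  exists M, smooth_on M f /\ smooth_on M g.
Proof.
  intros [M1 H1] [M2 H2]. exists (Rmax M1 M2).
  split; [apply smooth_on_weaken with M1|apply smooth_on_weaken with M2];
    auto using Rmax_l, Rmax_r.
Qed.

Lemma germ_smooth_plus f g :
  germ_smooth f -> germ_smooth g -> germ_smooth (fun x => f x + g x).
Proof.
  intros Hf Hg. destruct (germ_smooth_common f g Hf Hg) as (M & H1 & H2).
  exists M. now apply smooth_on_plus.
Qed.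

Lemma germ_smooth_mult f g :
  germ_smooth f -> germ_smooth g -> germ_smooth (fun x => f x * g x).
Proof.
  intros Hf Hg. destruct (germ_smooth_common f g Hf Hg) as (M & H1 & H2).
  exists M. now apply smooth_on_mult.
Qed.

Lemma germ_smooth_pow k : germ_smooth (fun x => x ^ k).
Proof. exists 0. intros n x _. apply ex_derive_n_pow. Qed.

Lemma germ_smooth_ex_derive f : germ_smooth f -> ultimately (fun x => ex_derive f x).
Proof. intros [M HM]. exists M. intros x Hx. now apply (smooth_on_ex_derive M). Qed.

Lemma MVT_above M f a b :
  (forall x, M < x -> ex_derive f x) -> M < a -> a < b ->
  exists c, a < c < b /\ f b - f a = Derive f c * (b - a).
Proof.
  intros Hf Ha Hab.
  destruct (MVT_cor2 f (Derive f) a b Hab) as [c [Hc1 Hc2]].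
  - intros c Hc. apply is_derive_Reals, Derive_correct, Hf. lra.
  - exists c. auto.
Qed.

Definition sign_definite (u : R -> R) : Prop :=
  germ_eq u (fun _ => 0) \/ ultimately (fun x => 0 < u x) \/ ultimately (fun x => u x < 0).

Lemma sign_definite_ext u v : germ_eq u v -> sign_definite u -> sign_definite v.
Proof.
  unfold sign_definite, germ_eq.
  intros Huv [H|[H|H]]; [left|right; left|right; right];
    generalize (filter_and _ _ Huv H); apply filter_imp; intros x [E Hx]; congruence || lra.
Qed.

Lemma sign_definite_mult u v :
  sign_definite u -> sign_definite v -> sign_definite (fun x => u x * v x).
Proof.
  unfold sign_definite, germ_eq.
  intros [Hu|[Hu|Hu]] [Hv|[Hv|Hv]]; generalize (filter_and _ _ Hu Hv); intros H;
    [left|left|left|left|right; left|right; right|left|right; right|right; left];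
    revert H; apply filter_imp; intros x [H1 H2]; nra.
Qed.

Lemma sign_definite_of_derive w :
  germ_smooth w -> sign_definite (Derive w) -> sign_definite w.
Proof.
  unfold sign_definite, germ_eq.
  intros Hw. apply germ_smooth_ex_derive in Hw.
  (* A strictly increasing function changes sign at most once. *)
  assert (Hinc : forall w : R -> R, ultimately (fun x => ex_derive w x) ->
    ultimately (fun x => 0 < Derive w x) -> sign_definite w).
  { clear. unfold sign_definite, germ_eq. intros w Hw Hp. destruct (filter_and _ _ Hw Hp) as [M HM].
    destruct (classic (exists y, M < y /\ 0 <= w y)) as [(y & Hy & Hwy)|Hn].
    - right; left. exists y. intros x Hx.
      destruct (MVT_above M w y x) as (c & Hc & E); [apply HM|lra|lra|].
      destruct (HM c ltac:(lra)) as [_ Hc']. nra.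
    - right; right. exists M. intros x Hx. apply Rnot_le_lt. intros H0.
      apply Hn. now exists x. }
  unfold sign_definite, germ_eq in Hinc.
  intros [H|[H|H]].
  - destruct (filter_and _ _ Hw H) as [M HM].
    assert (Hc : forall x, M + 1 < x -> w x = w (M + 1)).
    { intros x Hx. destruct (MVT_above M w (M + 1) x) as (c & Hc & E); [apply HM|lra|lra|].
      destruct (HM c ltac:(lra)) as [_ Hc']. rewrite Hc' in E. lra. }
    destruct (Rtotal_order (w (M + 1)) 0) as [H0|[H0|H0]].
    + right; right. exists (M + 1). intros x Hx. now rewrite Hc.
    + left. exists (M + 1). intros x Hx. now rewrite Hc.
    + right; left. exists (M + 1). intros x Hx. now rewrite Hc.
  - now apply Hinc.
  - destruct (Hinc (fun x => - w x)) as [H'|[H'|H']].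
    + revert Hw. apply filter_imp. intros x Hx. now apply (ex_derive_opp w).
    + generalize (filter_and _ _ Hw H). apply filter_imp. intros x [_ Hx].
      rewrite Derive_opp. lra.
    + left. revert H'. apply filter_imp. intros; lra.
    + right; right. revert H'. apply filter_imp. intros; lra.
    + right; left. revert H'. apply filter_imp. intros; lra.
Qed.

(** By the intermediate value theorem. *)
Lemma sign_definite_of_nonvanishing w :
  germ_smooth w -> ultimately (fun x => w x <> 0) -> sign_definite w.
Proof.
  intros Hw Hn. apply germ_smooth_ex_derive in Hw.
  destruct (filter_and _ _ Hw Hn) as [M HM].
  assert (Hcont : forall x, M < x -> continuity_pt w x).
  { intros x Hx. apply continuity_pt_filterlim, (ex_derive_continuous w), HM, Hx. }
  destruct (Rtotal_order (w (M + 1)) 0) as [H0|[H0|H0]].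
  - right; right. exists (M + 1). intros x Hx. apply Rnot_le_lt. intros Hx0.
    destruct (Ranalysis5.IVT_interv w (M + 1) x) as (z & Hz & Ez).
    + intros a Ha. apply Hcont; lra.
    + lra.
    + exact H0.
    + destruct Hx0 as [Hx0|Hx0]; [exact Hx0|].
      symmetry in Hx0. apply HM in Hx0; [easy|lra].
    + apply HM in Ez; [easy|lra].
  - apply HM in H0; [easy|lra].
  - right; left. exists (M + 1). intros x Hx. apply Rnot_le_lt. intros Hx0.
    destruct (Ranalysis5.IVT_interv (fun y => - w y) (M + 1) x) as (z & Hz & Ez).
    + intros a Ha. apply continuity_pt_opp, Hcont; lra.
    + lra.
    + lra.
    + destruct Hx0 as [Hx0|Hx0]; [lra|]. apply HM in Hx0; [easy|lra].
    + assert (Ez' : w z = 0) by lra. apply HM in Ez'; [easy|lra].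
Qed.

(** The degree filtration of [H[x]], with the leading term split off so that
    inductions on the degree can remove it. *)
Fixpoint poly_over (H : (R -> R) -> Prop) (n : nat) (u : R -> R) : Prop :=
  match n with
  | O => H u
  | S m => exists a v, H a /\ poly_over H m v /\ germ_eq u (fun x => v x + a x * x ^ S m)
  end.


Lemma poly_over_ext H n u w :
  is_Hardy_field H -> germ_eq u w -> poly_over H n u -> poly_over H n w.
Proof.
  intros HH E. destruct n as [|n]; simpl.
  - now apply (hardy_germ H HH).
  - intros (a & v & Ha & Hv & Eu). exists a, v. repeat split; auto.
    eapply germ_eq_trans; [apply germ_eq_sym, E|exact Eu].
Qed.

Lemma germ_eq_pointwise u w : (forall x, u x = w x) -> germ_eq u w.
Proof. intros E. exists 0. auto. Qed.

Lemma poly_over_S H n u : is_Hardy_field H -> poly_over H n u -> poly_over H (S n) u.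
Proof.
  intros HH Hu. exists (fun _ => 0), u. repeat split; auto.
  - apply (hardy_zero H HH).
  - apply germ_eq_pointwise. intros; ring.
Qed.

Lemma poly_over_le H n m u :
  is_Hardy_field H -> (n <= m)%nat -> poly_over H n u -> poly_over H m u.
Proof. intros HH Hnm Hu. induction Hnm; auto using poly_over_S. Qed.

Lemma poly_over_plus H n : is_Hardy_field H -> forall u w,
  poly_over H n u -> poly_over H n w -> poly_over H n (fun x => u x + w x).
Proof.
  intros HH. induction n as [|n IH]; intros u w; simpl.
  - apply (hardy_add H HH).
  - intros (a & v & Ha & Hv & Eu) (b & v' & Hb & Hv' & Ew).
    exists (fun x => a x + b x), (fun x => v x + v' x). repeat split.
    + now apply (hardy_add H HH).
    + now apply IH.
    + generalize (filter_and _ _ Eu Ew). unfold germ_eq. apply filter_imp.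
      intros x [-> ->]. simpl. ring.
Qed.

Lemma poly_over_scal H n b : is_Hardy_field H -> H b -> forall u,
  poly_over H n u -> poly_over H n (fun x => b x * u x).
Proof.
  intros HH Hb. induction n as [|n IH]; intros u; simpl.
  - now apply (hardy_mul H HH).
  - intros (a & v & Ha & Hv & Eu).
    exists (fun x => b x * a x), (fun x => b x * v x). repeat split.
    + now apply (hardy_mul H HH).
    + now apply IH.
    + revert Eu. unfold germ_eq. apply filter_imp. intros x ->. simpl. ring.
Qed.

Lemma poly_over_0 H n u : is_Hardy_field H -> H u -> poly_over H n u.
Proof. intros HH Hu. apply poly_over_le with 0%nat; [exact HH|lia|exact Hu]. Qed.

Lemma poly_over_monomial H n a :
  is_Hardy_field H -> H a -> poly_over H n (fun x => a x * x ^ n).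
Proof.
  intros HH Ha. destruct n as [|n].
  - apply (hardy_germ H HH a); [|exact Ha]. apply germ_eq_pointwise. intros; simpl; ring.
  - exists a, (fun _ => 0). repeat split; [exact Ha| |].
    + apply poly_over_0; [exact HH|apply (hardy_zero H HH)].
    + apply germ_eq_pointwise. intros; ring.
Qed.

Lemma poly_over_mul_id H n : is_Hardy_field H -> forall u,
  poly_over H n u -> poly_over H (S n) (fun x => x * u x).
Proof.
  intros HH. induction n as [|n IH]; intros u Hu.
  - exists u, (fun _ => 0). repeat split; [exact Hu|apply (hardy_zero H HH)|].
    apply germ_eq_pointwise. intros; simpl; ring.
  - destruct Hu as (a & v & Ha & Hv & Eu).
    exists a, (fun x => x * v x). repeat split; [exact Ha|now apply IH|].
    revert Eu. unfold germ_eq. apply filter_imp. intros x ->. simpl. ring.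
Qed.

Lemma poly_over_mul_pow H n k u : is_Hardy_field H ->
  poly_over H n u -> poly_over H (n + k) (fun x => u x * x ^ k).
Proof.
  intros HH Hu. induction k as [|k IH].
  - rewrite Nat.add_0_r. revert Hu. apply poly_over_ext; [exact HH|].
    apply germ_eq_pointwise. intros; simpl; ring.
  - rewrite Nat.add_succ_r.
    apply poly_over_ext with (fun x => x * (u x * x ^ k)); [exact HH| |].
    + apply germ_eq_pointwise. intros; simpl; ring.
    + now apply poly_over_mul_id.
Qed.

Lemma poly_over_mult H n m : is_Hardy_field H -> forall u w,
  poly_over H n u -> poly_over H m w -> poly_over H (n + m) (fun x => u x * w x).
Proof.
  intros HH. induction m as [|m IH]; intros u w Hu Hw.
  - rewrite Nat.add_0_r.
    apply poly_over_ext with (fun x => w x * u x); [exact HH| |].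
    + apply germ_eq_pointwise. intros; ring.
    + now apply poly_over_scal.
  - destruct Hw as (a & v & Ha & Hv & Ew).
    apply poly_over_ext with (fun x => u x * v x + (a x * u x) * x ^ S m); [exact HH| |].
    + apply germ_eq_sym. revert Ew. unfold germ_eq. apply filter_imp. intros x ->. simpl. ring.
    + apply poly_over_plus; [exact HH| |].
      * rewrite Nat.add_succ_r. apply poly_over_S; [exact HH|now apply IH].
      * apply poly_over_mul_pow; [exact HH|now apply poly_over_scal].
Qed.

Lemma poly_over_smooth H n : is_Hardy_field H -> forall u,
  poly_over H n u -> germ_smooth u.
Proof.
  intros HH. induction n as [|n IH]; intros u Hu.
  - now apply (hardy_smooth H HH).
  - destruct Hu as (a & v & Ha & Hv & Eu).
    apply germ_smooth_ext with (fun x => v x + a x * x ^ S n); [now apply germ_eq_sym|].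
    apply germ_smooth_plus; [now apply IH|].
    apply germ_smooth_mult; [now apply (hardy_smooth H HH)|apply germ_smooth_pow].
Qed.

Lemma hardy_INR H k : is_Hardy_field H -> H (fun _ => INR k).
Proof.
  intros HH. induction k as [|k IH]; [apply (hardy_zero H HH)|].
  apply (hardy_germ H HH (fun _ => INR k + 1)).
  - apply germ_eq_pointwise. intros _. now rewrite S_INR.
  - apply (hardy_add H HH _ _ IH (hardy_one H HH)).
Qed.

Lemma poly_over_Derive_monomial_sum H n v a :
  is_Hardy_field H -> poly_over H n (Derive v) -> germ_smooth v -> H a ->
  germ_eq (Derive (fun x => v x + a x * x ^ S n))
    (fun x => (Derive v x + (INR (S n) * a x) * x ^ n) + Derive a x * x ^ S n).
Proof.
  intros HH Hv Sv Ha. pose proof (hardy_smooth H HH a Ha) as Sa.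
  apply germ_smooth_ex_derive in Sv. apply germ_smooth_ex_derive in Sa.
  generalize (filter_and _ _ Sv Sa). unfold germ_eq. apply filter_imp.
  intros x [Dv Da].
  assert (Dp : ex_derive (fun y : R => y ^ S n) x) by (apply ex_derive_pow, ex_derive_id).
  rewrite Derive_plus; [|exact Dv|now apply ex_derive_mult].
  rewrite Derive_mult by assumption.
  rewrite Derive_pow by apply ex_derive_id. rewrite Derive_id.
  simpl Init.Nat.pred. ring.
Qed.

Lemma poly_over_Derive H n : is_Hardy_field H -> forall u,
  poly_over H n u -> poly_over H n (Derive u).
Proof.
  intros HH. induction n as [|n IH]; intros u Hu.
  - now apply (hardy_derive H HH).
  - destruct Hu as (a & v & Ha & Hv & Eu).
    exists (Derive a), (fun x => Derive v x + (INR (S n) * a x) * x ^ n).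
    repeat split.
    + now apply (hardy_derive H HH).
    + apply poly_over_plus; [exact HH|now apply IH|].
      apply (poly_over_monomial H n (fun x => INR (S n) * a x)); [exact HH|].
      apply (hardy_mul H HH (fun _ => INR (S n))); [now apply hardy_INR|exact Ha].
    + eapply germ_eq_trans; [apply germ_eq_Derive, Eu|].
      apply (poly_over_Derive_monomial_sum H); auto.
      now apply (poly_over_smooth H n).
Qed.

(** Dividing by the leading coefficient and differentiating lowers the degree;
    a germ whose derivative has a definite sign has one, too. *)
Lemma poly_over_sign H n : is_Hardy_field H -> forall u,
  poly_over H n u -> sign_definite u.
Proof.
  intros HH.
  assert (Hinv : forall a, H a -> ~ germ_eq a (fun _ => 0) -> exists b,
     H b /\ germ_eq (fun x => a x * b x) (fun _ => 1) /\ sign_definite a).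
  { intros a Ha Hna. destruct (hardy_inv H HH a Ha Hna) as (b & Hb & E).
    exists b. repeat split; auto. apply sign_definite_of_nonvanishing.
    - now apply (hardy_smooth H HH).
    - revert E. unfold germ_eq. apply filter_imp. intros x E E0. rewrite E0 in E. lra. }
  induction n as [|n IH]; intros u Hu.
  - destruct (classic (germ_eq u (fun _ => 0))) as [H0|H0]; [now left|].
    destruct (Hinv u Hu H0) as (b & _ & _ & Hs). exact Hs.
  - destruct Hu as (a & v & Ha & Hv & Eu).
    destruct (classic (germ_eq a (fun _ => 0))) as [H0|H0].
    + apply sign_definite_ext with v; [|now apply IH].
      apply germ_eq_sym. generalize (filter_and _ _ Eu H0).
      unfold germ_eq. apply filter_imp. intros x [-> ->]. ring.
    + destruct (Hinv a Ha H0) as (b & Hb & E & Hsa).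
      set (w := fun x => b x * v x + 1 * x ^ S n).
      assert (Hbv : poly_over H n (fun x => b x * v x)) by now apply poly_over_scal.
      assert (Ew : germ_eq (Derive w)
        (fun x => Derive (fun y => b y * v y) x + INR (S n) * x ^ n)).
      { eapply germ_eq_trans.
        - apply (poly_over_Derive_monomial_sum H n (fun x => b x * v x) (fun _ => 1)); auto.
          + now apply poly_over_Derive.
          + now apply (poly_over_smooth H n).
          + apply (hardy_one H HH).
        - apply germ_eq_pointwise. intros x. rewrite Derive_const. ring. }
      assert (Hw : sign_definite w).
      { apply sign_definite_of_derive.
        - apply germ_smooth_plus; [now apply (poly_over_smooth H n)|].
          apply (poly_over_smooth H (S n) HH), (poly_over_monomial H (S n) (fun _ => 1) HH).
          apply (hardy_one H HH).
        - apply sign_definite_ext with (1 := germ_eq_sym _ _ Ew).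
          apply IH. apply poly_over_plus; [exact HH|now apply poly_over_Derive|].
          apply (poly_over_monomial H n (fun _ => INR (S n)) HH). now apply hardy_INR. }
      apply sign_definite_ext with (fun x => a x * w x); [|now apply sign_definite_mult].
      generalize (filter_and _ _ Eu E). unfold germ_eq. apply filter_imp.
      intros x [-> Eab]. unfold w.
      replace (a x * (b x * v x + 1 * x ^ S n)) with ((a x * b x) * v x + a x * x ^ S n) by ring.
      rewrite Eab. ring.
Qed.

(** The properties of [H[x]] on which the analysis rests.  No inverses are
    included: a quotient is compared with a constant by clearing denominators. *)
Record Hardy_ring (K : (R -> R) -> Prop) : Prop := {
  ring_germ : forall f g, germ_eq f g -> K f -> K g;
  ring_smooth : forall f, K f -> germ_smooth f;
  ring_sign : forall f, K f -> sign_definite f;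
  ring_rational : forall q : Q, K (fun _ => Q2R q);
  ring_id : K (fun x => x);
  ring_plus : forall f g, K f -> K g -> K (fun x => f x + g x);
  ring_mult : forall f g, K f -> K g -> K (fun x => f x * g x);
  ring_Derive : forall f, K f -> K (Derive f)
}.

Lemma hardy_rational H q : is_Hardy_field H -> H (fun _ => Q2R q).
Proof.
  intros HH.
  assert (HZ : forall z, H (fun _ => IZR z)).
  { intros z. destruct (Z_le_gt_dec 0 z) as [Hz|Hz].
    - apply (hardy_germ H HH (fun _ => INR (Z.to_nat z))); [|now apply hardy_INR].
      apply germ_eq_pointwise. intros _. now rewrite INR_IZR_INZ, Z2Nat.id.
    - apply (hardy_germ H HH (fun _ => - INR (Z.to_nat (- z)))).
      + apply germ_eq_pointwise. intros _. rewrite INR_IZR_INZ, Z2Nat.id by lia.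
        rewrite opp_IZR. ring.
      + apply (hardy_opp H HH (fun _ => INR (Z.to_nat (- z)))). now apply hardy_INR. }
  destruct q as [z d].
  assert (Hd : IZR (Zpos d) <> 0) by (apply not_0_IZR; discriminate).
  destruct (hardy_inv H HH (fun _ => IZR (Zpos d)) (HZ _)) as (b & Hb & E).
  - intros [M HM]. apply Hd, (HM (M + 1)). lra.
  - apply (hardy_germ H HH (fun x => IZR z * b x)).
    + revert E. unfold germ_eq. apply filter_imp. intros x E. unfold Q2R. cbn [Qnum Qden].
      apply Rmult_eq_reg_l with (IZR (Zpos d)); [|exact Hd].
      replace (IZR (Zpos d) * (IZR z * b x)) with (IZR z * (IZR (Zpos d) * b x)) by ring.
      rewrite E. field. exact Hd.
    + apply (hardy_mul H HH (fun _ => IZR z)); auto.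
Qed.

(** The germ of the identity may be missing from [H]; without it neither
    [f - p] nor powers of [x] could be compared with elements of [H]. *)
Lemma Hardy_ring_adjoin_id H : is_Hardy_field H ->
  Hardy_ring (fun u => exists n, poly_over H n u).
Proof.
  intros HH. constructor.
  - intros f g E [n Hn]. exists n. now apply poly_over_ext with f.
  - intros f [n Hn]. now apply (poly_over_smooth H n).
  - intros f [n Hn]. now apply (poly_over_sign H n).
  - intros q. exists 0%nat. now apply hardy_rational.
  - exists 1%nat. apply poly_over_ext with (fun x => 1 * x ^ 1); [exact HH| |].
    + apply germ_eq_pointwise. intros; ring.
    + apply (poly_over_monomial H 1 (fun _ => 1) HH). apply (hardy_one H HH).
  - intros f g [n Hn] [m Hm]. exists (Nat.max n m). apply poly_over_plus; [exact HH| |].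
    + apply poly_over_le with n; [exact HH|lia|exact Hn].
    + apply poly_over_le with m; [exact HH|lia|exact Hm].
  - intros f g [n Hn] [m Hm]. exists (n + m)%nat. now apply poly_over_mult.
  - intros f [n Hn]. exists n. now apply poly_over_Derive.
Qed.

(** * Growth of germs in a Hardy ring *)

Lemma increment_le M (f g f' g' : R -> R) :
  (forall x, M < x -> is_derive f x (f' x)) ->
  (forall x, M < x -> is_derive g x (g' x)) ->
  (forall x, M < x -> f' x <= g' x) ->
  forall a b, M < a -> a <= b -> f b - f a <= g b - g a.
Proof.
  intros Hf Hg Hle a b Ha [Hab|<-]; [|lra].
  destruct (MVT_cor2 (fun x => g x - f x) (fun x => g' x - f' x) a b Hab) as (c & E & Hc).
  - intros c Hc. apply is_derive_Reals.
    apply (is_derive_minus g f); [apply Hg|apply Hf]; lra.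
  - pose proof (Hle c ltac:(lra)). nra.
Qed.

Lemma Rabs_increment_le M (f g f' g' : R -> R) :
  (forall x, M < x -> is_derive f x (f' x)) ->
  (forall x, M < x -> is_derive g x (g' x)) ->
  (forall x, M < x -> Rabs (f' x) <= g' x) ->
  forall a b, M < a -> a <= b -> Rabs (f b - f a) <= g b - g a.
Proof.
  intros Hf Hg Hle a b Ha Hab. apply Rabs_le.
  assert (H1 : f b - f a <= g b - g a).
  { apply (increment_le M f g f' g'); auto. intros x Hx.
    pose proof (Hle x Hx). pose proof (Rle_abs (f' x)). lra. }
  assert (H2 : - f b - - f a <= g b - g a).
  { apply (increment_le M (fun x => - f x) g (fun x => - f' x) g'); auto.
    - intros x Hx. apply (is_derive_opp f). now apply Hf.
    - intros x Hx. pose proof (Hle x Hx). pose proof (Rabs_maj2 (f' x)). lra. }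
  lra.
Qed.

Lemma is_lim_p_infty_eps f (l : R) :
  is_lim f p_infty l -> forall eps, 0 < eps -> ultimately (fun x => Rabs (f x - l) < eps).
Proof.
  intros H eps Heps. apply is_lim_spec in H. exact (H (mkposreal eps Heps)).
Qed.

Lemma nondecreasing_limit f M :
  (forall x y, M < x -> x <= y -> f x <= f y) -> exists l : Rbar, is_lim f p_infty l.
Proof.
  intros Hf.
  destruct (classic (exists B, forall x, M < x -> f x <= B)) as [[B HB]|HB].
  - destruct (completeness (fun y => exists x, M < x /\ y = f x)) as [l [Hl1 Hl2]].
    + exists B. intros y (x & Hx & ->). now apply HB.
    + exists (f (M + 1)), (M + 1). split; [lra|reflexivity].
    + exists l. apply is_lim_spec. intros [eps Heps]. simpl.
      destruct (classic (exists x, M < x /\ l - eps < f x)) as [(a & Ha & Hfa)|Hn].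
      * exists a. intros x Hx. pose proof (Hf a x Ha (Rlt_le _ _ Hx)).
        assert (f x <= l) by (apply Hl1; exists x; split; [lra|reflexivity]).
        apply Rabs_def1; lra.
      * exfalso. assert (l <= l - eps); [|lra]. apply Hl2.
        intros y (x & Hx & ->). apply Rnot_lt_le. intros H. apply Hn. now exists x.
  - exists p_infty. apply is_lim_spec. intros B.
    destruct (classic (exists x, M < x /\ B < f x)) as [(a & Ha & Hfa)|Hn].
    + exists a. intros x Hx. pose proof (Hf a x Ha (Rlt_le _ _ Hx)). lra.
    + exfalso. apply HB. exists B. intros x Hx. apply Rnot_lt_le. intros H.
      apply Hn. now exists x.
Qed.

Lemma ring_const K r : Hardy_ring K -> (exists q : Q, r = Q2R q) -> K (fun _ => r).
Proof. intros HK [q ->]. now apply ring_rational. Qed.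

Lemma ring_INR K n : Hardy_ring K -> K (fun _ => INR n).
Proof.
  intros HK. apply ring_const; [exact HK|].
  exists (inject_Z (Z.of_nat n)). unfold Q2R; simpl. rewrite INR_IZR_INZ. field.
Qed.

Lemma ring_opp K f : Hardy_ring K -> K f -> K (fun x => - f x).
Proof.
  intros HK Hf. apply (ring_germ K HK (fun x => Q2R (-1) * f x)).
  - apply germ_eq_pointwise. intros x. unfold Q2R; simpl. field.
  - apply (ring_mult K HK (fun _ => Q2R (-1))); [now apply ring_rational|exact Hf].
Qed.

Lemma ring_minus K f g : Hardy_ring K -> K f -> K g -> K (fun x => f x - g x).
Proof.
  intros HK Hf Hg. apply (ring_plus K HK f (fun x => - g x)); [exact Hf|].
  now apply ring_opp.
Qed.

Lemma ring_pow K f k : Hardy_ring K -> K f -> K (fun x => f x ^ k).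
Proof.
  intros HK Hf. induction k as [|k IH]; simpl.
  - apply (ring_INR K 1 HK).
  - now apply (ring_mult K HK).
Qed.

Lemma ring_Derive_n K f k : Hardy_ring K -> K f -> K (Derive_n f k).
Proof.
  intros HK Hf. induction k as [|k IH]; [exact Hf|]. now apply (ring_Derive K HK).
Qed.

Lemma ring_compare K f g : Hardy_ring K -> K f -> K g ->
  ultimately (fun x => f x <= g x) \/ ultimately (fun x => g x <= f x).
Proof.
  intros HK Hf Hg.
  destruct (ring_sign K HK _ (ring_minus K f g HK Hf Hg)) as [H|[H|H]].
  - left. revert H. unfold germ_eq. apply filter_imp. intros; lra.
  - right. revert H. apply filter_imp. intros; lra.
  - left. revert H. apply filter_imp. intros; lra.
Qed.

Lemma ring_ex_derive K f : Hardy_ring K -> K f -> ultimately (fun x => ex_derive f x).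
Proof. intros HK Hf. apply germ_smooth_ex_derive, (ring_smooth K HK), Hf. Qed.

Lemma ring_limit K f : Hardy_ring K -> K f -> exists l : Rbar, is_lim f p_infty l.
Proof.
  intros HK Hf.
  assert (H0 : K (fun _ => 0)) by apply (ring_INR K 0 HK).
  pose proof (ring_ex_derive K f HK Hf) as Hd.
  destruct (ring_compare K _ _ HK H0 (ring_Derive K HK f Hf)) as [H|H];
    destruct (filter_and _ _ Hd H) as [M HM].
  - apply nondecreasing_limit with M. intros x y Hx Hxy.
    enough (0 - 0 <= f y - f x) by lra.
    apply (increment_le M (fun _ => 0) f (fun _ => 0) (Derive f)); auto.
    + intros; apply (is_derive_const (V := R_NormedModule)).
    + intros z Hz. now apply Derive_correct, HM.
    + intros z Hz. now apply HM.
  - destruct (nondecreasing_limit (fun x => - f x) M) as [l Hl].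
    + intros x y Hx Hxy.
      enough (f y - f x <= 0 - 0) by lra.
      apply (increment_le M f (fun _ => 0) (Derive f) (fun _ => 0)); auto.
      * intros z Hz. now apply Derive_correct, HM.
      * intros; apply (is_derive_const (V := R_NormedModule)).
      * intros z Hz. now apply HM.
    + exists (Rbar_opp l). apply is_lim_opp in Hl. revert Hl. apply is_lim_ext.
      intros; ring.
Qed.

Lemma ultimately_INR (P : R -> Prop) :
  ultimately P -> exists n0, forall n, (n0 <= n)%nat -> forall x, INR n <= x -> P x.
Proof.
  intros [M HM]. destruct (eventually_le_INR (M + 1)) as [n0 Hn0]. exists n0.
  intros n Hn x Hx. apply HM. specialize (Hn0 n Hn). lra.
Qed.

(** The mean value theorem for iterated differences. *)
Lemma diff_Derive_n k : forall f M n, smooth_on M f -> M < INR n ->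
  exists xi, INR n <= xi <= INR n + INR k /\
    diff k (fun m => f (INR m)) n = Derive_n f k xi.
Proof.
  induction k as [|k IH]; intros f M n Hf Hn.
  - exists (INR n). simpl. split; [lra|reflexivity].
  - set (g := fun x => f (x + 1) + - f x).
    assert (Hs1 : smooth_on M (fun x => f (x + 1))).
    { intros j x Hx. apply ex_derive_n_comp_trans, Hf. lra. }
    assert (Hs2 : smooth_on M (fun x => - f x)).
    { intros j x Hx. now apply ex_derive_n_opp, Hf. }
    destruct (IH g M n) as (xi & Hxi & E); [now apply smooth_on_plus|exact Hn|].
    destruct (MVT_above M (Derive_n f k) xi (xi + 1)) as (c & Hc & Ec).
    { intros x Hx. exact (Hf (S k) x Hx). }
    { lra. } { lra. }
    exists c. split; [rewrite S_INR; lra|].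
    rewrite diff_S, (diff_ext _ _ (fun m => g (INR m))).
    + rewrite E. unfold g.
      rewrite Derive_n_plus; try (apply (locally_above M); [lra|auto]).
      rewrite Derive_n_comp_trans, Derive_n_opp.
      simpl. lra.
    + intros m. unfold g. rewrite S_INR. ring.
Qed.

Lemma is_lim_along (g : R -> R) (l : Rbar) (a : nat -> R) :
  is_lim g p_infty l ->
  (exists n0, forall n, (n0 <= n)%nat -> exists xi, INR n <= xi /\ a n = g xi) ->
  is_lim_seq a l.
Proof.
  intros Hg [n0 Hn0] P HP.
  destruct (ultimately_INR _ (Hg P HP)) as [n1 Hn1].
  exists (Nat.max n0 n1). intros n Hn.
  destruct (Hn0 n ltac:(lia)) as (xi & Hxi & ->). apply (Hn1 n); [lia|exact Hxi].
Qed.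

Lemma ln_unbounded C : ultimately (fun x => C < ln x).
Proof.
  exists (exp C). intros x Hx. rewrite <- (ln_exp C) at 1.
  apply ln_increasing; [apply exp_pos|exact Hx].
Qed.

(** ** Germs with vanishing derivative *)

Lemma ultimately_false (P : R -> Prop) : ultimately P -> (forall x, P x -> False) -> False.
Proof. intros [M HM] H. apply (H (M + 1)), HM. lra. Qed.

(** If [(1 / f')'] does not tend to zero then [1 / f'] grows at least linearly
    and [f] at most logarithmically. *)
Lemma ring_inv_Derive_flat K f : Hardy_ring K -> K f ->
  (forall eps, 0 < eps -> ultimately (fun x => ln x <= eps * Rabs (f x))) ->
  ultimately (fun x => Derive f x <> 0) ->
  forall m, (1 <= m)%nat ->
  ultimately (fun x => INR m * Rabs (Derive (Derive f) x) <= Derive f x ^ 2).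
Proof.
  intros HK Hf Hlog Hne m Hm.
  assert (Hm1 : 1 <= INR m) by (apply (le_INR 1); lia).
  pose proof (ring_Derive K HK f Hf) as Hf'. pose proof (ring_Derive K HK _ Hf') as Hf''.
  destruct (ring_compare K (fun x => (INR m * Derive (Derive f) x) ^ 2)
    (fun x => (Derive f x ^ 2) ^ 2) HK) as [H|H].
  - apply (ring_pow K _ 2 HK), (ring_mult K HK (fun _ => INR m)); [now apply ring_INR|exact Hf''].
  - apply (ring_pow K (fun x => Derive f x ^ 2) 2 HK), ring_pow; assumption.
  - revert H. apply filter_imp. intros x Hx.
    rewrite <- !Rsqr_pow2 in Hx. apply Rsqr_le_abs_0 in Hx.
    rewrite Rabs_mult, (Rabs_pos_eq (INR m)) in Hx by lra.
    rewrite (Rabs_pos_eq (Rsqr _)) in Hx by apply Rle_0_sqr.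
    now rewrite Rsqr_pow2 in Hx.
  - exfalso.
    pose proof (ring_ex_derive K _ HK Hf) as D0. pose proof (ring_ex_derive K _ HK Hf') as D1.
    destruct (filter_and _ _ (filter_and _ _ D0 D1)
      (filter_and _ _ Hne (filter_and _ _ H (ultimately_gt 1)))) as [M HM].
    set (G := fun x => / Derive f x).
    set (a := M + 1).
    assert (HG : forall x, a < x -> (x - a) / INR m <= Rabs (G x - G a)).
    { intros x Hx.
      destruct (MVT_cor2 G (fun x => - Derive (Derive f) x / (Derive f x) ^ 2) a x Hx)
        as (c & Ec & Hc).
      - intros c Hc. apply is_derive_Reals. unfold a in Hc.
        destruct (HM c ltac:(lra)) as ((_ & Dc) & Nc & _).
        unfold G. auto_derive; [tauto|].
        change (Derive (fun y : R => Derive f y) c) with (Derive (Derive f) c).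
        field. exact Nc.
      - rewrite Ec, Rabs_mult, (Rabs_pos_eq (x - a)) by lra.
        unfold a in Hc. destruct (HM c ltac:(lra)) as (_ & Nc & Hc2 & _).
        unfold Rdiv. rewrite Rmult_comm. apply Rmult_le_compat_r; [lra|].
        assert (Hp : 0 < Derive f c ^ 2).
        { assert (0 <= Derive f c ^ 2) by apply pow2_ge_0.
          assert (Derive f c ^ 2 <> 0) by now apply pow_nonzero. lra. }
        rewrite Rabs_mult, Rabs_Ropp, Rabs_inv, (Rabs_pos_eq (Derive f c ^ 2)) by lra.
        rewrite <- !Rsqr_pow2 in Hc2. apply Rsqr_le_abs_0 in Hc2.
        rewrite Rabs_mult, (Rabs_pos_eq (INR m)) in Hc2 by lra.
        rewrite (Rabs_pos_eq (Rsqr _)), Rsqr_pow2 in Hc2 by apply Rle_0_sqr.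
        apply Rmult_le_reg_l with (INR m); [lra|].
        rewrite Rinv_r by lra. rewrite <- Rmult_assoc.
        apply Rmult_le_reg_r with (Derive f c ^ 2); [exact Hp|].
        rewrite Rmult_assoc, Rinv_l by lra. lra. }
    (* beyond [b], the bound [HG] gives [x / (2 m) <= |1 / f'|] *)
    set (b := 2 * (a + INR m * Rabs (G a)) + 1).
    assert (HRa := Rabs_pos (G a)).
    destruct (HM (M + 1) ltac:(lra)) as (_ & _ & _ & HM1).
    assert (Hma : 0 <= INR m * Rabs (G a)) by (apply Rmult_le_pos; lra).
    assert (Hb : a < b) by (unfold b, a in *; lra).
    assert (Hf'le : forall x, b < x -> Rabs (Derive f x) <= 2 * INR m / x).
    { intros x Hx. specialize (HG x ltac:(lra)).
      assert (H2 : x / (2 * INR m) <= Rabs (G x)).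
      { pose proof (Rabs_triang (G x - G a) (G a)) as Ht.
        replace (G x - G a + G a) with (G x) in Ht by ring.
        pose proof (Rabs_triang (G x) (- G a)) as Ht2. rewrite Rabs_Ropp in Ht2.
        fold (G x - G a) in Ht2.
        enough (x / (2 * INR m) + Rabs (G a) <= (x - a) / INR m) by lra.
        apply Rmult_le_reg_l with (2 * INR m); [lra|].
        replace (2 * INR m * (x / (2 * INR m) + Rabs (G a)))
          with (x + 2 * (INR m * Rabs (G a))) by (field; lra).
        replace (2 * INR m * ((x - a) / INR m)) with (2 * x - 2 * a) by (field; lra).
        unfold b in Hx. lra. }
      assert (Hx0 : 0 < x) by (unfold a in *; lra).
      unfold G in H2. rewrite Rabs_inv in H2.
      destruct (HM x ltac:(unfold a in *; lra)) as (_ & Nx & _).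
      apply Rabs_pos_lt in Nx.
      apply Rinv_le_contravar in H2; [|apply Rdiv_lt_0_compat; lra].
      rewrite Rinv_inv in H2. replace (2 * INR m / x) with (/ (x / (2 * INR m)))
        by (field; lra). exact H2. }
    assert (Hfle : forall x, b + 1 < x ->
       Rabs (f x) <= Rabs (f (b + 1)) + 2 * INR m * (ln x - ln (b + 1))).
    { intros x Hx.
      pose proof (Rabs_increment_le b f (fun x => 2 * INR m * ln x) (Derive f)
        (fun x => 2 * INR m / x)) as Hi.
      assert (Hi' := Hi ltac:(intros y Hy; apply Derive_correct, HM; unfold a in *; lra)
        ltac:(intros y Hy; auto_derive; [unfold a in *; lra|field; unfold a in *; lra])
        Hf'le (b + 1) x ltac:(lra) ltac:(lra)).
      cbv beta in Hi'.
      replace (f x) with (f (b + 1) + (f x - f (b + 1))) by ring.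
      eapply Rle_trans; [apply Rabs_triang|]. lra. }
    assert (Hlog' := Hlog (/ (4 * INR m)) ltac:(apply Rinv_0_lt_compat; lra)).
    destruct (filter_and _ _ Hlog'
      (filter_and _ _ (ultimately_gt (b + 1))
        (ln_unbounded (Rabs (f (b + 1)) / (2 * INR m) - ln (b + 1))))) as [N HN].
    set (x := Rmax N (b + 1) + 1).
    pose proof (Rmax_l N (b + 1)) as Hx1. pose proof (Rmax_r N (b + 1)) as Hx2.
    destruct (HN x ltac:(unfold x; lra)) as (H1 & H2 & H3).
    specialize (Hfle x H2).
    apply (Rmult_le_compat_l (4 * INR m)) in H1; [|lra].
    rewrite <- Rmult_assoc, Rinv_r, Rmult_1_l in H1 by lra.
    apply (Rmult_lt_compat_l (2 * INR m)) in H3; [|lra].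
    replace (2 * INR m * (Rabs (f (b + 1)) / (2 * INR m) - ln (b + 1)))
      with (Rabs (f (b + 1)) - 2 * INR m * ln (b + 1)) in H3 by (field; lra).
    lra.
Qed.

Lemma ring_Derive_nonzero K f : Hardy_ring K -> K f ->
  (forall eps, 0 < eps -> ultimately (fun x => ln x <= eps * Rabs (f x))) ->
  ultimately (fun x => Derive f x <> 0).
Proof.
  intros HK Hf Hlog.
  destruct (ring_sign K HK _ (ring_Derive K HK f Hf)) as [H|[H|H]].
  2, 3: revert H; apply filter_imp; intros; lra.
  exfalso.
  destruct (filter_and _ _ (ring_ex_derive K f HK Hf) H) as [M HM].
  assert (Hc : forall x, M + 1 < x -> f x = f (M + 1)).
  { intros x Hx. destruct (MVT_above M f (M + 1) x) as (c & Hc & E); [apply HM|lra|lra|].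
    destruct (HM c ltac:(lra)) as [_ Hc']. rewrite Hc' in E. lra. }
  assert (Hlog1 := Hlog 1 Rlt_0_1).
  apply (ultimately_false _ (filter_and _ _ Hlog1
    (filter_and _ _ (ultimately_gt (M + 1)) (ln_unbounded (Rabs (f (M + 1))))))).
  intros x (H1 & H2 & H3). rewrite (Hc x H2) in H1. lra.
Qed.

(** The increments [f(n + 1) - f(n)] are values of [f'] at nearby points, so that
    [(1 / f')' -> 0] gives the last hypothesis of Fejer's criterion. *)
Lemma mean_zero_e_flat K f : Hardy_ring K -> K f ->
  (forall eps, 0 < eps -> ultimately (fun x => ln x <= eps * Rabs (f x))) ->
  is_lim (Derive f) p_infty 0 ->
  mean_zero (fun n => e (f (INR n))).
Proof.
  intros HK Hf Hlog Hlim.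
  pose proof (ring_Derive_nonzero K f HK Hf Hlog) as Hne.
  pose proof (ring_inv_Derive_flat K f HK Hf Hlog Hne) as Hflat.
  destruct (ultimately_INR _ (filter_and _ _ (ring_ex_derive K f HK Hf)
    (filter_and _ _ (ring_ex_derive K _ HK (ring_Derive K HK f Hf)) Hne))) as [n0 Hn0].
  assert (Hxi : forall n, (n0 <= n)%nat -> exists xi, INR n < xi < INR n + 1 /\
     f (INR (S n)) - f (INR n) = Derive f xi).
  { intros n Hn. rewrite S_INR.
    destruct (MVT_cor2 f (Derive f) (INR n) (INR n + 1)) as (c & Ec & Hc); [lra| |].
    - intros c Hc. apply is_derive_Reals, Derive_correct, (Hn0 n Hn). lra.
    - exists c. split; [exact Hc|]. rewrite Ec. ring. }
  apply mean_zero_e_Fejer with (d := fun n => f (INR (S n)) - f (INR n)).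
  - reflexivity.
  - exists n0. intros n Hn. destruct (Hxi n Hn) as (xi & H1 & ->).
    apply (Hn0 n Hn). lra.
  - apply (is_lim_along (Derive f)); [exact Hlim|].
    exists n0. intros n Hn. destruct (Hxi n Hn) as (xi & H1 & H2).
    exists xi. split; [lra|exact H2].
  - apply eps_is_lim_seq. intros eps Heps.
    destruct (eventually_le_INR (2 / eps + 1)) as [m Hm]. specialize (Hm m (le_n m)).
    assert (Hm0 : 0 < 2 / eps) by (apply Rdiv_lt_0_compat; lra).
    assert (Hm1 : (1 <= m)%nat) by (apply INR_le; simpl; lra).
    destruct (ultimately_INR _ (Hflat m Hm1)) as [n1 Hn1].
    exists (Nat.max n0 n1). intros n Hn. rewrite Rminus_0_r.
    destruct (Hxi n ltac:(lia)) as (x & Hx & ->).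
    destruct (Hxi (S n) ltac:(lia)) as (y & Hy & ->). rewrite S_INR in Hy.
    destruct (MVT_cor2 (fun x => / Derive f x)
      (fun x => - Derive (Derive f) x / (Derive f x) ^ 2) x y ltac:(lra)) as (c & Ec & Hc).
    + intros c Hc. apply is_derive_Reals.
      destruct (Hn0 n ltac:(lia) c ltac:(lra)) as (_ & Dc & Nc).
      auto_derive; [tauto|].
        change (Derive (fun y : R => Derive f y) c) with (Derive (Derive f) c).
        field. exact Nc.
    + rewrite Ec. destruct (Hn0 n ltac:(lia) c ltac:(lra)) as (_ & _ & Nc).
      specialize (Hn1 n ltac:(lia) c ltac:(lra)).
      assert (Hp : 0 < Derive f c ^ 2).
      { assert (0 <= Derive f c ^ 2) by apply pow2_ge_0.
        assert (Derive f c ^ 2 <> 0) by now apply pow_nonzero. lra. }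
      rewrite Rabs_mult. unfold Rdiv.
      rewrite Rabs_mult, Rabs_Ropp, Rabs_inv, (Rabs_pos_eq (Derive f c ^ 2)) by lra.
      rewrite (Rabs_pos_eq (y - x)) by lra.
      assert (Hq : Rabs (Derive (Derive f) c) * / Derive f c ^ 2 <= / INR m).
      { apply Rmult_le_reg_r with (Derive f c ^ 2); [exact Hp|].
        rewrite Rmult_assoc, Rinv_l by lra.
        apply Rmult_le_reg_l with (INR m); [lra|].
        rewrite <- (Rmult_assoc (INR m) (/ INR m)), Rinv_r by lra. lra. }
      assert (Hq0 : 0 <= Rabs (Derive (Derive f) c) * / Derive f c ^ 2)
        by (apply Rmult_le_pos; [apply Rabs_pos|left; now apply Rinv_0_lt_compat]).
      assert (Hm2 : 2 * / INR m <= eps).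
      { apply Rle_div_l; [lra|]. apply (Rmult_le_compat_l eps) in Hm; [|lra].
        replace (eps * (2 / eps + 1)) with (2 + eps) in Hm by (field; lra). lra. }
      nra.
Qed.

(** ** Germs tending to infinity with vanishing derivative *)

Lemma is_lim_p_infty_gt v : is_lim v p_infty p_infty -> forall B, ultimately (fun x => B < v x).
Proof. intros H B. apply is_lim_spec in H. exact (H B). Qed.

Lemma ring_Derive_pos K v : Hardy_ring K -> K v -> is_lim v p_infty p_infty ->
  ultimately (fun x => 0 < Derive v x).
Proof.
  intros HK Hv Hinf.
  assert (Hneg : ultimately (fun x => Derive v x <= 0) -> False).
  { intros H. destruct (filter_and _ _ (ring_ex_derive K v HK Hv) H) as [M HM].
    apply (ultimately_false _ (filter_and _ _ (ultimately_gt (M + 1))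
      (is_lim_p_infty_gt v Hinf (v (M + 1))))).
    intros x (Hx & Hvx).
    destruct (MVT_above M v (M + 1) x) as (c & Hc & E); [apply HM|lra|lra|].
    destruct (HM c ltac:(lra)) as [_ Hc']. nra. }
  destruct (ring_sign K HK _ (ring_Derive K HK v Hv)) as [H|[H|H]]; [|exact H|];
    exfalso; apply Hneg; revert H; unfold germ_eq; apply filter_imp; intros; lra.
Qed.

Lemma ring_Derive_nonpos K w : Hardy_ring K -> K w -> is_lim w p_infty 0 ->
  ultimately (fun x => 0 < w x) -> ultimately (fun x => Derive w x <= 0).
Proof.
  intros HK Hw Hlim Hpos.
  destruct (ring_sign K HK _ (ring_Derive K HK w Hw)) as [H|[H|H]].
  1, 3: revert H; unfold germ_eq; apply filter_imp; intros; lra.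
  exfalso.
  destruct (filter_and _ _ (ring_ex_derive K w HK Hw) (filter_and _ _ H Hpos)) as [M HM].
  destruct (HM (M + 1) ltac:(lra)) as (_ & _ & H0).
  apply (ultimately_false _ (filter_and _ _ (ultimately_gt (M + 1))
      (is_lim_p_infty_eps w 0 Hlim _ H0))).
  intros x (Hx & Hwx).
  destruct (MVT_above M w (M + 1) x) as (c & Hc & E); [apply HM|lra|lra|].
  destruct (HM c ltac:(lra)) as (_ & Hc' & _).
  rewrite Rminus_0_r in Hwx. pose proof (Rle_abs (w x)). nra.
Qed.

(** The derivative of [v / sqrt v'] either tends to zero or is bounded below.
    In the second case [(1 / v)' >= - C / x ^ 2], so that [v] grows linearly, and
    [v'] does not tend to zero. *)
Lemma ring_slow_ratio K v : Hardy_ring K -> K v ->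
  is_lim v p_infty p_infty -> is_lim (Derive v) p_infty 0 ->
  forall eps, 0 < eps -> ultimately (fun x => v x <= eps * (x * sqrt (Derive v x))).
Proof.
  intros HK Hv Hinf Hlim eps Heps.
  pose proof (ring_Derive_pos K v HK Hv Hinf) as Hw.
  pose proof (ring_Derive K HK v Hv) as Kw.
  pose proof (ring_Derive_nonpos K _ HK Kw Hlim Hw) as Hw'.
  pose proof (ring_Derive K HK _ Kw) as Kw'.
  destruct (eventually_le_INR (/ eps + 1)) as [m Hm]. specialize (Hm m (le_n m)).
  assert (He : 0 < / eps) by now apply Rinv_0_lt_compat.
  assert (Hm1 : 1 <= INR m) by lra.
  assert (Hm2 : / INR m <= eps).
  { rewrite <- (Rinv_inv eps). apply Rinv_le_contravar; lra. }
  set (p := fun x => 2 * Derive v x ^ 2 - v x * Derive (Derive v) x).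
  assert (Kp : K p).
  { apply (ring_minus K (fun x => 2 * Derive v x ^ 2) (fun x => v x * Derive (Derive v) x) HK).
    - apply (ring_mult K HK (fun _ => 2)); [|now apply ring_pow].
      apply (ring_INR K 2 HK).
    - now apply (ring_mult K HK). }
  (* [G' = p / (2 v' sqrt v')] for [G = v / sqrt v'] *)
  set (G := fun x => v x / sqrt (Derive v x)).
  set (G' := fun x => p x / (2 * Derive v x * sqrt (Derive v x))).
  assert (HG : ultimately (fun x => is_derive G x (G' x))).
  { generalize (filter_and _ _ (ring_ex_derive K v HK Hv)
      (filter_and _ _ (ring_ex_derive K _ HK Kw) Hw)).
    apply filter_imp. intros x (D0 & D1 & Hp).
    assert (Hs : 0 < sqrt (Derive v x)) by now apply sqrt_lt_R0.
    assert (Ess : sqrt (Derive v x) * sqrt (Derive v x) = Derive v x)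
      by (apply sqrt_sqrt; lra).
    unfold G, G', p. auto_derive; [repeat split; auto; lra|].
    change (Derive (fun y : R => Derive v y) x) with (Derive (Derive v) x).
    change (Derive (fun y : R => v y) x) with (Derive v x).
    set (s := sqrt (Derive v x)) in *. rewrite <- Ess. field. lra. }
  assert (Hbase : ultimately (fun x => 0 < v x /\ 0 < Derive v x /\ Derive (Derive v) x <= 0)).
  { generalize (filter_and _ _ (is_lim_p_infty_gt v Hinf 0) (filter_and _ _ Hw Hw')).
    apply filter_imp. tauto. }
  assert (Hp0 : ultimately (fun x => 0 <= p x)).
  { revert Hbase. apply filter_imp. intros x (H1 & H2 & H3). unfold p.
    pose proof (pow2_ge_0 (Derive v x)). nra. }
  assert (HG'sq : ultimately (fun x => 0 < Derive v x /\ 0 <= G' x /\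
     4 * G' x ^ 2 * Derive v x ^ 3 = p x ^ 2)).
  { generalize (filter_and _ _ Hbase Hp0). apply filter_imp. intros x ((H1 & H2 & _) & H3).
    assert (Hs : 0 < sqrt (Derive v x)) by now apply sqrt_lt_R0.
    assert (Ess : sqrt (Derive v x) * sqrt (Derive v x) = Derive v x)
      by (apply sqrt_sqrt; lra).
    split; [exact H2|]. unfold G'. split.
    - apply Rmult_le_pos; [exact H3|]. left. apply Rinv_0_lt_compat. nra.
    - set (s := sqrt (Derive v x)) in *. rewrite <- Ess. field. lra. }
  destruct (ring_compare K (fun x => (INR m * p x) ^ 2) (fun x => Derive v x ^ 3) HK) as [H|H].
  - apply (ring_pow K _ 2 HK), (ring_mult K HK (fun _ => INR m)); [now apply ring_INR|exact Kp].
  - now apply (ring_pow K _ 3 HK).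
  - destruct (filter_and _ _ HG (filter_and _ _ HG'sq (filter_and _ _ H Hbase))) as [M HM].
    set (a := Rmax M 0 + 1).
    pose proof (Rmax_l M 0) as HaM. pose proof (Rmax_r M 0) as Ha0.
    assert (Hle : forall x, M < x -> G' x <= / (2 * INR m)).
    { intros x Hx. destruct (HM x Hx) as (_ & (H1 & H2 & H3) & H4 & _).
      apply Rnot_lt_le. intros Hlt.
      assert (Hlt1 : 1 < 2 * INR m * G' x).
      { apply (Rmult_lt_compat_l (2 * INR m)) in Hlt; [|lra].
        rewrite Rinv_r in Hlt by lra. exact Hlt. }
      assert (Hcube : 0 < Derive v x ^ 3) by now apply pow_lt.
      replace ((INR m * p x) ^ 2) with (INR m ^ 2 * p x ^ 2) in H4 by ring.
      rewrite <- H3 in H4.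
      replace (INR m ^ 2 * (4 * G' x ^ 2 * Derive v x ^ 3))
        with ((2 * INR m * G' x) ^ 2 * Derive v x ^ 3) in H4 by ring.
      assert (Hsq : 1 < (2 * INR m * G' x) ^ 2) by nra. nra. }
    assert (HGx : forall x, a < x -> G x <= G a + (x - a) * / (2 * INR m)).
    { intros x Hx.
      pose proof (increment_le M G (fun x => x * / (2 * INR m)) G' (fun _ => / (2 * INR m))) as Hi.
      specialize (Hi ltac:(intros y Hy; apply HM, Hy)
         ltac:(intros y Hy; auto_derive; [trivial|ring]) Hle a x ltac:(unfold a; lra) ltac:(lra)).
      cbv beta in Hi. lra. }
    generalize (filter_and _ _ (ultimately_gt a) (ultimately_gt (2 * INR m * Rabs (G a)))).
    intros [N HN]. exists (Rmax N M). intros x Hx.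
    pose proof (Rmax_l N M) as HNx. pose proof (Rmax_r N M) as HMx.
    destruct (HN x ltac:(lra)) as [Hxa Hxb].
    destruct (HM x ltac:(lra)) as (_ & (H1 & _) & _ & H5 & _).
    specialize (HGx x Hxa).
    assert (Hs : 0 < sqrt (Derive v x)) by now apply sqrt_lt_R0.
    assert (HG2 : G x <= x * / INR m).
    { pose proof (Rle_abs (G a)).
      assert (HGa : Rabs (G a) <= x * / (2 * INR m)).
      { apply Rle_div_r; lra. }
      replace (x * / INR m) with (x * / (2 * INR m) + x * / (2 * INR m)) by (field; lra).
      assert (0 < / (2 * INR m)) by (apply Rinv_0_lt_compat; lra).
      assert (0 < a) by (unfold a; lra). nra. }
    assert (HG3 : G x <= eps * x).
    { eapply Rle_trans; [exact HG2|]. rewrite Rmult_comm.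
      apply Rmult_le_compat_r; [unfold a in Hxa; lra|exact Hm2]. }
    unfold G in HG3. apply (Rle_div_l _ _ _ Hs) in HG3. lra.
  - exfalso.
    destruct (filter_and _ _ (filter_and _ _ HG (ring_ex_derive K v HK Hv))
      (filter_and _ _ HG'sq (filter_and _ _ H Hbase))) as [M HM].
    set (a := Rmax M 0 + 1).
    pose proof (Rmax_l M 0) as HaM. pose proof (Rmax_r M 0) as Ha0.
    assert (Hge : forall x, M < x -> / (2 * INR m) <= G' x).
    { intros x Hx. destruct (HM x Hx) as (_ & (H1 & H2 & H3) & H4 & _).
      apply Rnot_lt_le. intros Hlt.
      assert (Hlt1 : 2 * INR m * G' x < 1).
      { apply (Rmult_lt_compat_l (2 * INR m)) in Hlt; [|lra].
        rewrite Rinv_r in Hlt by lra. exact Hlt. }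
      assert (Hcube : 0 < Derive v x ^ 3) by now apply pow_lt.
      replace ((INR m * p x) ^ 2) with (INR m ^ 2 * p x ^ 2) in H4 by ring.
      rewrite <- H3 in H4.
      replace (INR m ^ 2 * (4 * G' x ^ 2 * Derive v x ^ 3))
        with ((2 * INR m * G' x) ^ 2 * Derive v x ^ 3) in H4 by ring.
      assert (Hsq : (2 * INR m * G' x) ^ 2 < 1).
      { assert (0 <= 2 * INR m * G' x) by (apply Rmult_le_pos; lra). nra. }
      nra. }
    set (c := 16 * INR m ^ 2).
    assert (Hc : 0 < c) by (unfold c; nra).
    set (b := 2 * a).
    assert (Hvw : forall x, b < x -> Derive v x / v x ^ 2 <= c / x ^ 2).
    { intros x Hx.
      assert (Hxa : 0 < a /\ a < x) by (unfold b, a in *; lra).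
      destruct (HM x ltac:(unfold a in *; lra)) as (_ & (H1 & _) & _ & H5 & _).
      pose proof (increment_le M (fun x => x * / (2 * INR m)) G (fun _ => / (2 * INR m)) G') as Hi.
      specialize (Hi ltac:(intros y Hy; auto_derive; [trivial|ring])
        ltac:(intros y Hy; apply HM, Hy) Hge a x ltac:(unfold a; lra) ltac:(lra)).
      cbv beta in Hi.
      assert (HGa : 0 < G a).
      { destruct (HM a ltac:(unfold a; lra)) as (_ & (Ha1 & _) & _ & Ha5 & _).
        unfold G. apply Rdiv_lt_0_compat; [exact Ha5|now apply sqrt_lt_R0]. }
      assert (Hi2 : 0 < / (2 * INR m)) by (apply Rinv_0_lt_compat; lra).
      assert (HGx : x / (4 * INR m) <= G x).
      { replace (x / (4 * INR m)) with (x / 2 * / (2 * INR m)) by (field; lra).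
        unfold b in Hx. nra. }
      assert (Hs : 0 < sqrt (Derive v x)) by now apply sqrt_lt_R0.
      assert (Ess : sqrt (Derive v x) * sqrt (Derive v x) = Derive v x)
        by (apply sqrt_sqrt; lra).
      unfold G in HGx. set (s := sqrt (Derive v x)) in *.
      apply (Rle_div_r _ _ _ Hs) in HGx.
      apply Rle_div_l; [nra|].
      replace (c / x ^ 2 * v x ^ 2) with ((4 * INR m / x * v x) ^ 2)
        by (unfold c; field; lra).
      rewrite <- Ess.
      assert (Hsx : s <= 4 * INR m / x * v x).
      { apply Rmult_le_reg_l with (x / (4 * INR m)).
        - apply Rdiv_lt_0_compat; lra.
        - replace (x / (4 * INR m) * (4 * INR m / x * v x)) with (v x) by (field; lra). lra. }
      nra. }
    assert (Hlow : forall x, b < x -> x / c <= v x).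
    { intros x Hx.
      assert (Hx0 : 0 < x) by (unfold b, a in *; lra).
      assert (Hvx : 0 < v x) by (apply HM; unfold b, a in *; lra).
      enough (Hinv : / v x <= c / x).
      { apply Rinv_le_contravar in Hinv; [|now apply Rinv_0_lt_compat].
        rewrite Rinv_inv in Hinv. replace (x / c) with (/ (c / x)) by (field; lra). exact Hinv. }
      apply Rnot_lt_le. intros Hgt.
      set (d := / v x - c / x). assert (Hd : 0 < d) by (unfold d; lra).
      apply (ultimately_false _ (filter_and _ _ (ultimately_gt x)
        (is_lim_p_infty_gt v Hinf (/ d)))).
      intros y [Hy1 Hy2].
      assert (Hd' : 0 < / d) by now apply Rinv_0_lt_compat.
      pose proof (increment_le b (fun x => - / v x) (fun x => - (c / x))
        (fun x => Derive v x / v x ^ 2) (fun x => c / x ^ 2)) as Hi.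
      assert (Hi' := Hi
        ltac:(intros z Hz; auto_derive;
          [split; [apply HM; unfold b, a in *; lra|];
           split; [assert (0 < v z) by (apply HM; unfold b, a in *; lra); lra|trivial]|
           change (Derive (fun y : R => v y) z) with (Derive v z); field;
           assert (0 < v z) by (apply HM; unfold b, a in *; lra); lra])
        ltac:(intros z Hz; auto_derive; [unfold b, a in *; lra|field; unfold b, a in *; lra])
        Hvw x y ltac:(lra) ltac:(lra)).
      cbv beta in Hi'.
      assert (Hvy : / v y < d).
      { rewrite <- (Rinv_inv d). apply Rinv_lt_contravar; [|exact Hy2]. nra. }
      assert (0 < c / y) by (apply Rdiv_lt_0_compat; lra).
      unfold d in Hvy. lra. }
    assert (Hc2 : 0 < / (2 * c)) by (apply Rinv_0_lt_compat; lra).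
    destruct (filter_and _ _ (ultimately_gt b) (is_lim_p_infty_eps _ _ Hlim _ Hc2)) as [N HN].
    set (x0 := Rmax N M + 1).
    pose proof (Rmax_l N M) as HNx. pose proof (Rmax_r N M) as HMx.
    apply (ultimately_false _ (filter_and _ _ (ultimately_gt x0)
        (ultimately_gt (2 * c * v x0)))).
    intros y [Hy1 Hy2].
    assert (Hb0 : 0 < b) by (unfold b, a; lra).
    destruct (HN x0 ltac:(unfold x0; lra)) as [Hbx0 _].
    destruct (MVT_above M v x0 y) as (z & Hz & Ez).
    { intros z Hz. apply HM, Hz. } { unfold x0; lra. } { lra. }
    destruct (HN z ltac:(unfold x0 in *; lra)) as [_ Hz'].
    rewrite Rminus_0_r in Hz'. pose proof (Rle_abs (Derive v z)) as Hz2.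
    specialize (Hlow y ltac:(lra)).
    apply (Rle_div_l _ _ _ Hc) in Hlow.
    assert (Derive v z * (y - x0) <= / (2 * c) * (y - x0)) by (apply Rmult_le_compat_r; lra).
    assert (Ec : c * (/ (2 * c) * (y - x0)) = (y - x0) / 2) by (field; lra).
    assert (c * v y <= c * v x0 + (y - x0) / 2) by (rewrite <- Ec; nra).
    lra.
Qed.

(** Iterated differences are values of derivatives, and monotonicity moves them to
    a common point. *)
Lemma slow_diff_of_ring K f k : Hardy_ring K -> K f ->
  is_lim (Derive_n f (S k)) p_infty p_infty ->
  is_lim (Derive_n f (S (S k))) p_infty 0 ->
  slow (diff (S k) (fun n => f (INR n))).
Proof.
  intros HK Hf Hinf Hlim.
  set (v := Derive_n f (S k)) in *.
  assert (Kv : K v) by now apply ring_Derive_n.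
  change (is_lim (Derive v) p_infty 0) in Hlim.
  pose proof (ring_Derive_pos K v HK Kv Hinf) as Hw.
  pose proof (ring_Derive_nonpos K _ HK (ring_Derive K HK v Kv) Hlim Hw) as Hw'.
  pose proof (ring_slow_ratio K v HK Kv Hinf Hlim) as Hratio.
  destruct (ring_smooth K HK f Hf) as [M HM]. change (smooth_on M f) in HM.
  set (u := fun n => f (INR n)).
  assert (Hu : forall j n, M < INR n -> exists xi, INR n <= xi <= INR n + INR j /\
      diff j u n = Derive_n f j xi) by (intros j n Hn; now apply (diff_Derive_n j f M)).
  destruct (ultimately_INR _ (filter_and _ _ (ultimately_gt M) (filter_and _ _ Hw Hw')))
    as [n0 Hn0].
  assert (HnM : forall n, (n0 <= n)%nat -> M < INR n).
  { intros n Hn. apply (Hn0 n Hn). lra. }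
  split; [|split; [|split]].
  - exists n0. intros n Hn. split.
    + destruct (Hu (S (S k)) n (HnM n Hn)) as (xi & Hxi & E).
      change (diff (S (S k)) u n) with (diff (S k) u (S n) - diff (S k) u n) in E.
      rewrite E. apply (Hn0 n Hn). lra.
    + destruct (Hu (S (S (S k))) n (HnM n Hn)) as (xi & Hxi & E).
      change (diff (S (S (S k))) u n) with ((diff (S k) u (S (S n)) - diff (S k) u (S n)) -
        (diff (S k) u (S n) - diff (S k) u n)) in E.
      enough (Derive_n f (S (S (S k))) xi <= 0) by lra.
      apply (Hn0 n Hn). lra.
  - apply (is_lim_along (Derive v)); [exact Hlim|]. exists n0. intros n Hn.
    destruct (Hu (S (S k)) n (HnM n Hn)) as (xi & Hxi & E).
    exists xi. split; [lra|exact E].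
  - apply (is_lim_along v); [exact Hinf|]. exists n0. intros n Hn.
    destruct (Hu (S k) n (HnM n Hn)) as (xi & Hxi & E).
    exists xi. split; [lra|exact E].
  - intros eps Heps.
    destruct (ultimately_INR _ (Hratio (eps / 2) ltac:(lra))) as [n1 Hn1].
    destruct (eventually_le_INR (INR (S (S k)))) as [n2 Hn2].
    exists (Nat.max n0 (Nat.max n1 n2)). intros N HN.
    assert (HNM := HnM N ltac:(lia)).
    set (y := INR N + INR (S (S k))).
    assert (Hy2 : y <= 2 * INR N) by (unfold y; specialize (Hn2 N ltac:(lia)); lra).
    pose proof (pos_INR (S (S k))) as Hk0.
    assert (Hk1 : INR (S k) <= INR (S (S k))) by (apply le_INR; lia).
    assert (Hconst : forall x, is_derive (fun _ : R => 0) x 0)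
      by (intros; apply (is_derive_const (V := R_NormedModule))).
    destruct (Hu (S k) N HNM) as (xi & Hxi & E1).
    destruct (Hu (S (S k)) N HNM) as (xi' & Hxi' & E2).
    change (diff (S (S k)) u N) with (diff (S k) u (S N) - diff (S k) u N) in E2.
    change (diff (S k) u N <= eps * (INR N * sqrt (diff (S k) u (S N) - diff (S k) u N))).
    rewrite E2, E1. change (Derive_n f (S k)) with v. change (Derive_n f (S (S k))) with (Derive v).
    (* [v] increases, [v'] decreases: compare with the right end point [y] *)
    assert (Hgt : forall x, INR N <= x -> M < x /\ 0 < Derive v x /\ Derive (Derive v) x <= 0).
    { intros x Hx. apply (Hn0 N ltac:(lia) x Hx). }
    assert (H1 : v xi <= v y).
    { destruct (Req_dec xi y) as [->|Hne]; [lra|].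
      assert (Hxy : xi < y) by (unfold y in *; lra).
      destruct (MVT_above M v xi y) as (c & Hc & Ec).
      { intros x Hx. exact (HM (S (S k)) x Hx). } { lra. } { exact Hxy. }
      destruct (Hgt c ltac:(lra)) as (_ & Hp & _). nra. }
    assert (H2 : Derive v y <= Derive v xi').
    { destruct (Req_dec xi' y) as [->|Hne]; [lra|].
      assert (Hxy : xi' < y) by (unfold y in *; lra).
      destruct (MVT_above M (Derive v) xi' y) as (c & Hc & Ec).
      { intros x Hx. exact (HM (S (S (S k))) x Hx). } { lra. } { exact Hxy. }
      destruct (Hgt c ltac:(lra)) as (_ & _ & Hp). nra. }
    specialize (Hn1 N ltac:(lia) y ltac:(unfold y; lra)).
    assert (H3 : sqrt (Derive v y) <= sqrt (Derive v xi')) by now apply sqrt_le_1_alt.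
    pose proof (sqrt_pos (Derive v y)) as H4.
    eapply Rle_trans; [exact H1|]. eapply Rle_trans; [exact Hn1|].
    replace (eps * (INR N * sqrt (Derive v xi')))
      with (eps / 2 * (2 * INR N * sqrt (Derive v xi'))) by field.
    apply Rmult_le_compat_l; [lra|].
    apply Rmult_le_compat; try lra. pose proof (pos_INR N). unfold y; lra.
Qed.

(** Otherwise [|g'| >= c x ^ k] with a constant sign of [g'], by comparability in
    [K], and integration contradicts the smallness of [g]. *)
Lemma ring_Derive_growth K g k : Hardy_ring K -> K g ->
  (forall eps, 0 < eps -> ultimately (fun x => Rabs (g x) <= eps * x ^ S k)) ->
  forall eps, 0 < eps -> ultimately (fun x => Rabs (Derive g x) <= eps * x ^ k).
Proof.
  intros HK Hg Hsmall eps Heps.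
  pose proof (ring_Derive K HK g Hg) as Hg'.
  destruct (eventually_le_INR (/ eps + 1)) as [m Hm]. specialize (Hm m (le_n m)).
  assert (He : 0 < / eps) by now apply Rinv_0_lt_compat.
  assert (Hm1 : 1 <= INR m) by lra.
  assert (Hm2 : / INR m <= eps).
  { rewrite <- (Rinv_inv eps). apply Rinv_le_contravar; lra. }
  assert (Kx : K (fun x => x ^ k)) by (apply (ring_pow K (fun x => x) k HK), (ring_id K HK)).
  assert (Hbig : forall h, K h -> (forall x, Rabs (h x) = Rabs (g x)) ->
    ultimately (fun x => x ^ k <= INR m * Derive h x) -> False).
  { intros h Hh Habs H.
    destruct (filter_and _ _ (ring_ex_derive K h HK Hh) H) as [M HM].
    assert (HSk : 1 <= INR (S k)) by (rewrite S_INR; pose proof (pos_INR k); lra).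
    set (C := 2 * (INR m * INR (S k))). assert (HC : 2 <= C) by (unfold C; nra).
    set (a := Rmax M 0 + 1).
    pose proof (Rmax_l M 0) as HaM. pose proof (Rmax_r M 0) as Ha0.
    assert (HC1 : 0 < / (2 * C)) by (apply Rinv_0_lt_compat; lra).
    assert (Hs := Hsmall (/ (2 * C)) HC1).
    set (p := fun x => x ^ S k * (2 * / C)).
    apply (ultimately_false _ (filter_and _ _ Hs (filter_and _ _ (ultimately_gt a)
      (filter_and _ _ (ultimately_gt 1) (ultimately_gt (C * (Rabs (h a) + Rabs (p a)))))))).
    intros x (H1 & H2 & H3 & H4).
    pose proof (increment_le M p h (fun x => x ^ k * / INR m) (Derive h)) as Hi.
    assert (Hp' : forall z, M < z -> is_derive p z (z ^ k * / INR m)).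
    { intros z _. unfold p, C. auto_derive; [trivial|].
      change (Nat.pred (S k)) with k.
      change (match k with 0%nat => 1 | S _ => INR k + 1 end) with (INR (S k)).
      field. lra. }
    assert (Hh' : forall z, M < z -> is_derive h z (Derive h z)).
    { intros z Hz. now apply Derive_correct, HM. }
    assert (Hle : forall z, M < z -> z ^ k * / INR m <= Derive h z).
    { intros z Hz. apply Rle_div_l; [lra|]. rewrite Rmult_comm. now apply HM. }
    specialize (Hi Hp' Hh' Hle a x ltac:(unfold a; lra) ltac:(lra)).
    rewrite <- Habs in H1.
    pose proof (Rle_abs (h x)). pose proof (Rle_abs (- h a)) as Ha2. rewrite Rabs_Ropp in Ha2.
    pose proof (Rle_abs (p a)).
    assert (Hxk : x <= x ^ S k).
    { simpl. pose proof (pow_R1_Rle x k ltac:(lra)). nra. }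
    assert (Hpx : p x = 2 * (x ^ S k * / C)) by (unfold p; ring).
    assert (Hq : / (2 * C) * x ^ S k = / 2 * (x ^ S k * / C)) by (field; lra).
    assert (Hr : x * / C <= x ^ S k * / C)
      by (apply Rmult_le_compat_r; [left; apply Rinv_0_lt_compat; lra|exact Hxk]).
    assert (Ht : Rabs (h a) + Rabs (p a) < x * / C).
    { apply Rlt_div_r; lra. }
    assert (0 < x * / C) by (apply Rmult_lt_0_compat; [lra|apply Rinv_0_lt_compat; lra]).
    lra. }
  assert (Hup : ultimately (fun x => INR m * Derive g x <= x ^ k)).
  { destruct (ring_compare K (fun x => INR m * Derive g x) (fun x => x ^ k) HK) as [H|H]; auto.
    - apply (ring_mult K HK (fun _ => INR m)); [now apply ring_INR|exact Hg'].
    - exfalso. now apply (Hbig g). }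
  assert (Hdown : ultimately (fun x => INR m * - Derive g x <= x ^ k)).
  { destruct (ring_compare K (fun x => INR m * - Derive g x) (fun x => x ^ k) HK) as [H|H]; auto.
    - apply (ring_mult K HK (fun _ => INR m)); [now apply ring_INR|now apply ring_opp].
    - exfalso. apply (Hbig (fun x => - g x)).
      + now apply ring_opp.
      + intros; apply Rabs_Ropp.
      + revert H. apply filter_imp. intros x Hx. now rewrite Derive_opp. }
  generalize (filter_and _ _ (ultimately_gt 0) (filter_and _ _ Hup Hdown)).
  apply filter_imp. intros x (H0 & H1 & H2).
  assert (Hxk : 0 < x ^ k) by now apply pow_lt.
  apply Rle_trans with (/ INR m * x ^ k); [|nra].
  apply Rmult_le_reg_l with (INR m); [lra|].
  rewrite <- (Rmult_assoc (INR m) (/ INR m)), Rinv_r, Rmult_1_l by lra.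
  rewrite <- (Rabs_pos_eq (INR m)) at 1 by lra. rewrite <- Rabs_mult.
  apply Rabs_le. lra.
Qed.

Lemma ring_Derive_n_vanishes K n : Hardy_ring K -> forall g, K g ->
  (forall eps, 0 < eps -> ultimately (fun x => Rabs (g x) <= eps * x ^ n)) ->
  is_lim (Derive_n g n) p_infty 0.
Proof.
  intros HK. induction n as [|n IH]; intros g Hg Hsmall.
  - apply is_lim_spec. intros [eps Heps].
    change (ultimately (fun x => Rabs (g x - 0) < eps)).
    assert (Heps2 : 0 < eps / 2) by lra.
    generalize (Hsmall _ Heps2). apply filter_imp.
    intros x Hx. rewrite Rminus_0_r. simpl in Hx. lra.
  - assert (H := IH (Derive g) (ring_Derive K HK g Hg) (ring_Derive_growth K g n HK Hg Hsmall)).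
    revert H. apply is_lim_ext. intros x. apply Derive_n_Derive.
Qed.

(** * Fourier expansion of periodic sequences *)

Lemma csum_single (z : nat -> C) r N :
  (1 <= r <= N)%nat -> (forall k, (1 <= k <= N)%nat -> k <> r -> z k = 0) -> csum z N = z r.
Proof.
  induction N as [|N IH]; intros Hr Hz; [lia|]. simpl.
  destruct (Nat.eq_dec r (S N)) as [->|Hne].
  - rewrite (csum_ext z (fun _ => RtoC 0)) by (intros; apply Hz; lia).
    rewrite csum_const. ring.
  - rewrite IH; [|lia|intros; apply Hz; lia]. rewrite (Hz (S N)) by lia. ring.
Qed.

Lemma root_of_unity_sum (Q : nat) (theta : R) (k : Z) :
  INR Q * theta = IZR k -> e theta <> 1 -> csum (fun a => e (INR a * theta)) Q = 0.
Proof.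
  intros HQ Hne.
  assert (H : Cmult (Cminus (e theta) 1) (csum (fun a => e (INR a * theta)) Q) = 0).
  { rewrite <- csum_scal.
    rewrite (csum_ext _ (fun a => Cminus (e (INR (S a) * theta)) (e (INR a * theta)))).
    - rewrite (csum_telescope (fun a => e (INR a * theta))).
      rewrite S_INR. replace ((INR Q + 1) * theta) with (INR 1 * theta + IZR k)
        by (rewrite <- HQ; simpl; ring).
      rewrite e_period. ring.
    - intros a _. rewrite S_INR, Rmult_plus_distr_r, Rmult_1_l, e_plus. ring. }
  destruct (classic (csum (fun a => e (INR a * theta)) Q = 0)) as [H0|H0]; [exact H0|].
  exfalso. apply (Cmult_neq_0 _ _ (Cminus_eq_contra _ _ Hne) H0 H).
Qed.

Lemma root_of_unity_sum_integer (Q : nat) (k : Z) :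
  csum (fun a => e (INR a * IZR k)) Q = RtoC (INR Q).
Proof.
  rewrite (csum_ext _ (fun _ => RtoC 1)); [rewrite csum_const; ring|].
  intros a _. rewrite INR_IZR_INZ, <- mult_IZR. apply e_IZR.
Qed.

Lemma e_fraction_neq_1 (Q : nat) (t : Z) :
  (- Z.of_nat Q < t < Z.of_nat Q)%Z -> t <> 0%Z -> e (IZR t / INR Q) <> 1.
Proof.
  intros Ht Ht0 He. destruct (e_eq_1_integer _ He) as [k Hk].
  assert (HQ : 0 < INR Q) by (apply lt_0_INR; lia).
  assert (E : IZR t = IZR (k * Z.of_nat Q)).
  { rewrite mult_IZR, <- INR_IZR_INZ, <- Hk. field. lra. }
  apply eq_IZR in E.
  destruct (Z_lt_le_dec k 0); [nia|]. destruct (Z.eq_dec k 0) as [->|]; nia.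
Qed.

Lemma periodic_multiple (w : nat -> C) (Q : nat) :
  (forall n, w (n + Q)%nat = w n) -> forall k n, w (n + k * Q)%nat = w n.
Proof.
  intros Hw k n. induction k as [|k IH]; [now rewrite Nat.add_0_r|].
  replace (n + S k * Q)%nat with (n + k * Q + Q)%nat by lia. now rewrite Hw.
Qed.

(** Inversion of the discrete Fourier transform on [Z / Q]. *)
Lemma periodic_Fourier (w : nat -> C) (Q : nat) :
  (1 <= Q)%nat -> (forall n, w (n + Q)%nat = w n) ->
  exists c : nat -> C, forall n, (1 <= n)%nat ->
    w n = csum (fun a => Cmult (c a) (e (INR a / INR Q * INR n))) Q.
Proof.
  intros HQ Hw.
  assert (HQ0 : 0 < INR Q) by (apply lt_0_INR; lia).
  exists (fun a => Cmult (RtoC (/ INR Q)) (csum (fun r => Cmult (w r) (e (- (INR a / INR Q * INR r)))) Q)).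
  intros n Hn.
  set (k := ((n - 1) / Q)%nat). set (r0 := ((n - 1) mod Q + 1)%nat).
  assert (En : n = (r0 + k * Q)%nat).
  { unfold r0, k. pose proof (Nat.div_mod_eq (n - 1) Q). nia. }
  assert (Hr0 : (1 <= r0 <= Q)%nat).
  { unfold r0. pose proof (Nat.mod_upper_bound (n - 1) Q ltac:(lia)). lia. }
  transitivity (Cmult (RtoC (/ INR Q)) (csum (fun r => Cmult (w r)
     (csum (fun a => e (INR a * (IZR (Z.of_nat n - Z.of_nat r) / INR Q))) Q)) Q)).
  - rewrite (csum_single _ r0 Q Hr0).
    + replace (IZR (Z.of_nat n - Z.of_nat r0) / INR Q) with (IZR (Z.of_nat k)).
      * rewrite root_of_unity_sum_integer.
        rewrite En, (periodic_multiple w Q Hw).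
        rewrite RtoC_inv by lra. field. intros H. apply RtoC_inj in H. lra.
      * replace (Z.of_nat n - Z.of_nat r0)%Z with (Z.of_nat k * Z.of_nat Q)%Z by lia.
        rewrite mult_IZR, <- (INR_IZR_INZ Q). field. lra.
    + intros r Hr Hne.
      rewrite (root_of_unity_sum Q _ (Z.of_nat n - Z.of_nat r)); [ring|field; lra|].
      replace (IZR (Z.of_nat n - Z.of_nat r) / INR Q)
        with (IZR (Z.of_nat r0 - Z.of_nat r) / INR Q + IZR (Z.of_nat k)).
      * rewrite e_period. apply e_fraction_neq_1; lia.
      * replace (Z.of_nat n - Z.of_nat r)%Z
          with (Z.of_nat r0 - Z.of_nat r + Z.of_nat k * Z.of_nat Q)%Z by lia.
        rewrite plus_IZR, mult_IZR, <- (INR_IZR_INZ Q). field. lra.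
  - rewrite (csum_ext (fun a => Cmult (Cmult _ _) _)
      (fun a => Cmult (RtoC (/ INR Q)) (csum (fun r => Cmult (w r)
         (e (INR a * (IZR (Z.of_nat n - Z.of_nat r) / INR Q)))) Q))).
    + rewrite csum_scal. f_equal. rewrite csum_exchange. apply csum_ext.
      intros r _. now rewrite csum_scal.
    + intros a _. rewrite <- Cmult_assoc. f_equal.
      rewrite Cmult_comm, <- csum_scal. apply csum_ext. intros r _.
      replace (INR a * (IZR (Z.of_nat n - Z.of_nat r) / INR Q))
        with (INR a / INR Q * INR n + - (INR a / INR Q * INR r)).
      * rewrite e_plus. ring.
      * rewrite minus_IZR, <- !INR_IZR_INZ. field. lra.
Qed.

Lemma pow_plus_modulus (n D k : nat) : exists M, ((n + D) ^ k = n ^ k + D * M)%nat.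
Proof.
  induction k as [|k [M HM]]; [exists 0%nat; simpl; lia|].
  exists (n * M + n ^ k + D * M)%nat. simpl. rewrite HM. ring.
Qed.

Lemma e_rational_monomial_periodic (q : Q) k n :
  e (Q2R q * INR (n + Pos.to_nat (Qden q)) ^ k) = e (Q2R q * INR n ^ k).
Proof.
  destruct (pow_plus_modulus n (Pos.to_nat (Qden q)) k) as [M HM].
  rewrite <- !pow_INR, HM, plus_INR, mult_INR.
  rewrite <- (e_period (Q2R q * INR (n ^ k)) (Qnum q * Z.of_nat M)).
  f_equal. rewrite mult_IZR, <- INR_IZR_INZ.
  rewrite (INR_IZR_INZ (Pos.to_nat (Qden q))), positive_nat_Z.
  unfold Q2R. field. apply not_0_IZR. discriminate.
Qed.

(** * Rational polynomials *)

Definition is_Qpoly (g : R -> R) : Prop := exists p : list Q, forall x, g x = Qpoly_eval p x.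

Lemma is_Qpoly_const q : is_Qpoly (fun _ => Q2R q).
Proof. exists (q :: nil). intros x. unfold Qpoly_eval; simpl. ring. Qed.

Lemma is_Qpoly_mul_id g : is_Qpoly g -> is_Qpoly (fun x => x * g x).
Proof.
  intros [p Hp]. exists (0%Q :: p). intros x. rewrite Hp.
  unfold Qpoly_eval; simpl. unfold Q2R at 2; simpl. lra.
Qed.

Lemma is_Qpoly_ext g h : (forall x, g x = h x) -> is_Qpoly g -> is_Qpoly h.
Proof. intros E [p Hp]. exists p. intros x. now rewrite <- E. Qed.

Lemma is_Qpoly_monomial q k : is_Qpoly (fun x => Q2R q * x ^ k).
Proof.
  induction k as [|k IH].
  - apply is_Qpoly_ext with (2 := is_Qpoly_const q). intros; simpl; ring.
  - apply is_Qpoly_ext with (2 := is_Qpoly_mul_id _ IH). intros; simpl; ring.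
Qed.

Lemma is_Qpoly_plus g h : is_Qpoly g -> is_Qpoly h -> is_Qpoly (fun x => g x + h x).
Proof.
  intros [p Hp] [q Hq].
  assert (H : forall p q : list Q, exists r, forall x,
     Qpoly_eval r x = Qpoly_eval p x + Qpoly_eval q x).
  { clear. induction p as [|a p IH]; intros [|b q].
    - exists nil. intros; unfold Qpoly_eval; simpl; ring.
    - exists (b :: q). intros; unfold Qpoly_eval; simpl; ring.
    - exists (a :: p). intros; unfold Qpoly_eval; simpl; ring.
    - destruct (IH q) as [r Hr]. exists ((a + b)%Q :: r). intros x.
      specialize (Hr x). unfold Qpoly_eval in *. simpl. rewrite Hr, Q2R_plus. ring. }
  destruct (H p q) as [r Hr]. exists r. intros x. now rewrite Hp, Hq, Hr.
Qed.

Lemma is_Qpoly_scal c g : is_Qpoly g -> is_Qpoly (fun x => Q2R c * g x).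
Proof.
  intros [p Hp]. exists (List.map (Qmult c) p). intros x. rewrite Hp. clear Hp.
  unfold Qpoly_eval. induction p as [|a p IH]; simpl; [ring|].
  rewrite <- IH, Q2R_mult. ring.
Qed.

Lemma ring_Qpoly K g : Hardy_ring K -> is_Qpoly g -> K g.
Proof.
  intros HK [p Hp]. apply (ring_germ K HK (Qpoly_eval p)).
  - apply germ_eq_pointwise. intros; now rewrite Hp.
  - clear Hp. induction p as [|a p IH].
    + apply (ring_INR K 0 HK).
    + apply (ring_plus K HK (fun _ => Q2R a) (fun x => x * Qpoly_eval p x)).
      * now apply ring_rational.
      * apply (ring_mult K HK (fun x => x)); [now apply ring_id|exact IH].
Qed.

(** * Exponential sums along germs far from the rational polynomials *)

(** Division-free form of [ln x / |f - g| -> 0]; it excludes [f = g]. *)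
Definition beyond_log (f : R -> R) : Prop :=
  forall g, is_Qpoly g ->
  forall eps, 0 < eps -> ultimately (fun x => ln x <= eps * Rabs (f x - g x)).

(** If [f - p] vanished near infinity, the hypothesis for [p + 1] would fail;
    otherwise [|f - p|] is eventually positive and can be cleared from the
    quotient. *)
Lemma beyond_log_of_lim K f : Hardy_ring K -> K f ->
  (forall p : list Q, is_lim (fun x => ln x / Rabs (f x - Qpoly_eval p x)) p_infty 0) ->
  beyond_log f.
Proof.
  intros HK Hf Hlog g [p Hp] eps Heps.
  assert (Kp : K (fun x => f x - g x)).
  { apply (ring_minus K f g HK Hf), (ring_Qpoly K); [exact HK|now exists p]. }
  assert (Hne : ultimately (fun x => f x - g x <> 0)).
  { destruct (ring_sign K HK _ Kp) as [H|[H|H]].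
    2, 3: revert H; apply filter_imp; intros; lra.
    exfalso.
    destruct (is_Qpoly_plus g (fun _ => Q2R 1)) as [r Hr].
    { now exists p. } { apply is_Qpoly_const. }
    pose proof (is_lim_p_infty_eps _ _ (Hlog r) 1 Rlt_0_1) as H1.
    apply (ultimately_false _ (filter_and _ _ (filter_and _ _ H H1) (ln_unbounded 1))).
    intros x ((E & H2) & H3). rewrite <- Hr in H2.
    replace (f x - (g x + Q2R 1)) with (-1) in H2 by (unfold Q2R; simpl; lra).
    rewrite Rabs_m1 in H2. pose proof (Rle_abs (ln x / 1 - 0)). lra. }
  generalize (filter_and _ _ Hne (is_lim_p_infty_eps _ _ (Hlog p) eps Heps)).
  apply filter_imp. intros x [Hx H]. rewrite <- Hp in H.
  apply Rabs_pos_lt in Hx. rewrite Rminus_0_r in H.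
  pose proof (Rle_abs (ln x / Rabs (f x - g x))).
  apply Rle_div_l; [exact Hx|]. lra.
Qed.

Lemma beyond_log_plus f h : is_Qpoly h -> beyond_log f -> beyond_log (fun x => f x + h x).
Proof.
  intros Hh Hf g Hg eps Heps.
  assert (Hgh : is_Qpoly (fun x => g x + Q2R (-1) * h x)).
  { apply (is_Qpoly_plus g (fun x => Q2R (-1) * h x)); [exact Hg|now apply is_Qpoly_scal]. }
  generalize (Hf _ Hgh eps Heps). apply filter_imp. intros x Hx.
  replace (f x + h x - g x) with (f x - (g x + Q2R (-1) * h x)); [exact Hx|].
  unfold Q2R; simpl; lra.
Qed.

Lemma beyond_log_scal f (c : Q) : ~ (c == 0)%Q -> beyond_log f -> beyond_log (fun x => Q2R c * f x).
Proof.
  intros Hc Hf g Hg eps Heps.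
  assert (Hc0 : Q2R c <> 0).
  { intros H. apply Hc, eqR_Qeq. rewrite H. unfold Q2R; simpl; lra. }
  pose proof (Rabs_pos_lt _ Hc0) as Hc1.
  assert (He : 0 < eps * Rabs (Q2R c)) by nra.
  generalize (Hf _ (is_Qpoly_scal (/ c) g Hg) _ He). apply filter_imp. intros x Hx.
  rewrite Rmult_assoc, <- Rabs_mult in Hx.
  replace (Q2R c * f x - g x) with (Q2R c * (f x - Q2R (/ c) * g x)); [exact Hx|].
  rewrite Q2R_inv by exact Hc. field. exact Hc0.
Qed.

Lemma Derive_n_smooth_plus M f g n x :
  smooth_on M f -> smooth_on M g -> M < x ->
  Derive_n (fun y => f y + g y) n x = Derive_n f n x + Derive_n g n x.
Proof.
  intros Hf Hg Hx. apply Derive_n_plus; apply (locally_above M); auto.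
Qed.

Lemma smooth_on_monomial M c k : smooth_on M (fun x => c * x ^ k).
Proof. intros n x _. apply ex_derive_n_scal_l, ex_derive_n_pow. Qed.

Lemma mean_zero_e_opp u : mean_zero (fun n => e (- u n)) -> mean_zero (fun n => e (u n)).
Proof.
  intros H. apply mean_zero_ext with (2 := mean_zero_conj _ H).
  intros n _. now rewrite e_opp, Cconj_conj.
Qed.

Lemma lim_diff K f k (l : Rbar) : Hardy_ring K -> K f ->
  is_lim (Derive_n f k) p_infty l -> is_lim_seq (diff k (fun n => f (INR n))) l.
Proof.
  intros HK Hf Hl. destruct (ring_smooth K HK f Hf) as [M HM].
  apply (is_lim_along _ _ _ Hl).
  destruct (ultimately_INR _ (ultimately_gt M)) as [n0 Hn0]. exists n0. intros n Hn.
  destruct (diff_Derive_n k f M n HM) as (xi & Hxi & E); [apply (Hn0 n Hn); lra|].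
  exists xi. split; [lra|exact E].
Qed.

(** Removing a rational leading term [q x ^ k]: the factor [e (q n ^ k)] is
    periodic, hence a combination of the characters [e (a n / Q)]. *)
Lemma mean_zero_e_rational_shift (f : R -> R) (q : Q) (k : nat) :
  (forall a : Q, mean_zero (fun n => e (f (INR n) + - Q2R q * INR n ^ k + Q2R a * INR n))) ->
  mean_zero (fun n => e (f (INR n))).
Proof.
  intros H.
  destruct (periodic_Fourier (fun n => e (Q2R q * INR n ^ k)) (Pos.to_nat (Qden q)))
    as [c Hc].
  - lia.
  - intros n. apply e_rational_monomial_periodic.
  - set (Q := Pos.to_nat (Qden q)) in *.
    assert (HQ : 0 < INR Q) by (apply lt_0_INR; unfold Q; lia).
    apply mean_zero_ext with (fun n => csum (fun a => Cmult (c a)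
      (e (f (INR n) + - Q2R q * INR n ^ k + INR a / INR Q * INR n))) Q).
    + intros n Hn.
      transitivity (e ((f (INR n) + - Q2R q * INR n ^ k) + Q2R q * INR n ^ k));
        [|f_equal; ring].
      rewrite (e_plus _ (Q2R q * INR n ^ k)), (Hc n Hn), <- csum_scal.
      apply csum_ext. intros a _.
      rewrite (e_plus (f (INR n) + - Q2R q * INR n ^ k)). ring.
    + apply mean_zero_csum. intros a _. apply mean_zero_scal.
      apply mean_zero_ext with (2 := H (Z.of_nat a # Qden q)).
      intros n _. f_equal. f_equal. f_equal. unfold Q2R; cbn [Qnum Qden].
      unfold Rdiv. rewrite <- INR_IZR_INZ. unfold Q.
      now rewrite (INR_IZR_INZ (Pos.to_nat (Qden q))), positive_nat_Z.
Qed.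

Lemma Derive_n_monomial_top k x c : Derive_n (fun y => c * y ^ k) k x = c * INR (Factorial.fact k).
Proof.
  rewrite Derive_n_scal_l. f_equal.
  rewrite Derive_n_pow_smalli by lia. rewrite Nat.sub_diag. simpl. field.
Qed.

Lemma Derive_n_linear k x c : Derive_n (fun y => c * y) (S (S k)) x = 0.
Proof.
  rewrite Derive_n_scal_l.
  rewrite (Derive_n_ext (fun y => y) (fun y => y ^ 1)) by (intros; ring).
  rewrite Derive_n_pow_bigi by lia. ring.
Qed.

(** Boshernitzan's theorem, by induction on the order of a derivative that
    vanishes at infinity, with cases according to the limit [c] of the preceding
    derivative. *)
Theorem mean_zero_e_of_vanishing_derivative K : Hardy_ring K -> forall d f, K f -> beyond_log f ->
  is_lim (Derive_n f d) p_infty 0 -> mean_zero (fun n => e (f (INR n))).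
Proof.
  intros HK.
  assert (Hlog0 : forall f, beyond_log f ->
     forall eps, 0 < eps -> ultimately (fun x => ln x <= eps * Rabs (f x))).
  { intros f Hf eps Heps. generalize (Hf _ (is_Qpoly_const 0) eps Heps).
    apply filter_imp. intros x. replace (f x - Q2R 0) with (f x); [trivial|].
    unfold Q2R; simpl; lra. }
  induction d as [|d IH]; intros f Hf Hlog Hlim.
  { exfalso. simpl in Hlim.
    apply (ultimately_false _ (filter_and _ _ (Hlog0 f Hlog 1 Rlt_0_1)
      (filter_and _ _ (is_lim_p_infty_eps _ _ Hlim 1 Rlt_0_1) (ln_unbounded 1)))).
    intros x (H1 & H2 & H3). rewrite Rminus_0_r in H2. lra. }
  destruct d as [|j].
  { apply (mean_zero_e_flat K); auto. }
  destruct (ring_limit K _ HK (ring_Derive_n K f (S j) HK Hf)) as [[c| |] Hc].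
  - destruct (classic (exists q : Q, c = Q2R q)) as [[q Hq]|Hirr].
    2: { apply (mean_zero_e_irrational_diff j _ c).
         - now apply (lim_diff K).
         - intros q Hq. apply Hirr. now exists q. }
    destruct (classic (j = 0%nat /\ forall k : Z, c <> IZR k)) as [[-> Hnz]|Hcase].
    { apply mean_zero_e_of_difference with c; [|exact Hnz].
      now apply (lim_diff K f 1). }
    (* [q0 x ^ (j + 1)] has [(j + 1)]-st derivative [c] *)
    set (F := INR (Factorial.fact (S j))).
    assert (HF : F <> 0) by apply INR_fact_neq_0.
    set (FQ := inject_Z (Z.of_nat (Factorial.fact (S j)))).
    assert (EF : Q2R FQ = F).
    { unfold FQ, F, Q2R; simpl. rewrite INR_IZR_INZ. field. }
    assert (HFQ : ~ (FQ == 0)%Q).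
    { intros H. apply Qeq_eqR in H. rewrite EF in H. apply HF. rewrite H.
      unfold Q2R; simpl; lra. }
    set (q0 := (q / FQ)%Q).
    assert (Eq0 : Q2R q0 * F = c).
    { unfold q0. rewrite Q2R_div, EF by exact HFQ. rewrite Hq. field. exact HF. }
    assert (Hg : forall a : Q, (j = 0%nat -> a = 0%Q) ->
       mean_zero (fun n => e (f (INR n) + - Q2R q0 * INR n ^ S j + Q2R a * INR n))).
    { intros a Ha.
      set (m := fun x => - Q2R q0 * x ^ S j). set (l := fun x => Q2R a * x).
      assert (Qm : is_Qpoly m).
      { apply is_Qpoly_ext with (2 := is_Qpoly_monomial (- q0) (S j)).
        intros x. unfold m. now rewrite Q2R_opp. }
      assert (Ql : is_Qpoly l).
      { apply is_Qpoly_ext with (2 := is_Qpoly_monomial a 1). intros x. unfold l. ring. }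
      apply (IH (fun x => f x + m x + l x)).
      - apply (ring_plus K HK (fun x => f x + m x)); [|now apply ring_Qpoly].
        apply (ring_plus K HK f m Hf). now apply ring_Qpoly.
      - apply (beyond_log_plus (fun x => f x + m x) l Ql). now apply beyond_log_plus.
      - destruct (ring_smooth K HK f Hf) as [M HM].
        assert (Sm : smooth_on M m) by apply smooth_on_monomial.
        assert (Sl : smooth_on M l).
        { apply smooth_on_ext with (2 := smooth_on_monomial M (Q2R a) 1).
          intros x _. unfold l. ring. }
        assert (El : forall x, Derive_n l (S j) x = 0).
        { intros x. destruct j as [|j]; [|apply Derive_n_linear].
          unfold l. rewrite (Ha eq_refl), Derive_n_scal_l.
          unfold Q2R; simpl. lra. }
        apply is_lim_ext_loc with (fun x => Derive_n f (S j) x + - c).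
        + exists M. intros x Hx.
          rewrite (Derive_n_smooth_plus M (fun x => f x + m x) l)
            by (auto using smooth_on_plus).
          rewrite (Derive_n_smooth_plus M f m) by assumption.
          rewrite El. unfold m. rewrite Derive_n_monomial_top. fold F.
          rewrite <- Eq0. ring.
        + replace (Finite 0) with (Finite (c + - c)) by (f_equal; ring).
          apply is_lim_plus'; [exact Hc|apply is_lim_const]. }
    destruct j as [|j].
    + assert (Hint : exists k : Z, c = IZR k).
      { apply NNPP. intros Hn. apply Hcase. split; [reflexivity|].
        intros k Hk. apply Hn. now exists k. }
      destruct Hint as [k Hk].
      apply mean_zero_ext with (2 := Hg 0%Q (fun _ => eq_refl)).
      intros n _.
      rewrite <- (e_period (f (INR n)) (- k * Z.of_nat n)).
      f_equal. rewrite mult_IZR, <- INR_IZR_INZ, opp_IZR.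
      assert (E1 : Q2R q0 = IZR k) by (rewrite <- Hk, <- Eq0; unfold F; simpl; ring).
      rewrite E1. unfold Q2R; simpl. lra.
    + apply (mean_zero_e_rational_shift f q0 (S (S j))). intros a. apply Hg. discriminate.
  - apply (mean_zero_e_slow_diff j). now apply (slow_diff_of_ring K).
  - apply mean_zero_e_opp.
    apply (mean_zero_e_slow_diff j (fun n => - f (INR n))).
    apply (slow_diff_of_ring K (fun x => - f x)); [exact HK|now apply ring_opp| |].
    + apply is_lim_ext with (fun x => - Derive_n f (S j) x).
      * intros x. now rewrite Derive_n_opp.
      * apply (is_lim_opp _ _ _ Hc).
    + apply is_lim_ext with (fun x => - Derive_n f (S (S j)) x).
      * intros x. now rewrite Derive_n_opp.
      * replace (Finite 0) with (Rbar_opp 0) by (simpl; f_equal; ring).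
        apply (is_lim_opp _ _ _ Hlim).
Qed.

(** Multiples by [h] and linear twists stay away from the rational polynomials. *)
Theorem mean_zero_e_twisted K f (h : nat) (alpha : Q) : Hardy_ring K -> K f ->
  subpolynomial f -> beyond_log f -> (1 <= h)%nat ->
  mean_zero (fun n => e (INR h * f (INR n) + Q2R alpha * INR n)).
Proof.
  intros HK Hf (d & Hd & Hsub) Hlog Hh.
  set (hq := inject_Z (Z.of_nat h)).
  assert (Eh : Q2R hq = INR h).
  { unfold hq, Q2R; simpl. rewrite INR_IZR_INZ. field. }
  assert (Hh0 : 1 <= INR h) by (apply (le_INR 1); lia).
  assert (Hhq : ~ (hq == 0)%Q).
  { intros H. apply Qeq_eqR in H. rewrite Eh in H. unfold Q2R in H; simpl in H. lra. }
  set (l := fun x => Q2R alpha * x).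
  assert (Ql : is_Qpoly l).
  { apply is_Qpoly_ext with (2 := is_Qpoly_monomial alpha 1). intros x. unfold l. ring. }
  set (g := fun x => Q2R hq * f x + l x).
  assert (Kg : K g).
  { apply (ring_plus K HK (fun x => Q2R hq * f x)); [|now apply ring_Qpoly].
    apply (ring_mult K HK (fun _ => Q2R hq)); [now apply ring_rational|exact Hf]. }
  apply mean_zero_ext with (fun n => e (g (INR n))).
  { intros n _. unfold g, l. now rewrite Eh. }
  apply (mean_zero_e_of_vanishing_derivative K HK (S d) g Kg).
  { apply (beyond_log_plus (fun x => Q2R hq * f x) l Ql). now apply beyond_log_scal. }
  apply (ring_Derive_n_vanishes K (S d) HK g Kg).
  intros eps Heps.
  assert (He1 : 0 < eps / (2 * INR h)) by (apply Rdiv_lt_0_compat; lra).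
  generalize (filter_and _ _ (is_lim_p_infty_eps _ _ Hsub _ He1)
    (filter_and _ _ (ultimately_gt 1) (ultimately_gt (2 * Rabs (Q2R alpha) / eps)))).
  apply filter_imp. intros x (H1 & H2 & H3).
  assert (Hxd : 0 < x ^ d) by (apply pow_lt; lra).
  assert (Hf1 : Rabs (f x) <= eps / (2 * INR h) * x ^ d).
  { rewrite Rminus_0_r in H1. unfold Rdiv at 1 in H1.
    rewrite Rabs_mult, Rabs_inv, (Rabs_pos_eq (x ^ d)) in H1 by lra.
    apply (Rmult_lt_compat_r (x ^ d)) in H1; [|exact Hxd].
    rewrite Rmult_assoc, Rinv_l in H1 by lra. lra. }
  assert (Hxx : x ^ d <= x ^ S d) by (simpl; nra).
  assert (Hx1 : x <= x ^ d).
  { rewrite <- (pow_1 x) at 1. apply Rle_pow; [lra|exact Hd]. }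
  assert (Hx2 : x * x <= x ^ S d) by (simpl; nra).
  unfold g, l. rewrite Eh. eapply Rle_trans; [apply Rabs_triang|].
  rewrite !Rabs_mult, (Rabs_pos_eq (INR h)), (Rabs_pos_eq x) by lra.
  apply (Rmult_lt_compat_l eps) in H3; [|lra].
  replace (eps * (2 * Rabs (Q2R alpha) / eps)) with (2 * Rabs (Q2R alpha)) in H3 by (field; lra).
  assert (Hb1 : INR h * Rabs (f x) <= eps / 2 * x ^ d).
  { apply (Rmult_le_compat_l (INR h)) in Hf1; [|lra].
    replace (INR h * (eps / (2 * INR h) * x ^ d)) with (eps / 2 * x ^ d) in Hf1 by (field; lra).
    exact Hf1. }
  assert (Hb2 : Rabs (Q2R alpha) * x <= eps / 2 * (x * x)) by nra.
  nra.
Qed.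

(** * Weyl's criterion *)

Definition dirichlet (K : nat) (t : R) : C := csum (fun h => e (INR h * t)) K.

Lemma dirichlet_S K t : dirichlet (S K) t = Cmult (e t) (Cplus 1 (dirichlet K t)).
Proof.
  unfold dirichlet. induction K as [|K IH].
  - cbn [csum]. replace (INR 1 * t) with t by (simpl; ring). ring.
  - set (D := csum (fun h => e (INR h * t)) (S K)) in *. cbn [csum] in IH |- *.
    change (Cplus (csum (fun h => e (INR h * t)) K) (e (INR (S K) * t))) with D.
    rewrite IH at 1. unfold D; cbn [csum].
    replace (INR (S (S K)) * t) with (t + INR (S K) * t) by (rewrite (S_INR (S K)); ring).
    rewrite e_plus. ring.
Qed.

Lemma dirichlet_square K t :
  Cmod (dirichlet K t) ^ 2 =
  INR K + rsum (fun j => 2 * (INR K - INR j) * Re (e (INR j * t))) K.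
Proof.
  induction K as [|K IH].
  - unfold dirichlet; simpl. rewrite Cmod_0. ring.
  - rewrite dirichlet_S, Cmod_mult, Cmod_e, Rmult_1_l.
    assert (E1 : Cmod (Cplus 1 (dirichlet K t)) ^ 2 =
      1 + Cmod (dirichlet K t) ^ 2 + 2 * Re (dirichlet K t)).
    { rewrite Cmod2_plus, Cmod_1.
      assert (E : Re (Cmult 1 (Cconj (dirichlet K t))) = Re (dirichlet K t))
        by (rewrite Cmult_1_l; apply re_conj).
      rewrite E. ring. }
    assert (E2 : Re (dirichlet K t) = rsum (fun j => Re (e (INR j * t))) K).
    { unfold dirichlet. clear. induction K as [|K IH]; [reflexivity|].
      cbn [csum rsum]. rewrite <- IH. reflexivity. }
    rewrite E1, IH, E2. cbn [rsum].
    rewrite (rsum_ext (fun j => 2 * (INR (S K) - INR j) * Re (e (INR j * t)))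
      (fun j => 2 * (INR K - INR j) * Re (e (INR j * t)) + 2 * Re (e (INR j * t))))
      by (intros; rewrite S_INR; ring).
    rewrite rsum_plus, rsum_scal, !S_INR. ring.
Qed.

(** A geometric sum. *)
Lemma dirichlet_decay K t d : 0 < d -> d <= Cmod (Cminus (e t) 1) ->
  Cmod (dirichlet K t) ^ 2 <= 4 / d ^ 2.
Proof.
  intros Hd Hle.
  assert (E : Cmult (Cminus (e t) 1) (dirichlet K t) = Cminus (e (INR (S K) * t)) (e (INR 1 * t))).
  { unfold dirichlet. rewrite <- csum_scal, <- (csum_telescope (fun h => e (INR h * t))).
    apply csum_ext. intros h _. rewrite S_INR, Rmult_plus_distr_r, Rmult_1_l, e_plus. ring. }
  apply (f_equal Cmod) in E. rewrite Cmod_mult in E.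
  assert (H2 : Cmod (Cminus (e (INR (S K) * t)) (e (INR 1 * t))) <= 2).
  { unfold Cminus. eapply Rle_trans; [apply Cmod_triangle|].
    rewrite Cmod_opp, !Cmod_e. lra. }
  rewrite <- E in H2.
  pose proof (Cmod_ge_0 (dirichlet K t)) as H0.
  set (y := Cmod (dirichlet K t)) in *.
  assert (H3 : d * y <= 2) by nra.
  apply (Rle_div_r _ _ (d ^ 2)); [apply pow_lt; lra|].
  replace (y ^ 2 * d ^ 2) with ((d * y) ^ 2) by ring.
  assert (0 <= d * y) by nra. nra.
Qed.

(** The Fejer kernel, normalized so that its [K] translates by [r / K] form a
    partition of unity. *)
Definition bump (K : nat) (t : R) : R := Cmod (dirichlet K t) ^ 2 / INR K ^ 2.

Lemma bump_pos K t : (1 <= K)%nat -> 0 <= bump K t.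
Proof.
  intros HK. unfold bump. apply Rmult_le_pos; [apply pow2_ge_0|].
  left. apply Rinv_0_lt_compat, pow_lt, lt_0_INR. lia.
Qed.

Lemma rsum_exchange (r : nat -> nat -> R) N K :
  rsum (fun n => rsum (fun k => r n k) K) N = rsum (fun k => rsum (fun n => r n k) N) K.
Proof.
  induction N as [|N IH]; simpl.
  - rewrite rsum_const. ring.
  - rewrite IH, <- rsum_plus. reflexivity.
Qed.

Lemma Re_csum z N : Re (csum z N) = rsum (fun n => Re (z n)) N.
Proof. induction N as [|N IH]; [reflexivity|]. cbn [csum rsum]. now rewrite <- IH. Qed.

Lemma bump_partition K t : (1 <= K)%nat -> rsum (fun r => bump K (t - INR r / INR K)) K = 1.
Proof.
  intros HK. assert (HK0 : 0 < INR K) by (apply lt_0_INR; lia).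
  unfold bump, Rdiv.
  rewrite (rsum_ext _ (fun r => / INR K ^ 2 * (INR K + rsum (fun j => 2 * (INR K - INR j) *
     Re (e (INR j * (t - INR r * / INR K)))) K)))
    by (intros; rewrite dirichlet_square; ring).
  rewrite rsum_scal, rsum_plus, rsum_const, rsum_exchange.
  rewrite (rsum_ext _ (fun _ => 0)).
  - rewrite rsum_const. field. lra.
  - intros j Hj. rewrite rsum_scal.
    destruct (Nat.eq_dec j K) as [->|Hne]; [ring|].
    rewrite <- Re_csum.
    rewrite (csum_ext _ (fun r => Cmult (e (INR j * t)) (e (INR r * (IZR (- Z.of_nat j) / INR K))))).
    + rewrite csum_scal, (root_of_unity_sum K _ (- Z.of_nat j)).
      * rewrite Cmult_0_r. simpl. ring.
      * field. lra.
      * apply e_fraction_neq_1; lia.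
    + intros r _. rewrite <- e_plus. f_equal.
      rewrite opp_IZR, <- INR_IZR_INZ. field. lra.
Qed.

Lemma bump_average (x : nat -> R) K t : (1 <= K)%nat ->
  (forall h, (1 <= h)%nat -> mean_zero (fun n => e (INR h * x n))) ->
  mean_zero (fun n => RtoC (bump K (x n - t) - / INR K)).
Proof.
  intros HK Hx. assert (HK0 : 0 < INR K) by (apply lt_0_INR; lia).
  apply mean_zero_ext with (fun n => csum (fun j => Cmult (RtoC (/ INR K ^ 2 * (2 * (INR K - INR j))))
     (RtoC (Re (Cmult (e (- (INR j * t))) (e (INR j * x n)))))) K).
  - intros n _. unfold bump, Rdiv. rewrite dirichlet_square.
    rewrite (csum_ext _ (fun j => RtoC (/ INR K ^ 2 * (2 * (INR K - INR j) *
      Re (e (INR j * (x n - t))))))).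
    + rewrite csum_RtoC, rsum_scal. f_equal. field. lra.
    + intros j _. rewrite <- e_plus, <- RtoC_mult. f_equal.
      replace (- (INR j * t) + INR j * x n) with (INR j * (x n - t)) by ring. ring.
  - apply mean_zero_csum. intros j Hj.
    apply mean_zero_scal, mean_zero_Re, mean_zero_scal, Hx. lia.
Qed.

Lemma indicator_true (P : nat -> Prop) n : P n -> indicator P n = 1.
Proof. intros H. unfold indicator. destruct (excluded_middle_informative (P n)); tauto. Qed.

Lemma indicator_false (P : nat -> Prop) n : ~ P n -> indicator P n = 0.
Proof. intros H. unfold indicator. destruct (excluded_middle_informative (P n)); tauto. Qed.

Lemma indicator_pos (P : nat -> Prop) n : 0 <= indicator P n.
Proof. unfold indicator. destruct (excluded_middle_informative (P n)); lra. Qed.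

Lemma count_upto_rsum P N : INR (count_upto P N) = rsum (indicator P) N.
Proof.
  unfold count_upto. induction N as [|N IH]; [reflexivity|].
  rewrite seq_S, filter_app, length_app, plus_INR, IH. cbn [rsum]. f_equal.
  unfold indicator. simpl.
  destruct (excluded_middle_informative (P (S N))); reflexivity.
Qed.

(** The minimum makes the statement inductive in [K]; it is used with [B <= K]. *)
Lemma count_integers_between A B K : 0 <= A ->
  Rmin (INR K) (B - 1) - A <= rsum (indicator (fun r => A <= INR r <= B)) K.
Proof.
  intros HA. induction K as [|K IH].
  - simpl. pose proof (Rmin_l 0 (B - 1)). lra.
  - cbn [rsum].
    assert (Hpos : 0 <= rsum (indicator (fun r => A <= INR r <= B)) K)
      by (apply rsum_pos; intros; apply indicator_pos).
    pose proof (indicator_pos (fun r => A <= INR r <= B) (S K)) as Hp.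
    rewrite S_INR. unfold Rmin in *.
    destruct (Rle_dec A (INR (S K))) as [H1|H1].
    + destruct (Rle_dec (INR (S K)) B) as [H2|H2]; rewrite S_INR in *.
      * rewrite indicator_true by (rewrite S_INR; lra).
        destruct (Rle_dec (INR K) (B - 1)), (Rle_dec (INR K + 1) (B - 1)); lra.
      * destruct (Rle_dec (INR K) (B - 1)), (Rle_dec (INR K + 1) (B - 1)); lra.
    + rewrite S_INR in H1.
      destruct (Rle_dec (INR K + 1) (B - 1)); lra.
Qed.

(** A sum of bumps centred well inside [[a, b)] is a lower approximation of the
    indicator function of [[a, b)]; since all points lie in [[0, 1)], these bumps
    do not wrap around the circle. *)
Lemma Weyl_lower_bound (x : nat -> R) :
  (forall n, 0 <= x n < 1) ->
  (forall h, (1 <= h)%nat -> mean_zero (fun n => e (INR h * x n))) ->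
  forall a b, 0 <= a -> b <= 1 -> forall eps, 0 < eps ->
  exists N0, forall N, (N0 <= N)%nat ->
    (b - a - eps) * INR N <= rsum (indicator (fun n => a <= x n < b)) N.
Proof.
  intros Hx01 Hx a b Ha Hb eps Heps.
  set (d := eps / 8). assert (Hd : 0 < d) by (unfold d; lra).
  assert (Hd2 : 0 < d ^ 2) by now apply pow_lt.
  destruct (eventually_le_INR (4 * (4 / d ^ 2 + 1) / eps + 1)) as [K HK].
  specialize (HK K (le_n K)).
  assert (H4 : 0 < 4 / d ^ 2) by (apply Rdiv_lt_0_compat; lra).
  assert (HK1 : 1 <= INR K).
  { assert (0 < 4 * (4 / d ^ 2 + 1) / eps) by (apply Rdiv_lt_0_compat; lra). lra. }
  assert (HKn : (1 <= K)%nat) by (apply INR_le; simpl; lra).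
  assert (HKeps : (4 / d ^ 2 + 1) / INR K <= eps / 4).
  { apply Rle_div_l; [lra|]. apply (Rmult_le_compat_l (eps / 4)) in HK; [|lra].
    replace (eps / 4 * (4 * (4 / d ^ 2 + 1) / eps + 1)) with (4 / d ^ 2 + 1 + eps / 4) in HK
      by (field; lra). lra. }
  set (R := indicator (fun r => INR K * (a + d) <= INR r <= INR K * (b - d))).
  set (p := fun n => rsum (fun r => R r * bump K (x n - INR r / INR K)) K).
  assert (Hp : forall n, p n <= indicator (fun n => a <= x n < b) n + 4 / d ^ 2 / INR K).
  { intros n. unfold p.
    assert (Hbp : forall r, 0 <= bump K (x n - INR r / INR K)) by (intros; now apply bump_pos).
    assert (HR : forall r, 0 <= R r <= 1).
    { intros r. unfold R, indicator. destruct (excluded_middle_informative _); lra. }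
    assert (Hc : 0 < 4 / d ^ 2 / INR K) by (apply Rdiv_lt_0_compat; lra).
    destruct (classic (a <= x n < b)) as [Hin|Hout].
    - rewrite indicator_true by exact Hin.
      apply Rle_trans with (rsum (fun r => bump K (x n - INR r / INR K)) K).
      + apply rsum_le. intros r _. specialize (Hbp r). specialize (HR r). nra.
      + rewrite bump_partition by exact HKn. lra.
    - rewrite indicator_false by exact Hout.
      replace (0 + 4 / d ^ 2 / INR K) with (INR K * (4 / d ^ 2 / INR K ^ 2)) by (field; lra).
      rewrite <- rsum_const. apply rsum_le. intros r _.
      assert (Hc2 : 0 < 4 / d ^ 2 / INR K ^ 2) by (apply Rdiv_lt_0_compat; [lra|apply pow_lt; lra]).
      destruct (classic (INR K * (a + d) <= INR r <= INR K * (b - d))) as [Hr|Hr].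
      + unfold R. rewrite indicator_true, Rmult_1_l by exact Hr.
        unfold bump. apply Rmult_le_compat_r; [left; apply Rinv_0_lt_compat, pow_lt; lra|].
        apply dirichlet_decay; [exact Hd|].
        assert (Hr' : a + d <= INR r / INR K <= b - d).
        { split; [apply Rle_div_r; lra|apply Rle_div_l; lra]. }
        specialize (Hx01 n).
        apply Cmod_e_sub_1_away; [lra|].
        destruct (Rlt_le_dec (x n) a) as [H|H].
        * rewrite Rabs_left1 by lra. lra.
        * assert (b <= x n) by (apply Rnot_lt_le; intros H'; apply Hout; lra).
          rewrite Rabs_pos_eq by lra. lra.
      + unfold R. rewrite indicator_false, Rmult_0_l by exact Hr. lra. }
  assert (HRK : INR K * (b - a - 2 * d) - 1 <= rsum R K).
  { pose proof (count_integers_between (INR K * (a + d)) (INR K * (b - d)) K) as HR.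
    assert (H0 : 0 <= INR K * (a + d)) by nra. specialize (HR H0). fold R in HR.
    rewrite Rmin_right in HR by nra. nra. }
  assert (Havg : mean_zero (fun n => RtoC (p n - rsum R K / INR K))).
  { apply mean_zero_ext with (fun n => csum (fun r => Cmult (RtoC (R r))
       (RtoC (bump K (x n - INR r / INR K) - / INR K))) K).
    - intros n _. rewrite (csum_ext _ (fun r => RtoC (R r * bump K (x n - INR r / INR K)
         + - / INR K * R r))).
      + rewrite csum_RtoC, rsum_plus, rsum_scal. unfold p. f_equal. field. lra.
      + intros r _. rewrite <- RtoC_mult. f_equal. ring.
    - apply mean_zero_csum. intros r _. apply mean_zero_scal. now apply bump_average. }
  destruct (Havg (eps / 4)) as [N0 HN0]; [lra|]. exists N0. intros N HN.
  specialize (HN0 N HN). rewrite csum_RtoC, Cmod_R in HN0.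
  pose proof (Rabs_maj2 (rsum (fun n => p n - rsum R K / INR K) N)) as Hm.
  rewrite (rsum_ext _ (fun n => p n + - (rsum R K / INR K))) in Hm by (intros; ring).
  rewrite (rsum_ext _ (fun n => p n + - (rsum R K / INR K))) in HN0 by (intros; ring).
  rewrite rsum_plus, rsum_const in Hm.
  rewrite rsum_plus, rsum_const in HN0.
  assert (Hle := rsum_le _ _ N (fun n _ => Hp n)).
  rewrite rsum_plus, rsum_const in Hle.
  change (rsum (fun n => p n) N) with (rsum p N) in *.
  change (rsum (fun n => indicator (fun n => a <= x n < b) n) N)
    with (rsum (indicator (fun n => a <= x n < b)) N) in Hle.
  set (I := rsum (indicator (fun n => a <= x n < b)) N) in *.
  pose proof (pos_INR N) as HNp.
  assert (Hq : b - a - 2 * d - / INR K <= rsum R K / INR K).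
  { apply Rle_div_r; [lra|].
    replace ((b - a - 2 * d - / INR K) * INR K) with (INR K * (b - a - 2 * d) - 1)
      by (field; lra). exact HRK. }
  assert (Hfin : (b - a - eps) + 4 / d ^ 2 / INR K + eps / 4 <= rsum R K / INR K).
  { replace ((4 / d ^ 2 + 1) / INR K) with (4 / d ^ 2 / INR K + / INR K) in HKeps
      by (field; lra).
    unfold d in *. lra. }
  assert (INR N * ((b - a - eps) + 4 / d ^ 2 / INR K + eps / 4) <= INR N * (rsum R K / INR K))
    by (now apply Rmult_le_compat_l).
  lra.
Qed.

(** The lower bounds for [[0, a)], [[a, b)] and [[b, 1)] add up to 1, so they are
    also upper bounds. *)
Lemma Weyl_criterion (x : nat -> R) :
  (forall n, 0 <= x n < 1) ->
  (forall h, (1 <= h)%nat -> mean_zero (fun n => e (INR h * x n))) ->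
  uniformly_distributed x.
Proof.
  intros Hx01 Hx a b Ha Hab Hb.
  apply eps_is_lim_seq. intros eps Heps.
  pose proof (Weyl_lower_bound x Hx01 Hx) as HL.
  destruct (HL a b Ha Hb (eps / 2)) as [N1 H1]; [lra|].
  destruct (HL 0 a ltac:(lra) ltac:(lra) (eps / 2)) as [N2 H2]; [lra|].
  destruct (HL b 1 ltac:(lra) ltac:(lra) (eps / 2)) as [N3 H3]; [lra|].
  exists (Nat.max 1 (Nat.max N1 (Nat.max N2 N3))). intros N HN.
  specialize (H1 N ltac:(lia)). specialize (H2 N ltac:(lia)). specialize (H3 N ltac:(lia)).
  assert (HN0 : 0 < INR N) by (apply lt_0_INR; lia).
  rewrite count_upto_rsum.
  assert (Hsum : rsum (indicator (fun n => 0 <= x n < a)) N +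
     rsum (indicator (fun n => a <= x n < b)) N +
     rsum (indicator (fun n => b <= x n < 1)) N = INR N).
  { rewrite <- !rsum_plus. rewrite (rsum_ext _ (fun _ => 1)); [rewrite rsum_const; ring|].
    intros n _. unfold indicator. specialize (Hx01 n).
    destruct (excluded_middle_informative (0 <= x n < a)),
      (excluded_middle_informative (a <= x n < b)),
      (excluded_middle_informative (b <= x n < 1)); lra. }
  set (I := rsum (indicator (fun n => a <= x n < b)) N) in *.
  apply Rabs_le. split.
  - enough (b - a - eps <= I / INR N) by lra. apply Rle_div_r; [exact HN0|]. nra.
  - enough (I / INR N <= b - a + eps) by lra. apply Rle_div_l; [exact HN0|]. nra.
Qed.

(** * Rational Besicovitch sequences *)

Lemma sum_n_m_rsum (r : nat -> R) N : sum_n_m r 1 N = rsum r N.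
Proof.
  induction N as [|N IH]; [apply (sum_n_m_zero r); lia|].
  rewrite sum_n_Sm by lia. rewrite IH. reflexivity.
Qed.

Lemma sum_n_m_csum (z : nat -> C) N : sum_n_m z 1 N = csum z N.
Proof.
  induction N as [|N IH]; [apply (sum_n_m_zero z); lia|].
  rewrite sum_n_Sm by lia. rewrite IH. reflexivity.
Qed.

Lemma LimSup_lt_eventually (v : nat -> R) (c : R) :
  Rbar_lt (LimSup_seq v) c -> exists N0, forall n, (N0 <= n)%nat -> v n < c.
Proof.
  intros H. pose proof (proj2_sig (ex_LimSup_seq v)) as Hc. fold (LimSup_seq v) in Hc.
  destruct (LimSup_seq v) as [l| |]; simpl in H.
  - assert (Hlc : 0 < c - l) by lra.
    destruct (Hc (mkposreal _ Hlc)) as [_ [N0 HN0]]. exists N0. intros n Hn.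
    specialize (HN0 n Hn). simpl in HN0. lra.
  - easy.
  - destruct (Hc c) as [N0 HN0]. now exists N0.
Qed.

Lemma lt_LimSup_frequently (v : nat -> R) :
  Rbar_lt 0 (LimSup_seq v) ->
  exists d, 0 < d /\ forall N, exists n, (N <= n)%nat /\ d < v n.
Proof.
  intros H. pose proof (proj2_sig (ex_LimSup_seq v)) as Hc. fold (LimSup_seq v) in Hc.
  destruct (LimSup_seq v) as [l| |]; simpl in H.
  - assert (Hl : 0 < l / 2) by lra. exists (l / 2). split; [exact Hl|]. intros N.
    destruct (proj1 (Hc (mkposreal _ Hl)) N) as (n & Hn & Hv). exists n. split; [exact Hn|].
    simpl in Hv. lra.
  - exists 1. split; [lra|]. intros N. destruct (Hc 1 N) as (n & Hn & Hv). now exists n.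
  - easy.
Qed.

Lemma rational_trig_poly_csum k alpha c n :
  rational_trig_poly k alpha c n = csum (fun j => Cmult (c j) (e (Q2R (alpha j) * INR n))) k.
Proof.
  unfold rational_trig_poly. rewrite sum_n_m_csum. apply csum_ext. intros j _.
  unfold e. f_equal. f_equal. ring.
Qed.

Lemma rational_character_mean (alpha : Q) :
  exists t : C, mean_zero (fun n => Cminus (e (Q2R alpha * INR n)) t).
Proof.
  destruct (classic (exists k : Z, Q2R alpha = IZR k)) as [[k Hk]|Hn].
  - exists 1. apply mean_zero_ext with (2 := mean_zero_0). intros n _.
    rewrite Hk, INR_IZR_INZ, <- mult_IZR, e_IZR. ring.
  - exists 0. apply mean_zero_ext with (fun n => e (Q2R alpha * INR n)).
    + intros n _. ring.
    + apply mean_zero_e_of_difference with (Q2R alpha).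
      * apply is_lim_seq_ext with (fun _ => Q2R alpha); [|apply is_lim_seq_const].
        intros n. rewrite S_INR. ring.
      * intros k Hk. apply Hn. now exists k.
Qed.

Lemma rational_trig_poly_mean k alpha c :
  exists t : C, mean_zero (fun n => Cminus (rational_trig_poly k alpha c n) t).
Proof.
  assert (H : forall k, exists t : C, mean_zero (fun n =>
     Cminus (csum (fun j => Cmult (c j) (e (Q2R (alpha j) * INR n))) k) t)).
  { clear k. induction k as [|k [t Ht]].
    - exists 0. apply mean_zero_ext with (2 := mean_zero_0). intros n _. simpl. ring.
    - destruct (rational_character_mean (alpha (S k))) as [s Hs].
      exists (Cplus t (Cmult (c (S k)) s)).
      apply mean_zero_ext with (2 := mean_zero_plus _ _ Ht (mean_zero_scal (c (S k)) _ Hs)).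
      intros n _. simpl. ring. }
  destruct (H k) as [t Ht]. exists t. apply mean_zero_ext with (2 := Ht).
  intros n _. now rewrite rational_trig_poly_csum.
Qed.

Lemma Besicovitch_approximation (g : nat -> C) : rational_Besicovitch_ap g ->
  forall eps, 0 < eps -> exists k alpha c N0, forall N, (N0 <= N)%nat ->
    rsum (fun n => Cmod (Cminus (g n) (rational_trig_poly k alpha c n))) N <= eps * INR N.
Proof.
  intros Hg eps Heps. destruct (Hg eps Heps) as (k & alpha & c & _ & H).
  apply LimSup_lt_eventually in H. destruct H as [N0 HN0].
  exists k, alpha, c, (S N0). intros N HN. specialize (HN0 N ltac:(lia)).
  rewrite sum_n_m_rsum in HN0.
  assert (HNp : 0 < INR N) by (apply lt_0_INR; lia).
  left. now apply Rlt_div_l.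
Qed.

Lemma Besicovitch_mean_zero (g z : nat -> C) :
  rational_Besicovitch_ap g -> (forall n, Cmod (z n) = 1) ->
  (forall alpha : Q, mean_zero (fun n => Cmult (z n) (e (Q2R alpha * INR n)))) ->
  mean_zero (fun n => Cmult (g n) (z n)).
Proof.
  intros Hg Hz Hza eps Heps.
  destruct (Besicovitch_approximation g Hg (eps / 2)) as (k & alpha & c & N1 & H1); [lra|].
  assert (HT : mean_zero (fun n => Cmult (rational_trig_poly k alpha c n) (z n))).
  { apply mean_zero_ext with
      (fun n => csum (fun j => Cmult (c j) (Cmult (z n) (e (Q2R (alpha j) * INR n)))) k).
    - intros n _. rewrite rational_trig_poly_csum, (Cmult_comm _ (z n)), <- csum_scal.
      apply csum_ext. intros; ring.
    - apply mean_zero_csum. intros j _. apply mean_zero_scal, Hza. }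
  destruct (HT (eps / 2)) as [N2 H2]; [lra|].
  exists (Nat.max N1 N2). intros N HN.
  specialize (H1 N ltac:(lia)). specialize (H2 N ltac:(lia)).
  set (T := rational_trig_poly k alpha c) in *.
  replace (csum (fun n => Cmult (g n) (z n)) N) with
    (Cplus (csum (fun n => Cmult (Cminus (g n) (T n)) (z n)) N)
           (csum (fun n => Cmult (T n) (z n)) N)).
  - eapply Rle_trans; [apply Cmod_triangle|].
    assert (H3 : Cmod (csum (fun n => Cmult (Cminus (g n) (T n)) (z n)) N) <= eps / 2 * INR N).
    { eapply Rle_trans; [apply Cmod_csum_le|].
      rewrite (rsum_ext _ (fun n => Cmod (Cminus (g n) (T n)))); [exact H1|].
      intros n _. rewrite Cmod_mult, Hz. ring. }
    lra.
  - rewrite <- csum_plus. apply csum_ext. intros; ring.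
Qed.

(** The averages of an almost periodic function form a Cauchy sequence; hence
    positive upper density implies positive lower density. *)
Lemma Besicovitch_positive_lower_density (A : nat -> Prop) :
  rational_Besicovitch_ap (fun m => RtoC (indicator A m)) ->
  Rbar_lt 0 (upper_density A) ->
  exists d, 0 < d /\ exists N0, forall N, (N0 <= N)%nat -> d * INR N <= rsum (indicator A) N.
Proof.
  intros Hap Hup.
  destruct (lt_LimSup_frequently _ Hup) as (d & Hd & Hfreq).
  exists (d / 2). split; [lra|].
  destruct (Besicovitch_approximation _ Hap (d / 8)) as (k & alpha & c & N1 & H1); [lra|].
  destruct (rational_trig_poly_mean k alpha c) as [t Ht].
  set (T := rational_trig_poly k alpha c) in *.
  destruct (Ht (d / 8)) as [N2 H2]; [lra|].
  assert (H : forall N, (Nat.max N1 N2 <= N)%nat ->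
    Rabs (rsum (indicator A) N - Re t * INR N) <= d / 4 * INR N).
  { intros N HN. specialize (H1 N ltac:(lia)). specialize (H2 N ltac:(lia)).
    assert (H3 : Cmod (Cminus (RtoC (rsum (indicator A) N)) (Cmult (RtoC (INR N)) t))
       <= d / 4 * INR N).
    { replace (Cminus (RtoC (rsum (indicator A) N)) (Cmult (RtoC (INR N)) t))
        with (Cplus (csum (fun n => Cminus (RtoC (indicator A n)) (T n)) N)
                    (csum (fun n => Cminus (T n) t) N)).
      - eapply Rle_trans; [apply Cmod_triangle|].
        pose proof (Cmod_csum_le (fun n => Cminus (RtoC (indicator A n)) (T n)) N). lra.
      - rewrite !csum_minus, csum_const.
        rewrite csum_RtoC. ring. }
    eapply Rle_trans; [|exact H3].
    eapply Rle_trans; [|apply re_le_Cmod]. right. f_equal.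
    destruct t as [t1 t2]. unfold Cminus, Cplus, Copp, Cmult, RtoC, Re; cbn [fst snd]. ring. }
  destruct (Hfreq (S (Nat.max N1 N2))) as (M & HM & HdM).
  rewrite count_upto_rsum in HdM.
  assert (HMp : 0 < INR M) by (apply lt_0_INR; lia).
  apply Rlt_div_r in HdM; [|exact HMp].
  pose proof (H M ltac:(lia)) as HM1.
  pose proof (Rle_abs (rsum (indicator A) M - Re t * INR M)) as HM2.
  assert (Hre : 3 / 4 * d <= Re t).
  { apply Rmult_le_reg_r with (INR M); [exact HMp|]. lra. }
  exists (Nat.max N1 N2). intros N HN.
  pose proof (H N HN) as HN1.
  pose proof (Rabs_maj2 (rsum (indicator A) N - Re t * INR N)) as HN2.
  pose proof (pos_INR N).
  assert (3 / 4 * d * INR N <= Re t * INR N) by (apply Rmult_le_compat_r; lra).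
  lra.
Qed.

Lemma csum_gap (z : nat -> C) a b : (a < b)%nat ->
  (forall m, (a < m < b)%nat -> z m = 0) -> csum z b = Cplus (csum z a) (z b).
Proof.
  intros Hab Hz. destruct b as [|b]; [lia|]. simpl. f_equal.
  assert (Hk : forall k, (a + k <= b)%nat -> csum z (a + k) = csum z a).
  { induction k as [|k IH]; intros Hk; [now rewrite Nat.add_0_r|].
    rewrite Nat.add_succ_r. simpl. rewrite IH by lia. rewrite Hz by lia. ring. }
  replace b with (a + (b - a))%nat by lia. apply Hk. lia.
Qed.

Lemma increasing_le (u : nat -> nat) :
  (forall k, (1 <= k)%nat -> (u k < u (S k))%nat) ->
  forall i j, (1 <= i <= j)%nat -> (u i <= u j)%nat.
Proof.
  intros Hu i j [Hi Hij]. induction Hij as [|j Hij IH]; [lia|].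
  specialize (Hu j ltac:(lia)). lia.
Qed.

Lemma csum_over_range (u : nat -> nat) (F : nat -> C) :
  (forall k, (1 <= k)%nat -> (1 <= u k)%nat) ->
  (forall k, (1 <= k)%nat -> (u k < u (S k))%nat) ->
  forall K, (1 <= K)%nat ->
  csum (fun m => Cmult (RtoC (indicator (seq_range u) m)) (F m)) (u K) =
  csum (fun k => F (u k)) K.
Proof.
  intros Hu1 Hinc.
  pose proof (increasing_le u Hinc) as Hmon.
  assert (Hin : forall k, (1 <= k)%nat -> indicator (seq_range u) (u k) = 1).
  { intros k Hk. apply indicator_true. now exists k. }
  induction K as [|K IH]; intros HK; [lia|].
  destruct K as [|K].
  - rewrite (csum_gap _ 0 (u 1%nat)).
    + simpl. rewrite Hin by lia. ring.
    + specialize (Hu1 1%nat (le_n 1)). lia.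
    + intros m Hm. rewrite indicator_false; [ring|].
      intros (k & Hk & E). specialize (Hmon 1%nat k ltac:(lia)). lia.
  - rewrite (csum_gap _ (u (S K)) (u (S (S K)))).
    + rewrite IH by lia. cbn [csum]. rewrite Hin by lia. ring.
    + apply Hinc. lia.
    + intros m Hm. rewrite indicator_false; [ring|].
      intros (k & Hk & E). destruct (Nat.le_gt_cases k (S K)) as [Hle|Hgt].
      * specialize (Hmon k (S K) ltac:(lia)). lia.
      * specialize (Hmon (S (S K)) k ltac:(lia)). lia.
Qed.

(** The first [K] terms fill the range up to [u K], and [u K = O(K)] by the density
    hypothesis. *)
Lemma mean_zero_along_range (u : nat -> nat) (F : nat -> C) :
  (forall k, (1 <= k)%nat -> (1 <= u k)%nat) ->
  (forall k, (1 <= k)%nat -> (u k < u (S k))%nat) ->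
  (exists d, 0 < d /\ exists N0, forall N, (N0 <= N)%nat ->
     d * INR N <= rsum (indicator (seq_range u)) N) ->
  mean_zero (fun m => Cmult (RtoC (indicator (seq_range u) m)) (F m)) ->
  mean_zero (fun k => F (u k)).
Proof.
  intros Hu1 Hinc (d & Hd & N1 & H1) HF eps Heps.
  destruct (HF (eps * d)) as [N2 H2]; [nra|].
  exists (Nat.max 1 (Nat.max N1 N2)). intros K HK.
  assert (Hge : forall k, (1 <= k)%nat -> (k <= u k)%nat).
  { induction k as [|k IH]; intros Hk; [lia|].
    destruct k as [|k]; [apply Hu1; lia|].
    specialize (IH ltac:(lia)). specialize (Hinc (S k) ltac:(lia)). lia. }
  specialize (Hge K ltac:(lia)).
  specialize (H1 (u K) ltac:(lia)). specialize (H2 (u K) ltac:(lia)).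
  rewrite csum_over_range in H2 by (auto; lia).
  assert (EK : rsum (indicator (seq_range u)) (u K) = INR K).
  { apply RtoC_inj. rewrite <- csum_RtoC.
    rewrite (csum_ext _ (fun m => Cmult (RtoC (indicator (seq_range u) m)) 1))
      by (intros; ring).
    rewrite (csum_over_range u (fun _ => RtoC 1)) by (auto; lia).
    rewrite csum_const. ring. }
  rewrite EK in H1.
  eapply Rle_trans; [exact H2|]. rewrite Rmult_assoc.
  apply Rmult_le_compat_l; lra.
Qed.

Lemma e_INR_frac_part h y : e (INR h * frac_part y) = e (INR h * y).
Proof.
  rewrite <- (e_period (INR h * frac_part y) (Z.of_nat h * Int_part y)).
  f_equal. rewrite mult_IZR, <- INR_IZR_INZ. unfold frac_part. ring.
Qed.

(* If f x = p x, the quotient below is 0 by convention.  This does not enlarge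
   the class of admissible f: a germ f in a Hardy field agreeing with p at
   arbitrarily large x agrees with p eventually, and then the hypothesis fails
   for p + 1. *)
Theorem corollary4p10 (f : R -> R) (n : nat -> nat)
    (hf_sub : subpolynomial f)
    (hf_hardy : in_some_Hardy_field f)
    (hn : rational_Besicovitch_sequence n)
    (hlog : forall p : list Q,
        is_lim (fun x => ln x / Rabs (f x - Qpoly_eval p x)) p_infty 0) :
  uniformly_distributed (fun k => frac_part (f (INR (n k)))).
Proof.
  destruct hf_hardy as (H & HH & Hf).
  destruct hn as (Hn1 & Hinc & Hap & Hup).
  pose proof (Hardy_ring_adjoin_id H HH) as HK.
  set (K := fun u => exists d, poly_over H d u) in HK.
  assert (Kf : K f) by (exists 0%nat; exact Hf).
  pose proof (beyond_log_of_lim K f HK Kf hlog) as Hlog.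
  pose proof (Besicovitch_positive_lower_density _ Hap Hup) as Hdens.
  apply Weyl_criterion.
  - intros k. destruct (base_fp (f (INR (n k)))). lra.
  - intros h Hh.
    apply mean_zero_ext with (fun k => e (INR h * f (INR (n k)))).
    { intros k _. now rewrite e_INR_frac_part. }
    apply (mean_zero_along_range n (fun m => e (INR h * f (INR m)))); auto.
    apply Besicovitch_mean_zero.
    + exact Hap.
    + intros m. apply Cmod_e.
    + intros alpha.
      apply mean_zero_ext with (fun m => e (INR h * f (INR m) + Q2R alpha * INR m)).
      * intros m _. apply e_plus.
      * now apply (mean_zero_e_twisted K).
Qed.
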